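(* Let $H>0$. Suppose that $A_n$ ($n\ge 1$) are positive numbers for which there exist $\delta>0$, $T_0$, and a positive increasing function $\Phi$ on the positive integers such that $$\frac1M\sum_{n=T}^{T+M}A_n\asymp\Phi(T)\qquad\text{whenever } T\ge T_0,\quad \frac{T}{(\log\log T)^{1+\delta}}\le M\le T .$$ Then $$\lim_{N\to\infty}\ \min_{|a_n|\le A_n}\ \int_0^H\left|1+\sum_{n=2}^N a_n n^{it-1}\right|^2dt>0$$ if and only if $$\sum_{n=2}^\infty\frac{\log\Phi(n)}{n\log^2 n}<\infty .$$
   Context: Here $T$ and $M$ are positive integers, and $\asymp$ means that the ratio of the two sides lies between two positive constants independent of $T$ and $M$. For each $N$ the minimum is taken over all complex numbers $a_2,\dots,a_N$ with $|a_n|\le A_n$ for $2\le n\le N$. *)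

(* Defs.v *)
From Stdlib Require Import Reals.
From Coquelicot Require Export Coquelicot.
Open Scope R_scope.

Definition Cexp (z : C) : C :=
  (exp (Re z) * cos (Im z), exp (Re z) * sin (Im z)).

(* [n^s = exp (s log n)] for an integer [n >= 1] and complex [s]. *)
Definition nat_cpow (n : nat) (s : C) : C := Cexp (s * RtoC (ln (INR n)))%C.

Definition dirichlet_poly (a : nat -> C) (N : nat) (t : R) : C :=
  (1 + sum_n_m (fun n => a n * nat_cpow n (Ci * RtoC t - 1)) 2 N)%C.

(* The integrand is continuous in [t], so [RInt] is the genuine integral. *)
Definition mean_square (H : R) (a : nat -> C) (N : nat) : R :=
  RInt (fun t => Cmod (dirichlet_poly a N t) ^ 2) 0 H.

(* Only the values [a 2], ..., [a N] matter, so a whole sequence [a] encodes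
   the tuple [(a_2, ..., a_N)]. *)
Definition mean_square_values (A : nat -> R) (H : R) (N : nat) (v : R) : Prop :=
  exists a : nat -> C,
    (forall n : nat, (2 <= n <= N)%nat -> Cmod (a n) <= A n) /\
    v = mean_square H a N.

Definition is_minimum (E : R -> Prop) (m : R) : Prop :=
  E m /\ forall v : R, E v -> m <= v.

(* [T] is large enough and [T / (log log T)^(1 + delta) <= M <= T].  For [T <= 2],
   where [log log T] is not positive, [Rpower] takes the value [1]; this affects
   only finitely many pairs [(T, M)], all excluded as soon as [T0 > 2]. *)
Definition admissible_window (delta T0 : R) (T M : nat) : Prop :=
  (1 <= T)%nat /\ (1 <= M)%nat /\ T0 <= INR T /\
  INR T / Rpower (ln (ln (INR T))) (1 + delta) <= INR M /\ (M <= T)%nat.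

Definition window_mean (A : nat -> R) (T M : nat) : R :=
  / INR M * sum_n_m A T (T + M).

Definition asymp_on (P : nat -> nat -> Prop) (f g : nat -> nat -> R) : Prop :=
  exists c C : R, 0 < c /\ 0 < C /\
    forall T M : nat, P T M -> c * g T M <= f T M <= C * g T M.

(* Main.v *)
Require Import Defs.
From mathcomp Require all_boot all_order all_algebra qpoly Rstruct.
From Stdlib Require Import Arith Factorial Reals Lra Lia List Classical ClassicalEpsilon.
From Coquelicot Require Import Coquelicot.
Open Scope R_scope.

(** Pair the Dirichlet polynomial with functions on [[0, H]]; with [x = log n]
    the sum becomes the logarithmic integral of [log Phi(e^x) / x^2].

    If the sum converges, there are convolutions of boxes of total width below
    [H / 4] whose transforms at [log n] decay like [1 / Phi(n)], up to a summable
    factor. Smoothing by them leaves a sum [1 + sum b_n n^(it)] with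
    [sum |b_n|] bounded independently of [N]; by a two-constants argument in the
    upper half-plane such a sum cannot be small on an interval.

    If the limit is positive, the variational inequality for the minimiser [f]
    bounds [sum A_n/n |F(log n)|], where [F(z)] is the integral of
    [conj f(t) e^(izt)] over [[0, H]]. Every short window thus contains a [log n]
    at which [|F|] is [O(1 / Phi(n))]. These points are denser than the type of
    [F] allows, so Lagrange interpolation spreads the decay to a half-line, and
    Jensen's inequality for [F] in the half-plane bounds the logarithmic
    integral. *)

(** Analyticity enters only through finite exponential sums with nonnegative frequencies. Both
    half-plane arguments are maximum principles for [ln (|F|^2 + eta)] plus explicit harmonic
    kernels; [eta > 0] removes the singularities at the zeros of F.

    The implication from a positive limit must be uniform, because the minimiser changes with [N]:
    the weights, [eta] and the range of the samples are fixed first, and only then is [N] taken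
    large. The kernels stand over the points [j ln 2], with weights proportional to the decay
    exponents capped at [j]. For weights of linear growth the tail [x^(-2)] of the Poisson kernel
    would sum to a logarithm, hence a kernel whose boundary values decay like [x^(-4)].
    Interpolation from samples of size [e^(-W)] uses about [W / 7] nodes: since [48 < e^6], a decay
    [e^(-W/7)] survives.

    In the converse, grouping [n] by powers of 2 turns the series into the sum of [W j / j^2], and
    grouping [j] again turns it into the sum of [W (2^k) / 2^k], which up to constants is the total
    width of the boxes. *)

(** * Finite sums over lists *)

Definition rsum {I : Type} (f : I -> R) (l : list I) : R :=
  fold_right (fun i s => f i + s) 0 l.

Lemma rsum_cons {I : Type} (f : I -> R) i l : rsum f (i :: l) = f i + rsum f l.
Proof. reflexivity. Qed.

Lemma rsum_app {I : Type} (f : I -> R) l1 l2 :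
  rsum f (l1 ++ l2) = rsum f l1 + rsum f l2.
Proof. induction l1 as [|i l IH]; [unfold rsum; simpl; lra|]. change ((i :: l) ++ l2) with (i :: (l ++ l2)). rewrite !rsum_cons, IH; lra. Qed.

Lemma rsum_map {I J : Type} (f : J -> R) (h : I -> J) l :
  rsum f (map h l) = rsum (fun i => f (h i)) l.
Proof. induction l as [|i l IH]; [reflexivity|]. simpl map. now rewrite !rsum_cons, IH. Qed.

Lemma rsum_le {I : Type} (f g : I -> R) l :
  (forall i, In i l -> f i <= g i) -> rsum f l <= rsum g l.
Proof.
  induction l as [|i l IH]; intros h; [apply Rle_refl|].
  rewrite !rsum_cons. apply Rplus_le_compat; [apply h; now left|].
  apply IH; intros j hj; apply h; now right.
Qed.

Lemma rsum_ext {I : Type} (f g : I -> R) l :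
  (forall i, In i l -> f i = g i) -> rsum f l = rsum g l.
Proof. intros h; apply Rle_antisym; apply rsum_le; intros i hi; rewrite h; auto; lra. Qed.

Lemma rsum_plus {I : Type} (f g : I -> R) l :
  rsum (fun i => f i + g i) l = rsum f l + rsum g l.
Proof. induction l as [|i l IH]; [unfold rsum; simpl; lra|]. rewrite !rsum_cons, IH; lra. Qed.

Lemma rsum_scal {I : Type} c (f : I -> R) l :
  rsum (fun i => c * f i) l = c * rsum f l.
Proof. induction l as [|i l IH]; [unfold rsum; simpl; lra|]. rewrite !rsum_cons, IH; lra. Qed.

Lemma rsum_minus {I : Type} (f g : I -> R) l :
  rsum (fun i => f i - g i) l = rsum f l - rsum g l.
Proof. induction l as [|i l IH]; [unfold rsum; simpl; lra|]. rewrite !rsum_cons, IH; lra. Qed.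

Lemma rsum_nonneg {I : Type} (f : I -> R) l :
  (forall i, In i l -> 0 <= f i) -> 0 <= rsum f l.
Proof.
  intros h. rewrite <- (Rmult_0_l (rsum f l)), <- rsum_scal.
  apply rsum_le; intros i hi; rewrite Rmult_0_l; auto.
Qed.

Lemma rsum_abs {I : Type} (f : I -> R) l :
  Rabs (rsum f l) <= rsum (fun i => Rabs (f i)) l.
Proof.
  induction l as [|i l IH]; [unfold rsum; simpl; rewrite Rabs_R0; lra|].
  rewrite !rsum_cons. eapply Rle_trans; [apply Rabs_triang|lra].
Qed.

Lemma rsum_exchange {I J : Type} (f : I -> J -> R) (l : list I) (k : list J) :
  rsum (fun i => rsum (f i) k) l = rsum (fun j => rsum (fun i => f i j) l) k.
Proof.
  induction l as [|i l IH].
  - symmetry. rewrite (rsum_ext _ (fun _ => 0 * 0)) by (intros; unfold rsum; simpl; lra).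
    rewrite rsum_scal. unfold rsum at 2; simpl; lra.
  - rewrite rsum_cons, IH, <- rsum_plus. reflexivity.
Qed.

Lemma rsum_const {I : Type} c (l : list I) : rsum (fun _ => c) l = INR (length l) * c.
Proof.
  induction l as [|i l IH]; [unfold rsum; simpl; lra|].
  rewrite rsum_cons, IH. change (length (i :: l)) with (S (length l)). rewrite S_INR; lra.
Qed.

Lemma rsum_incl_le {I : Type} (f : I -> R) l1 l2 :
  (forall i, In i l2 -> 0 <= f i) -> rsum f l1 <= rsum f (l1 ++ l2).
Proof. intros h. rewrite rsum_app. pose proof (rsum_nonneg f l2 h). lra. Qed.

(** * Minima over compact sets *)

(** [compactness_value] is about nested tuples, while points are handled here as sequences of which
    only the first [n] entries count; these two maps translate. *)
Fixpoint tn_seq (n : nat) : Compactness.Tn n R -> nat -> R :=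
  match n with
  | O => fun _ _ => 0
  | S n' => fun x i => match i with O => fst x | S j => tn_seq n' (snd x) j end
  end.

Fixpoint seq_tn (n : nat) (s : nat -> R) : Compactness.Tn n R :=
  match n with
  | O => tt
  | S n' => (s O, seq_tn n' (fun i => s (S i)))
  end.

Lemma bounded_n_seq_tn n lo up s :
  (forall i, (i < n)%nat -> lo i <= s i <= up i) ->
  bounded_n n (seq_tn n lo) (seq_tn n up) (seq_tn n s).
Proof.
  revert lo up s; induction n as [|n IH]; intros lo up s h; simpl; [exact I|].
  split; [apply h; lia|]. apply (IH (fun i => lo (S i)) (fun i => up (S i)) (fun i => s (S i))).
  intros i hi; apply h; lia.
Qed.

Lemma close_n_seq_tn n d s t i :
  close_n n d (seq_tn n s) t -> (i < n)%nat -> Rabs (s i - tn_seq n t i) < d.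
Proof.
  revert s t i; induction n as [|n IH]; intros s t i hc hi; [lia|].
  destruct t as [t1 t2]; simpl in hc; destruct hc as [h1 h2].
  destruct i as [|i]; simpl; [exact h1|]. apply (IH (fun i => s (S i))); [exact h2|lia].
Qed.

(** If the infimum [- m] were not attained, every point would have a neighbourhood on which [f]
    stays above [- m] by a fixed amount; compactness makes this amount uniform, which contradicts
    the infimum. *)
Lemma compact_min (n : nat) (B : nat -> R) (K : (nat -> R) -> Prop) (f : (nat -> R) -> R) (low : R) :
  (forall x i, K x -> (i < n)%nat -> Rabs (x i) <= B i) ->
  (forall x, K x -> low <= f x) ->
  (forall x, K x -> forall eps, 0 < eps -> exists d, 0 < d /\ forall y, K y ->
     (forall i, (i < n)%nat -> Rabs (y i - x i) < d) -> Rabs (f y - f x) < eps) ->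
  (forall x, ~ K x -> exists d, 0 < d /\ forall y,
     (forall i, (i < n)%nat -> Rabs (y i - x i) < d) -> ~ K y) ->
  (exists x, K x) ->
  exists x, K x /\ forall y, K y -> f x <= f y.
Proof.
  intros hB hlow hcont hcl [x0 hx0].
  set (E := fun r => exists x, K x /\ r = - f x).
  destruct (completeness E) as [m [hm1 hm2]].
  { exists (- low). intros r [x [hx ->]]. specialize (hlow x hx). lra. }
  { exists (- f x0), x0; auto. }
  apply NNPP; intros hno.
  assert (hgt : forall x, K x -> - m < f x).
  { intros x hx. destruct (Rle_lt_dec (f x) (- m)) as [h|h]; [|exact h].
    exfalso; apply hno; exists x; split; [exact hx|]. intros y hy.
    assert (- f y <= m) by (apply hm1; exists y; auto). lra. }
  (* One number [d] serves both as the radius of the neighbourhood and as the gap above the infimum,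
     so the uniform lower bound on the radii from [compactness_value] is at once a uniform gap. Off
     [K] the claim is vacuous because [K] is closed. *)
  assert (hd : forall t : Compactness.Tn n R, exists d : posreal,
    forall y, (forall i, (i < n)%nat -> Rabs (y i - tn_seq n t i) < d) -> K y -> - m + d <= f y).
  { intros t. destruct (classic (K (tn_seq n t))) as [hk|hk].
    - specialize (hgt _ hk). set (e := (f (tn_seq n t) + m) / 2).
      assert (he : 0 < e) by (unfold e; lra).
      destruct (hcont _ hk e he) as [d [hd1 hd2]].
      assert (hp : 0 < Rmin d e) by (apply Rmin_pos; lra).
      exists (mkposreal _ hp); simpl. intros y hy hky.
      assert (Rabs (f y - f (tn_seq n t)) < e).
      { apply hd2; auto. intros i hi. eapply Rlt_le_trans; [apply hy, hi|apply Rmin_l]. }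
      apply Rabs_def2 in H. pose proof (Rmin_r d e). unfold e in *. lra.
    - destruct (hcl _ hk) as [d [hd1 hd2]].
      exists (mkposreal _ hd1); simpl. intros y hy hky. exfalso. now apply (hd2 y). }
  apply choice in hd. destruct hd as [delta hdelta].
  destruct (compactness_value n (seq_tn n (fun i => - B i)) (seq_tn n B) delta) as [d hd].
  assert (hall : forall y, K y -> - m + d <= f y).
  { intros y hy. apply NNPP; intros hc.
    apply (hd (seq_tn n y)).
    - apply bounded_n_seq_tn. intros i hi. specialize (hB y i hy hi).
      apply Rabs_le_between in hB. exact hB.
    - intros [t [_ [ht1 ht2]]]. apply hc.
      apply Rle_trans with (- m + delta t); [lra|]. apply hdelta; auto.
      intros i hi. now apply close_n_seq_tn with (1 := ht1). }
  assert (m <= m - d).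
  { apply hm2. intros r [x [hx ->]]. specialize (hall x hx). lra. }
  destruct d as [d hdp]; simpl in *; lra.
Qed.

Lemma atan_lipschitz x y : Rabs (atan x - atan y) <= Rabs (x - y).
Proof.
  assert (h : forall a b, a < b -> 0 <= atan b - atan a <= b - a).
  { intros a b hab.
    destruct (MVT_cor2 atan (fun z => / (1 + z ^ 2)) a b hab) as [z [hz _]].
    { intros z _. apply is_derive_Reals. auto_derive; [exact I|]. rewrite Rmult_1_l. f_equal; unfold Rsqr; ring. }
    rewrite hz. assert (0 < / (1 + z ^ 2) <= 1).
    { split; [apply Rinv_0_lt_compat; nra|]. rewrite <- Rinv_1 at 2. apply Rinv_le_contravar; nra. }
    split; [apply Rmult_le_pos; lra|]. rewrite <- (Rmult_1_l (b - a)) at 2.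
    apply Rmult_le_compat_r; lra. }
  destruct (Rtotal_order x y) as [hl|[->|hl]].
  - specialize (h x y hl). rewrite !Rabs_left1; lra.
  - rewrite !Rminus_diag, Rabs_R0; lra.
  - specialize (h y x hl). rewrite !Rabs_pos_eq; lra.
Qed.

(** Composition with the increasing bounded function [atan] keeps the minimisers and makes any
    function bounded below, so the hypothesis [low] disappears. *)
Lemma compact_min_attained (n : nat) (B : nat -> R) (K : (nat -> R) -> Prop) (f : (nat -> R) -> R) :
  (forall x i, K x -> (i < n)%nat -> Rabs (x i) <= B i) ->
  (forall x, K x -> forall eps, 0 < eps -> exists d, 0 < d /\ forall y, K y ->
     (forall i, (i < n)%nat -> Rabs (y i - x i) < d) -> Rabs (f y - f x) < eps) ->
  (forall x, ~ K x -> exists d, 0 < d /\ forall y,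
     (forall i, (i < n)%nat -> Rabs (y i - x i) < d) -> ~ K y) ->
  (exists x, K x) ->
  exists x, K x /\ forall y, K y -> f x <= f y.
Proof.
  intros hB hcont hcl hne.
  destruct (compact_min n B K (fun x => atan (f x)) (- PI / 2)) as [x [hx1 hx2]]; auto.
  - intros x _. pose proof (atan_bound (f x)). lra.
  - intros x hx eps heps. destruct (hcont x hx eps heps) as [d [hd1 hd2]].
    exists d; split; [exact hd1|]. intros y hy hyd.
    eapply Rle_lt_trans; [apply atan_lipschitz|now apply hd2].
  - exists x; split; [exact hx1|]. intros y hy.
    apply Rnot_lt_le; intros hl. apply atan_increasing in hl. specialize (hx2 y hy). lra.
Qed.

(** * The maximum principle *)

Lemma is_derive_Rplus (f g : R -> R) (x a b : R) :
  is_derive f x a -> is_derive g x b -> is_derive (fun t => f t + g t) x (a + b).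
Proof. exact (is_derive_plus f g x a b). Qed.

(** Near [x0] the derivative is larger than [phi' x0] to the right and smaller to the left. If
    [phi' x0 >= 0] a step to the right increases [phi], otherwise a step to the left does; [x0] need
    not be critical. *)
Lemma convex_point_not_max (phi phi' : R -> R) (x0 d c : R) :
  0 < d -> 0 < c ->
  (forall x, Rabs (x - x0) < d -> is_derive phi x (phi' x)) ->
  is_derive phi' x0 c ->
  exists x, Rabs (x - x0) < d /\ phi x0 < phi x.
Proof.
  intros hd hc h1 h2.
  apply is_derive_Reals in h2.
  destruct (h2 (c / 2) ltac:(lra)) as [e he].
  set (h := Rmin (d / 2) (e / 2)).
  assert (hh : 0 < h) by (unfold h; destruct e as [e hep]; simpl; apply Rmin_pos; lra).
  assert (hh1 : h < d) by (unfold h; pose proof (Rmin_l (d/2) (e/2)); lra).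
  assert (hh2 : h < e) by (unfold h; destruct e as [e hep]; simpl in *;
     pose proof (Rmin_r (d/2) (e/2)); lra).
  assert (hsl : forall k, k <> 0 -> Rabs k <= h -> 0 < (phi' (x0 + k) - phi' x0) / k).
  { intros k hk1 hk2. specialize (he k hk1 ltac:(lra)). apply Rabs_def2 in he. lra. }
  destruct (Rle_lt_dec 0 (phi' x0)) as [hs|hs].
  - exists (x0 + h). split; [replace (x0 + h - x0) with h by ring; rewrite Rabs_pos_eq; lra|].
    destruct (MVT_cor2 phi phi' x0 (x0 + h) ltac:(lra)) as [z [hz1 hz2]].
    { intros z hz. apply is_derive_Reals, h1. rewrite Rabs_pos_eq; lra. }
    assert (hp := hsl (z - x0) ltac:(lra) ltac:(rewrite Rabs_pos_eq; lra)).
    replace (x0 + (z - x0)) with z in hp by ring.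
    assert (0 < phi' z - phi' x0).
    { replace (phi' z - phi' x0) with ((phi' z - phi' x0) / (z - x0) * (z - x0)) by (field; lra).
      apply Rmult_lt_0_compat; lra. }
    assert (0 < phi' z * (x0 + h - x0)) by (apply Rmult_lt_0_compat; lra). lra.
  - exists (x0 - h). split; [replace (x0 - h - x0) with (-h) by ring; rewrite Rabs_Ropp, Rabs_pos_eq; lra|].
    destruct (MVT_cor2 phi phi' (x0 - h) x0 ltac:(lra)) as [z [hz1 hz2]].
    { intros z hz. apply is_derive_Reals, h1. apply Rabs_def1; lra. }
    assert (hp := hsl (z - x0) ltac:(lra) ltac:(rewrite Rabs_left; lra)).
    replace (x0 + (z - x0)) with z in hp by ring.
    assert (0 < phi' x0 - phi' z).
    { replace (phi' x0 - phi' z) with ((phi' z - phi' x0) / (z - x0) * (x0 - z)) by (field; lra).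
      apply Rmult_lt_0_compat; lra. }
    assert (0 < - phi' z * (x0 - (x0 - h))) by (apply Rmult_lt_0_compat; lra). lra.
Qed.

(** Pointwise pure second derivatives and joint continuity of [V] alone are all that the
    second-derivative test at an interior maximum consumes, and they are easy to check for explicit
    formulas. *)
Record sub_at (V Vx Vy Vxx Vyy : R -> R -> R) (x y : R) : Prop := {
  sub_cont : continuity_2d_pt V x y;
  sub_x : is_derive (fun s => V s y) x (Vx x y);
  sub_xx : is_derive (fun s => Vx s y) x (Vxx x y);
  sub_y : is_derive (fun s => V x s) y (Vy x y);
  sub_yy : is_derive (fun s => Vy x s) y (Vyy x y);
  sub_lap : 0 <= Vxx x y + Vyy x y }.

(* The domain is [y > - b]: an open half-plane containing the closed upper one. *)
Definition subharmonic (b : R) (V : R -> R -> R) : Prop :=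
  exists Vx Vy Vxx Vyy, forall x y, - b < y -> sub_at V Vx Vy Vxx Vyy x y.

(** Adding [eps x^2] makes the Laplacian strictly positive, so an interior maximum on the rectangle
    would have a positive second derivative along one of the axes. *)
Lemma max_principle (b : R) (V : R -> R -> R) (r c x0 y0 : R) :
  0 < b -> subharmonic b V -> 0 < r ->
  (forall x y, Rabs x <= r -> 0 <= y <= r ->
     (Rabs x = r \/ y = 0 \/ y = r) -> V x y <= c) ->
  Rabs x0 <= r -> 0 <= y0 <= r -> V x0 y0 <= c.
Proof.
  intros hb (Vx & Vy & Vxx & Vyy & hV) hr hbd hx0 hy0.
  apply Rnot_lt_le; intros hlt.
  (* On the rectangle the perturbation is at most [eps r^2], half the supposed excess of [V x0 y0]
     over [c]; the perturbed maximum therefore still exceeds [c] and lies in the interior. *)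
  set (eps := (V x0 y0 - c) / (2 * (r * r))).
  assert (hrr : 0 < r * r) by (apply Rmult_lt_0_compat; lra).
  assert (heps : 0 < eps) by (unfold eps; apply Rdiv_lt_0_compat; lra).
  assert (hepsr : eps * (r * r) = (V x0 y0 - c) / 2) by (unfold eps; field; lra).
  set (f := fun s : nat -> R => - (V (s O) (s 1%nat) + eps * (s O * s O))).
  set (K := fun s : nat -> R => Rabs (s O) <= r /\ 0 <= s 1%nat <= r).
  assert (hct : forall s, K s -> forall e, 0 < e -> exists d, 0 < d /\ forall y, K y ->
     (forall i, (i < 2)%nat -> Rabs (y i - s i) < d) -> Rabs (f y - f s) < e).
  { intros s hs e he.
    assert (hc : continuity_2d_pt (fun u v => V u v + eps * (u * u)) (s O) (s 1%nat)).
    { apply continuity_2d_pt_plus; [apply (sub_cont _ _ _ _ _ _ _ (hV (s O) (s 1%nat) ltac:(destruct hs; lra)))|].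
      apply continuity_2d_pt_mult; [apply continuity_2d_pt_const|].
      apply continuity_2d_pt_mult; apply continuity_2d_pt_id1. }
    destruct (hc (mkposreal e he)) as [d hd]. exists d; split; [apply cond_pos|].
    intros y _ hy. unfold f.
    replace (- (V (y O) (y 1%nat) + eps * (y O * y O)) - - (V (s O) (s 1%nat) + eps * (s O * s O)))
      with (- (V (y O) (y 1%nat) + eps * (y O * y O) - (V (s O) (s 1%nat) + eps * (s O * s O)))) by ring.
    rewrite Rabs_Ropp. apply hd; apply hy; lia. }
  destruct (compact_min_attained 2 (fun _ => r) K f) as [s [[hs1 hs2] hs3]]; auto.
  - intros x i [h1 h2] hi. destruct i as [|[|i]]; [exact h1| |lia]. rewrite Rabs_pos_eq; lra.
  - intros s hs. unfold K in hs. apply not_and_or in hs.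
    destruct hs as [hs|hs].
    + exists (Rabs (s O) - r). split; [lra|]. intros y hy [hk _]. specialize (hy O ltac:(lia)).
      pose proof (Rabs_triang_inv (s O) (y O)). rewrite Rabs_minus_sym in hy. lra.
    + apply not_and_or in hs. destruct hs as [hs|hs].
      * exists (- s 1%nat). split; [lra|]. intros y hy [_ hk]. specialize (hy 1%nat ltac:(lia)).
        apply Rabs_def2 in hy; lra.
      * exists (s 1%nat - r). split; [lra|]. intros y hy [_ hk]. specialize (hy 1%nat ltac:(lia)).
        apply Rabs_def2 in hy; lra.
  - exists (fun _ => 0). unfold K; rewrite Rabs_R0; lra.
  - set (x := s O) in *. set (y := s 1%nat) in *.
    assert (hmax : forall u v, Rabs u <= r -> 0 <= v <= r ->
        V u v + eps * (u * u) <= V x y + eps * (x * x)).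
    { intros u v hu hv.
      specialize (hs3 (fun i => match i with O => u | _ => v end) (conj hu hv)).
      unfold f in hs3; fold x y in hs3; lra. }
    assert (hsq : forall u, Rabs u <= r -> 0 <= u * u <= r * r).
    { intros u hu. apply Rabs_le_between in hu. nra. }
    assert (hVy : c < V x y).
    { specialize (hmax x0 y0 hx0 hy0). pose proof (hsq x0 hx0). pose proof (hsq x hs1).
      assert (eps * (x * x) <= eps * (r * r)) by (apply Rmult_le_compat_l; lra).
      assert (0 <= eps * (x0 * x0)) by (apply Rmult_le_pos; lra). lra. }
    assert (hint : Rabs x < r /\ 0 < y < r).
    { destruct (Req_dec (Rabs x) r) as [e|e]; [specialize (hbd x y hs1 hs2 (or_introl e)); lra|].
      destruct (Req_dec y 0) as [e1|e1]; [specialize (hbd x y hs1 hs2 (or_intror (or_introl e1))); lra|].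
      destruct (Req_dec y r) as [e2|e2]; [specialize (hbd x y hs1 hs2 (or_intror (or_intror e2))); lra|].
      lra. }
    destruct hint as [hix hiy].
    assert (hS := hV x y ltac:(lra)).
    (* The second derivatives of the perturbed function add up to at least [2 eps], so one of them
       is positive and [convex_point_not_max] applies along that axis. *)
    destruct (Rle_lt_dec (Vyy x y) 0) as [hp|hp].
    + assert (hxx : 0 < Vxx x y + 2 * eps) by (pose proof (sub_lap _ _ _ _ _ _ _ hS); lra).
      destruct (convex_point_not_max (fun u => V u y + eps * (u * u)) (fun u => Vx u y + 2 * eps * u)
        x (r - Rabs x) (Vxx x y + 2 * eps)) as [u [hu1 hu2]]; [lra|lra| | |].
      * intros u _. apply is_derive_Rplus; [apply (sub_x _ _ _ _ _ _ _ (hV u y ltac:(lra)))|].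
        auto_derive; [exact I|ring].
      * apply is_derive_Rplus; [apply (sub_xx _ _ _ _ _ _ _ hS)|]. auto_derive; [exact I|ring].
      * assert (Rabs u <= r).
        { replace u with (u - x + x) by ring. eapply Rle_trans; [apply Rabs_triang|]. lra. }
        specialize (hmax u y H hs2). lra.
    + destruct (convex_point_not_max (fun v => V x v) (fun v => Vy x v)
        y (Rmin y (r - y)) (Vyy x y)) as [v [hv1 hv2]]; auto.
      * apply Rmin_pos; lra.
      * intros v hv. apply (sub_y _ _ _ _ _ _ _ (hV x v ltac:(
          pose proof (Rmin_l y (r - y)); apply Rabs_def2 in hv; lra))).
      * apply (sub_yy _ _ _ _ _ _ _ hS).
      * pose proof (Rmin_l y (r - y)); pose proof (Rmin_r y (r - y)); apply Rabs_def2 in hv1.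
        specialize (hmax x v hs1 ltac:(lra)). lra.
Qed.

(** * Exponential sums and logarithmic subharmonicity *)

(* A list of pairs [(d, t)] encodes [F(x + i y) = sum d e^(i t (x + i y))]. *)
Definition eRe (l : list (C * R)) (x y : R) : R :=
  rsum (fun p => exp (- (snd p * y)) *
    (Re (fst p) * cos (snd p * x) - Im (fst p) * sin (snd p * x))) l.

Definition eIm (l : list (C * R)) (x y : R) : R :=
  rsum (fun p => exp (- (snd p * y)) *
    (Re (fst p) * sin (snd p * x) + Im (fst p) * cos (snd p * x))) l.

Definition esq (l : list (C * R)) (x y : R) : R := eRe l x y ^ 2 + eIm l x y ^ 2.

Definition mass (l : list (C * R)) : R := rsum (fun p => Cmod (fst p)) l.

(** The coefficient [i t d] in coordinates. The four lemmas on partial derivatives below are then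
    the Cauchy-Riemann equations for F. *)
Definition ederiv (l : list (C * R)) : list (C * R) :=
  map (fun p => ((- (snd p * Im (fst p)), snd p * Re (fst p)), snd p)) l.

Lemma eRe_dx l x y : is_derive (fun s => eRe l s y) x (eRe (ederiv l) x y).
Proof.
  induction l as [|[[a b] t] l IH]; [apply (is_derive_const 0)|].
  apply is_derive_Rplus; [|exact IH]. simpl. auto_derive; [exact I|]. ring.
Qed.

Lemma eIm_dx l x y : is_derive (fun s => eIm l s y) x (eIm (ederiv l) x y).
Proof.
  induction l as [|[[a b] t] l IH]; [apply (is_derive_const 0)|].
  apply is_derive_Rplus; [|exact IH]. simpl. auto_derive; [exact I|]. ring.
Qed.

Lemma is_derive_Rplus_opp (f g : R -> R) (x a b : R) :
  is_derive f x (- a) -> is_derive g x (- b) -> is_derive (fun t => f t + g t) x (- (a + b)).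
Proof. intros hf hg. rewrite Ropp_plus_distr. now apply is_derive_Rplus. Qed.

Lemma eRe_dy l x y : is_derive (fun s => eRe l x s) y (- eIm (ederiv l) x y).
Proof.
  induction l as [|[[a b] t] l IH].
  - replace (- eIm (ederiv nil) x y) with 0 by (unfold eIm; simpl; ring). apply (is_derive_const 0).
  - apply is_derive_Rplus_opp; [|exact IH]. simpl. auto_derive; [exact I|]. ring.
Qed.

Lemma eIm_dy l x y : is_derive (fun s => eIm l x s) y (eRe (ederiv l) x y).
Proof.
  induction l as [|[[a b] t] l IH]; [apply (is_derive_const 0)|].
  apply is_derive_Rplus; [|exact IH]. simpl. auto_derive; [exact I|]. ring.
Qed.

Lemma continuity_2d_exp_trig a b t x y :
  continuity_2d_pt (fun u v => exp (- (t * v)) * (a * cos (t * u) - b * sin (t * u))) x y /\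
  continuity_2d_pt (fun u v => exp (- (t * v)) * (a * sin (t * u) + b * cos (t * u))) x y.
Proof.
  assert (he : continuity_2d_pt (fun _ v => exp (- (t * v))) x y).
  { apply (continuity_1d_2d_pt_comp exp).
    - apply derivable_continuous_pt, derivable_pt_exp.
    - apply continuity_2d_pt_opp, continuity_2d_pt_mult;
        [apply continuity_2d_pt_const|apply continuity_2d_pt_id2]. }
  assert (ht : continuity_2d_pt (fun u _ => t * u) x y).
  { apply continuity_2d_pt_mult; [apply continuity_2d_pt_const|apply continuity_2d_pt_id1]. }
  assert (hc : continuity_2d_pt (fun u _ => cos (t * u)) x y).
  { apply (continuity_1d_2d_pt_comp cos); [apply continuity_cos|exact ht]. }
  assert (hs : continuity_2d_pt (fun u _ => sin (t * u)) x y).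
  { apply (continuity_1d_2d_pt_comp sin); [apply continuity_sin|exact ht]. }
  split; apply continuity_2d_pt_mult; try exact he;
    [apply continuity_2d_pt_minus|apply continuity_2d_pt_plus];
    apply continuity_2d_pt_mult; auto using continuity_2d_pt_const.
Qed.

Lemma eRe_cont l x y : continuity_2d_pt (eRe l) x y.
Proof.
  induction l as [|[[a b] t] l IH]; [apply continuity_2d_pt_const|].
  apply continuity_2d_pt_plus; [|exact IH]. apply continuity_2d_exp_trig.
Qed.

Lemma eIm_cont l x y : continuity_2d_pt (eIm l) x y.
Proof.
  induction l as [|[[a b] t] l IH]; [apply continuity_2d_pt_const|].
  apply continuity_2d_pt_plus; [|exact IH]. apply continuity_2d_exp_trig.
Qed.

(* With [S = |F|^2 + eta]: [S Lap S - |grad S|^2 = 4 eta |F'|^2]. *)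
Lemma subharmonic_ln_esq b l eta : 0 < eta -> subharmonic b (fun x y => ln (esq l x y + eta)).
Proof.
  intros heta. set (d := ederiv l). set (dd := ederiv d).
  set (S := fun x y => esq l x y + eta).
  set (Sx := fun x y => 2 * (eRe l x y * eRe d x y + eIm l x y * eIm d x y)).
  set (Sy := fun x y => 2 * (- eRe l x y * eIm d x y + eIm l x y * eRe d x y)).
  set (Sxx := fun x y => 2 * (eRe d x y ^ 2 + eIm d x y ^ 2 + eRe l x y * eRe dd x y + eIm l x y * eIm dd x y)).
  set (Syy := fun x y => 2 * (eRe d x y ^ 2 + eIm d x y ^ 2 - eRe l x y * eRe dd x y - eIm l x y * eIm dd x y)).
  exists (fun x y => Sx x y / S x y), (fun x y => Sy x y / S x y),
    (fun x y => (Sxx x y * S x y - Sx x y * Sx x y) / S x y ^ 2),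
    (fun x y => (Syy x y * S x y - Sy x y * Sy x y) / S x y ^ 2).
  intros x y _.
  assert (hS : 0 < S x y).
  { unfold S, esq. pose proof (pow2_ge_0 (eRe l x y)). pose proof (pow2_ge_0 (eIm l x y)). lra. }
  pose proof (eRe_dx l x y) as d1. pose proof (eIm_dx l x y) as d2.
  pose proof (eRe_dx d x y) as d3. pose proof (eIm_dx d x y) as d4.
  pose proof (eRe_dy l x y) as d5. pose proof (eIm_dy l x y) as d6.
  pose proof (eRe_dy d x y) as d7. pose proof (eIm_dy d x y) as d8.
  fold d dd in d1, d2, d3, d4, d5, d6, d7, d8.
  assert (e1 : Derive (fun s : R => eRe l s y) x = eRe d x y) by now apply is_derive_unique.
  assert (e2 : Derive (fun s : R => eIm l s y) x = eIm d x y) by now apply is_derive_unique.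
  assert (e3 : Derive (fun s : R => eRe d s y) x = eRe dd x y) by now apply is_derive_unique.
  assert (e4 : Derive (fun s : R => eIm d s y) x = eIm dd x y) by now apply is_derive_unique.
  assert (e5 : Derive (fun s : R => eRe l x s) y = - eIm d x y) by now apply is_derive_unique.
  assert (e6 : Derive (fun s : R => eIm l x s) y = eRe d x y) by now apply is_derive_unique.
  assert (e7 : Derive (fun s : R => eRe d x s) y = - eIm dd x y) by now apply is_derive_unique.
  assert (e8 : Derive (fun s : R => eIm d x s) y = eRe dd x y) by now apply is_derive_unique.
  assert (hSx : is_derive (fun s => S s y) x (Sx x y)).
  { unfold S, Sx, esq. auto_derive.
    - repeat split; eexists; eassumption.
    - rewrite e1, e2. ring. }
  assert (hSy : is_derive (fun s => S x s) y (Sy x y)).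
  { unfold S, Sy, esq. auto_derive.
    - repeat split; eexists; eassumption.
    - rewrite e5, e6. ring. }
  assert (hSxx : is_derive (fun s => Sx s y) x (Sxx x y)).
  { unfold Sxx, Sx. auto_derive.
    - repeat split; eexists; eassumption.
    - rewrite e1, e2,
        e3, e4. ring. }
  assert (hSyy : is_derive (fun s => Sy x s) y (Syy x y)).
  { unfold Syy, Sy. auto_derive.
    - repeat split; eexists; eassumption.
    - rewrite e5, e6,
        e7, e8. ring. }
  assert (eSx : Derive (fun s : R => S s y) x = Sx x y) by now apply is_derive_unique.
  assert (eSy : Derive (fun s : R => S x s) y = Sy x y) by now apply is_derive_unique.
  assert (eSxx : Derive (fun s : R => Sx s y) x = Sxx x y) by now apply is_derive_unique.
  assert (eSyy : Derive (fun s : R => Sy x s) y = Syy x y) by now apply is_derive_unique.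
  split.
  - apply (continuity_1d_2d_pt_comp ln).
    + apply derivable_continuous_pt. exists (/ (S x y)). now apply derivable_pt_lim_ln.
    + unfold esq. apply continuity_2d_pt_plus; [|apply continuity_2d_pt_const].
      apply (continuity_2d_pt_ext (fun u v => eRe l u v * eRe l u v + eIm l u v * eIm l u v));
        [intros; ring|].
      apply continuity_2d_pt_plus; apply continuity_2d_pt_mult; apply eRe_cont || apply eIm_cont.
  - change (is_derive (fun s => ln (S s y)) x (Sx x y / S x y)). auto_derive.
    + split; [eexists; eassumption|auto].
    + rewrite eSx. field; lra.
  - auto_derive.
    + repeat split; try (eexists; eassumption); lra.
    + rewrite eSx, eSxx. field; lra.
  - change (is_derive (fun s => ln (S x s)) y (Sy x y / S x y)). auto_derive.
    + split; [eexists; eassumption|auto].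
    + rewrite eSy. field; lra.
  - auto_derive.
    + repeat split; try (eexists; eassumption); lra.
    + rewrite eSy, eSyy. field; lra.
  - replace ((Sxx x y * S x y - Sx x y * Sx x y) / S x y ^ 2 +
      (Syy x y * S x y - Sy x y * Sy x y) / S x y ^ 2)
      with (4 * eta * (eRe d x y ^ 2 + eIm d x y ^ 2) / S x y ^ 2).
    + apply Rmult_le_pos; [|left; apply Rinv_0_lt_compat; nra].
      apply Rmult_le_pos; [lra|nra].
    + unfold Sxx, Syy, Sx, Sy. field_simplify_eq; [|lra]. unfold S, esq. ring.
Qed.

Lemma subharmonic_plus b V W :
  subharmonic b V -> subharmonic b W -> subharmonic b (fun x y => V x y + W x y).
Proof.
  intros (Vx & Vy & Vxx & Vyy & hV) (Wx & Wy & Wxx & Wyy & hW).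
  exists (fun x y => Vx x y + Wx x y), (fun x y => Vy x y + Wy x y),
    (fun x y => Vxx x y + Wxx x y), (fun x y => Vyy x y + Wyy x y).
  intros x y hy. destruct (hV x y hy) as [a1 a2 a3 a4 a5 a6]. destruct (hW x y hy).
  split; try (apply is_derive_Rplus; assumption); [now apply continuity_2d_pt_plus|lra].
Qed.

Lemma subharmonic_scal b c V : 0 <= c -> subharmonic b V -> subharmonic b (fun x y => c * V x y).
Proof.
  intros hc (Vx & Vy & Vxx & Vyy & hV).
  exists (fun x y => c * Vx x y), (fun x y => c * Vy x y),
    (fun x y => c * Vxx x y), (fun x y => c * Vyy x y).
  intros x y hy. destruct (hV x y hy) as [a1 a2 a3 a4 a5 a6].
  split; try (apply is_derive_scal; assumption).
  - apply continuity_2d_pt_mult; [apply continuity_2d_pt_const|exact a1].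
  - rewrite <- Rmult_plus_distr_l. now apply Rmult_le_pos.
Qed.

Lemma subharmonic_const b c : subharmonic b (fun _ _ => c).
Proof.
  exists (fun _ _ => 0), (fun _ _ => 0), (fun _ _ => 0), (fun _ _ => 0).
  intros x y _. split; try apply (is_derive_const c); try apply (is_derive_const 0); try lra.
  apply continuity_2d_pt_const.
Qed.

Lemma subharmonic_rsum {I : Type} b (l : list I) (V : I -> R -> R -> R) :
  (forall i, In i l -> subharmonic b (V i)) -> subharmonic b (fun x y => rsum (fun i => V i x y) l).
Proof.
  induction l as [|i l IH]; intros h; [apply (subharmonic_const b 0)|].
  apply (subharmonic_plus b (V i)); [apply h; now left|]. apply IH. intros j hj; apply h; now right.
Qed.

(* [P - b dP/ds] for the Poisson kernel [P = s / (x^2 + s^2)] at height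
   [s = y + b]: on the boundary [y = 0] the slow [x^(-2)] tail of [P] cancels. *)
Definition kernel (b a x y : R) : R :=
  (y + b) / ((x - a) ^ 2 + (y + b) ^ 2) -
  b * (((x - a) ^ 2 - (y + b) ^ 2) / ((x - a) ^ 2 + (y + b) ^ 2) ^ 2).

Lemma kernel_den_pos b a x y : - b < y -> 0 < (x - a) ^ 2 + (y + b) ^ 2.
Proof. intros h. assert (0 < (y + b) ^ 2) by nra. pose proof (pow2_ge_0 (x - a)). lra. Qed.

(** The Poisson kernel with its pole moved down to height [- b] is harmonic for [y > - b], and so is
    its vertical derivative; the kernel combines the two. *)
Lemma subharmonic_kernel b a : subharmonic b (kernel b a).
Proof.
  set (D := fun x y : R => (x - a) ^ 2 + (y + b) ^ 2).
  exists (fun x y => - 2 * (x - a) * (y + b) / D x y ^ 2 -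
      b * (2 * (x - a) / D x y ^ 2 - 4 * (x - a) * ((x - a) ^ 2 - (y + b) ^ 2) / D x y ^ 3)).
  exists (fun x y => ((x - a) ^ 2 - (y + b) ^ 2) / D x y ^ 2 -
      b * (- 2 * (y + b) / D x y ^ 2 - 4 * (y + b) * ((x - a) ^ 2 - (y + b) ^ 2) / D x y ^ 3)).
  (* The second [y]-derivative is declared as [- Kxx], which settles the Laplacian; the formula for
     [Kxx] is filled in when the second [x]-derivative is computed. *)
  evar (Kxx : R -> R -> R). exists Kxx. exists (fun x y => - Kxx x y). subst Kxx.
  intros x y hy.
  assert (hD : 0 < D x y) by now apply kernel_den_pos.
  assert (hD' : (x - a) ^ 2 + (y + b) ^ 2 <> 0) by (unfold D in hD; lra).
  split.
  - unfold kernel.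
    assert (h1 : continuity_2d_pt (fun u _ => (u - a) ^ 2) x y).
    { apply (continuity_2d_pt_ext (fun u _ => (u - a) * (u - a))); [intros; ring|].
      apply continuity_2d_pt_mult; apply continuity_2d_pt_minus;
        apply continuity_2d_pt_id1 || apply continuity_2d_pt_const. }
    assert (h2 : continuity_2d_pt (fun _ v => v + b) x y).
    { apply continuity_2d_pt_plus; [apply continuity_2d_pt_id2|apply continuity_2d_pt_const]. }
    assert (h3 : continuity_2d_pt (fun _ v => (v + b) ^ 2) x y).
    { apply (continuity_2d_pt_ext (fun _ v => (v + b) * (v + b))); [intros; ring|].
      now apply continuity_2d_pt_mult. }
    assert (h4 : continuity_2d_pt (fun u v => / ((u - a) ^ 2 + (v + b) ^ 2)) x y).
    { apply continuity_2d_pt_inv; [now apply continuity_2d_pt_plus|exact hD']. }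
    apply continuity_2d_pt_minus; [now apply continuity_2d_pt_mult|].
    apply continuity_2d_pt_mult; [apply continuity_2d_pt_const|].
    apply continuity_2d_pt_mult; [now apply continuity_2d_pt_minus|].
    apply (continuity_2d_pt_ext (fun u v =>
      / ((u - a) ^ 2 + (v + b) ^ 2) * / ((u - a) ^ 2 + (v + b) ^ 2))).
    + intros u v. rewrite <- Rinv_mult. f_equal; ring.
    + now apply continuity_2d_pt_mult.
  - unfold kernel, D. auto_derive; [split; [|split]; auto; try (apply pow_nonzero; auto)|].
    all: try (unfold D in hD; simpl in *; nra). field. auto.
  - unfold D. auto_derive.
    { repeat split; auto; unfold D in hD; simpl in *; repeat apply Rmult_integral_contrapositive_currified; lra. }
    instantiate (1 := fun x y => - 2 * (y + b) / D x y ^ 2 + 8 * (x - a) ^ 2 * (y + b) / D x y ^ 3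
      - b * (2 / D x y ^ 2 - 8 * (x - a) ^ 2 / D x y ^ 3 - (12 * (x - a) ^ 2 - 4 * (y + b) ^ 2) / D x y ^ 3
         + 24 * (x - a) ^ 2 * ((x - a) ^ 2 - (y + b) ^ 2) / D x y ^ 4)).
    unfold D. field. auto.
  - unfold kernel, D. auto_derive; [split; [|split]; auto; try (apply pow_nonzero; auto)|].
    all: try (unfold D in hD; simpl in *; nra). field. auto.
  - unfold D. auto_derive.
    { repeat split; auto; unfold D in hD; simpl in *; repeat apply Rmult_integral_contrapositive_currified; lra. }
    unfold D. field. auto.
Qed.

(** Over one denominator all terms of the numerator are nonnegative for [y >= 0] and [b > 0]; this
    form gives the bounds from both sides. *)
Lemma kernel_num b a x y : - b < y ->
  kernel b a x y = (y * (x - a) ^ 2 + (y + b) ^ 3 + b * (y + b) ^ 2) / ((x - a) ^ 2 + (y + b) ^ 2) ^ 2.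
Proof. intros h. pose proof (kernel_den_pos b a x y h). unfold kernel. field. lra. Qed.

(** With [s = y + b] and [D = (x - a)^2 + s^2], the numerator is at most [2 s D], as [y] and [b] are
    at most [s]. So the kernel is at most [2 s / D], and [s K <= D] because [s^2] and [K^2] are both
    at most [D]. *)
Lemma kernel_far b a x y K : 0 < b -> 0 <= y -> 0 < K ->
  K ^ 2 <= (x - a) ^ 2 + (y + b) ^ 2 -> kernel b a x y <= 2 / K.
Proof.
  intros hb hy hK h. rewrite kernel_num by lra. pose proof (kernel_den_pos b a x y ltac:(lra)) as hD.
  set (s := y + b) in *. set (d := (x - a) ^ 2) in *. set (D := d + s ^ 2) in *.
  assert (hd : 0 <= d) by apply pow2_ge_0.
  assert (hs : 0 < s) by (unfold s; lra).
  assert (h1 : y * d + s ^ 3 + b * s ^ 2 <= 2 * (s * D)) by (unfold D, s in *; nra).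
  assert (h2 : s * K <= D) by (unfold D in *; nra).
  apply Rmult_le_reg_r with (D ^ 2); [nra|]. unfold Rdiv at 1. rewrite Rmult_assoc, Rinv_l by nra.
  apply Rmult_le_reg_r with K; [exact hK|].
  replace (2 / K * D ^ 2 * K) with (2 * D * D) by (field; lra). nra.
Qed.

Lemma kernel_boundary b a x : 0 < b -> kernel b a x 0 = 2 * b ^ 3 / ((x - a) ^ 2 + b ^ 2) ^ 2.
Proof.
  intros hb. rewrite kernel_num by lra. pose proof (kernel_den_pos b a x 0 ltac:(lra)).
  rewrite Rplus_0_l in *. field. lra.
Qed.

(** * Size of exponential sums and estimates in the half-plane *)

Lemma abs_le_Cmod (z : C) : Rabs (Re z) <= Cmod z /\ Rabs (Im z) <= Cmod z.
Proof.
  pose proof (Rmax_Cmod z) as h. unfold Re, Im.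
  pose proof (Rmax_l (Rabs (fst z)) (Rabs (snd z))). pose proof (Rmax_r (Rabs (fst z)) (Rabs (snd z))). lra.
Qed.

Definition ec (l : list (C * R)) (x y : R) : C := (eRe l x y, eIm l x y).

Lemma esq_Cmod l x y : esq l x y = Cmod (ec l x y) ^ 2.
Proof.
  unfold Cmod, esq, ec. simpl fst; simpl snd. rewrite pow2_sqrt; [reflexivity|].
  pose proof (pow2_ge_0 (eRe l x y)). pose proof (pow2_ge_0 (eIm l x y)). lra.
Qed.

Lemma Cmod_ec_le l x y : 0 <= y -> (forall p, In p l -> 0 <= snd p) -> Cmod (ec l x y) <= mass l.
Proof.
  intros hy; induction l as [|[d t] l IH]; intros hl.
  - unfold ec, eRe, eIm, mass; simpl. change (Cmod (RtoC 0) <= 0). rewrite Cmod_0; lra.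
  - replace (ec ((d, t) :: l) x y) with
      (Cplus (Cmult d (Cmult (RtoC (exp (- (t * y)))) (cos (t * x), sin (t * x)))) (ec l x y)).
    + eapply Rle_trans; [apply Cmod_triangle|].
      apply Rplus_le_compat; [|apply IH; intros p hp; apply hl; now right].
      simpl fst. rewrite !Cmod_mult, Cmod_R, Rabs_pos_eq by (left; apply exp_pos).
      assert (e : Cmod (cos (t * x), sin (t * x)) = 1).
      { unfold Cmod; simpl fst; simpl snd. rewrite <- sqrt_1. f_equal.
        pose proof (sin2_cos2 (t * x)) as h. unfold Rsqr in h. simpl; lra. }
      rewrite e, Rmult_1_r. rewrite <- (Rmult_1_r (Cmod d)) at 2.
      apply Rmult_le_compat_l; [apply Cmod_ge_0|].
      rewrite <- exp_0. assert (0 <= t) by (apply (hl (d, t)); now left).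
      destruct (Req_dec (t * y) 0) as [e0|e0]; [rewrite e0, Ropp_0; lra|].
      left; apply exp_increasing. nra.
    + destruct d as [a b]. unfold ec, eRe, eIm. rewrite !rsum_cons. cbn -[rsum].
      unfold Cplus, Cmult, RtoC; simpl. f_equal; ring.
Qed.

Lemma esq_nonneg l x y : 0 <= esq l x y.
Proof. rewrite esq_Cmod. apply pow2_ge_0. Qed.

Lemma esq_le_mass l x y B : 0 <= y -> (forall p, In p l -> 0 <= snd p) -> mass l <= B ->
  esq l x y <= B ^ 2.
Proof.
  intros hy hl hB. rewrite esq_Cmod. apply pow_incr. split; [apply Cmod_ge_0|].
  eapply Rle_trans; [now apply Cmod_ec_le|exact hB].
Qed.

Definition potential (b : R) (ks : list (R * R)) (x y : R) : R :=
  rsum (fun k => fst k * kernel b (snd k) x y) ks.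

(** Vanishing at infinity in the closed half-plane is what lets a maximum principle on bounded
    rectangles serve for the whole half-plane. *)
Lemma potential_far b ks e : 0 < b -> 0 < e -> (forall k, In k ks -> 0 <= fst k) ->
  exists r0, 0 < r0 /\ forall x y, 0 <= y -> (r0 <= Rabs x \/ r0 <= y) -> potential b ks x y <= e.
Proof.
  intros hb he; induction ks as [|[w a] ks IH] in e, he |- *; intros hk.
  - exists 1. split; [lra|]. intros x y _ _. unfold potential; simpl; lra.
  - destruct (IH (e / 2) ltac:(lra)) as [r1 [hr1 h1]]; [intros k hin; apply hk; now right|].
    assert (hw : 0 <= w) by (apply (hk (w, a)); now left).
    set (K := 4 * (w + 1) / e).
    assert (hK : 0 < K) by (unfold K; apply Rdiv_lt_0_compat; lra).
    exists (r1 + K + Rabs a). split; [pose proof (Rabs_pos a); lra|].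
    intros x y hy hxy. unfold potential. rewrite rsum_cons. simpl fst; simpl snd.
    assert (hf : kernel b a x y <= 2 / K).
    { apply kernel_far; auto. pose proof (Rabs_pos a). destruct hxy as [hx|hx].
      - assert (K <= Rabs (x - a)) by (pose proof (Rabs_triang_inv x a); lra).
        rewrite <- (pow2_abs (x - a)). pose proof (pow2_ge_0 (y + b)). nra.
      - pose proof (pow2_ge_0 (x - a)). nra. }
    assert (w * kernel b a x y <= e / 2).
    { apply Rle_trans with (w * (2 / K)); [now apply Rmult_le_compat_l|].
      unfold K. apply Rmult_le_reg_r with (2 * (w + 1)); [lra|].
      replace (w * (2 / (4 * (w + 1) / e)) * (2 * (w + 1))) with (w * e) by (field; lra). nra. }
    assert (potential b ks x y <= e / 2).
    { apply h1; auto. pose proof (Rabs_pos a). destruct hxy; [left|right]; lra. }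
    unfold potential in *; lra.
Qed.

(* The two-constants principle for [|F|^2 e^(2u)], [u] a sum of kernels. *)
Lemma halfplane_bound b l ks eta B c x0 y0 :
  0 < b -> 0 < eta -> (forall p, In p l -> 0 <= snd p) -> mass l <= B ->
  (forall k, In k ks -> 0 <= fst k) ->
  ln (B ^ 2 + eta) < c ->
  (forall x, ln (esq l x 0 + eta) + 2 * potential b ks x 0 <= c) ->
  0 <= y0 -> ln (esq l x0 y0 + eta) + 2 * potential b ks x0 y0 <= c.
Proof.
  intros hb heta hl hB hks hc hbd hy0.
  destruct (potential_far b ks ((c - ln (B ^ 2 + eta)) / 2) hb ltac:(lra) hks) as [r0 [hr0 hfar]].
  set (r := r0 + Rabs x0 + y0).
  apply (max_principle b (fun x y => ln (esq l x y + eta) + 2 * potential b ks x y) r).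
  - exact hb.
  - apply subharmonic_plus; [now apply subharmonic_ln_esq|].
    apply subharmonic_scal; [lra|]. apply subharmonic_rsum. intros k hk.
    apply subharmonic_scal; [now apply hks|apply subharmonic_kernel].
  - unfold r; pose proof (Rabs_pos x0); lra.
  - intros x y hx hy hor. destruct (Req_dec y 0) as [->|hny]; [apply hbd|].
    (* On the three sides off the real axis F is only known to be bounded by [B]; the strict gap
       between [ln (B^2 + eta)] and [c] absorbs twice the potential. *)
    assert (potential b ks x y <= (c - ln (B ^ 2 + eta)) / 2).
    { apply hfar; [lra|]. unfold r in hor. pose proof (Rabs_pos x0). destruct hor as [h|[h|h]]; lra. }
    assert (ln (esq l x y + eta) <= ln (B ^ 2 + eta)).
    { assert (esq l x y <= B ^ 2) by (apply esq_le_mass; auto; lra).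
      pose proof (esq_nonneg l x y). apply ln_le; lra. }
    lra.
  - unfold r; lra.
  - unfold r; pose proof (Rabs_pos x0); lra.
Qed.

(** * Uniqueness on an interval *)

(** High on the imaginary axis the constant term 1 dominates, which bounds [|F(iY)|] from below. A
    single kernel over 0 with a large weight [L] lets smallness on [[-r, r]] outweigh the trivial
    bound elsewhere on the axis and contradict this. *)
Lemma uniqueness_bound S0 r : 0 <= S0 -> 0 < r -> exists eps0, 0 < eps0 /\
  forall l eps, (forall p, In p l -> ln 2 <= snd p) -> mass l <= S0 ->
  (forall t, Rabs t <= r -> esq ((RtoC 1, 0) :: l) t 0 <= eps) -> eps0 <= eps.
Proof.
  intros hS hr.
  assert (hln2 : 0 < ln 2) by (rewrite <- ln_1; apply ln_increasing; lra).
  (* At height [Y] each other term shrinks by [e^(-tY) <= 1 / (1 + Y ln 2)], so together they are at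
     most [S0 / (1 + 2 S0) <= 1/2]. *)
  set (Y := 2 * S0 / ln 2).
  assert (hY : 0 <= Y) by (unfold Y; apply Rmult_le_pos; [lra|left; now apply Rinv_0_lt_compat]).
  (* [b] is so small that the boundary values off [[-r, r]], at most [d0], do not exceed [k0], that
     is half of the lower bound [1 / (Y + b)] for the kernel at [iY]. *)
  set (b := Rmin r (r ^ 4 / (4 * r ^ 2 * (Y + r)))).
  assert (hb : 0 < b).
  { unfold b. apply Rmin_pos; [lra|]. apply Rdiv_lt_0_compat; [apply pow_lt; lra|].
    apply Rmult_lt_0_compat; [nra|lra]. }
  set (d0 := 2 * b ^ 3 / r ^ 4).
  assert (hr4 : 0 < r ^ 4) by (apply pow_lt; lra).
  assert (hd0 : d0 <= / (2 * (Y + b))).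
  { assert (h1 : b <= r) by apply Rmin_l.
    assert (h2 : b <= r ^ 4 / (4 * r ^ 2 * (Y + r))) by apply Rmin_r.
    assert (h3 : b * (4 * r ^ 2 * (Y + r)) <= r ^ 4).
    { replace (r ^ 4) with (r ^ 4 / (4 * r ^ 2 * (Y + r)) * (4 * r ^ 2 * (Y + r))) by (field; lra).
      apply Rmult_le_compat_r; [nra|exact h2]. }
    unfold d0. apply Rmult_le_reg_r with (r ^ 4 * (2 * (Y + b))); [apply Rmult_lt_0_compat; lra|].
    replace (2 * b ^ 3 / r ^ 4 * (r ^ 4 * (2 * (Y + b)))) with (b ^ 2 * (b * (4 * (Y + b)))) by (field; lra).
    replace (/ (2 * (Y + b)) * (r ^ 4 * (2 * (Y + b)))) with (r ^ 4) by (field; lra).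
    assert (b ^ 2 <= r ^ 2) by (apply pow_incr; lra).
    apply Rle_trans with (r ^ 2 * (b * (4 * (Y + r)))); [|lra].
    apply Rmult_le_compat; try nra. }
  set (k0 := / (2 * (Y + b))).
  assert (hk0 : 0 < k0) by (unfold k0; apply Rinv_0_lt_compat; lra).
  set (B := 1 + S0).
  (* The net gain at [iY] is at least [2 L (2 k0 - d0) >= 2 L k0], which exceeds
     [ln (B^2 + 1) + ln 4] by 1. *)
  set (L := (ln (B ^ 2 + 1) + ln 4 + 1) / (2 * k0)).
  assert (hB1 : 0 < ln (B ^ 2 + 1)) by (rewrite <- ln_1; apply ln_increasing; unfold B; nra).
  assert (hl4 : 0 < ln 4) by (rewrite <- ln_1; apply ln_increasing; lra).
  assert (hL : 0 < L) by (unfold L; apply Rdiv_lt_0_compat; lra).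
  (* On [[-r, r]] twice the potential is at most [4 L / b]. The factor 1/2 is there because [eps0]
     also serves as the regulariser, so that [esq + eps0] stays below [2 eps0]. *)
  set (eps0 := Rmin (1 / 2) (exp (- 4 * L / b) / 2)).
  assert (hexp := exp_pos (- 4 * L / b)).
  exists eps0. split; [apply Rmin_pos; lra|].
  intros l eps hl hm hsm. apply Rnot_lt_le; intros hlt.
  set (l' := (RtoC 1, 0) :: l) in *.
  assert (hl' : forall p, In p l' -> 0 <= snd p).
  { intros p [<-|hp]; [simpl; lra|]. specialize (hl p hp); lra. }
  assert (hm' : mass l' <= B).
  { unfold l', mass. rewrite rsum_cons. simpl fst. rewrite Cmod_1. unfold mass in hm; unfold B; lra. }
  assert (he2 : eps0 <= 1 / 2) by apply Rmin_l.
  assert (he3 : eps0 <= exp (- 4 * L / b) / 2) by apply Rmin_r.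
  assert (heps0 : 0 < eps0) by (apply Rmin_pos; lra).
  assert (hmain : ln (esq l' 0 Y + eps0) + 2 * potential b ((L, 0) :: nil) 0 Y
      <= ln (B ^ 2 + 1) + 2 * L * d0).
  { assert (hd0' : 0 < d0) by (unfold d0; apply Rdiv_lt_0_compat; [|lra]; apply Rmult_lt_0_compat; [lra|apply pow_lt; lra]).
    assert (hBe : ln (B ^ 2 + eps0) < ln (B ^ 2 + 1)) by (apply ln_increasing; unfold B; nra).
    apply halfplane_bound with (B := B); auto.
    - intros k [<-|[]]; simpl; lra.
    - assert (0 < L * d0) by (apply Rmult_lt_0_compat; lra). lra.
    - intros x. unfold potential. rewrite rsum_cons. simpl fst; simpl snd.
      change (rsum _ nil) with 0. rewrite kernel_boundary by lra.
      replace (x - 0) with x by ring.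
      assert (hb2 : 0 < b ^ 2) by (apply pow_lt; lra).
      assert (hb3 : 0 < b ^ 3) by (apply pow_lt; lra).
      assert (hx2 := pow2_ge_0 x).
      destruct (Rle_lt_dec (Rabs x) r) as [hx|hx].
      + specialize (hsm x hx).
        assert (h1 : ln (esq l' x 0 + eps0) <= - 4 * L / b).
        { rewrite <- ln_exp. pose proof (esq_nonneg l' x 0). apply ln_le; lra. }
        assert (h2 : 2 * b ^ 3 / (x ^ 2 + b ^ 2) ^ 2 <= 2 / b).
        { apply Rmult_le_reg_r with (b * (x ^ 2 + b ^ 2) ^ 2); [apply Rmult_lt_0_compat; nra|].
          replace (2 * b ^ 3 / (x ^ 2 + b ^ 2) ^ 2 * (b * (x ^ 2 + b ^ 2) ^ 2)) with (2 * (b ^ 2 * b ^ 2)) by (field; nra).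
          replace (2 / b * (b * (x ^ 2 + b ^ 2) ^ 2)) with (2 * (x ^ 2 + b ^ 2) ^ 2) by (field; nra). nra. }
        assert (h3 : L * (2 * b ^ 3 / (x ^ 2 + b ^ 2) ^ 2) <= L * (2 / b)) by (apply Rmult_le_compat_l; lra).
        replace (- 4 * L / b) with (- (2 * (L * (2 / b)))) in h1 by (field; lra).
        assert (0 < L * d0) by (apply Rmult_lt_0_compat; lra). lra.
      + assert (h1 : ln (esq l' x 0 + eps0) <= ln (B ^ 2 + 1)).
        { pose proof (esq_nonneg l' x 0).
          assert (esq l' x 0 <= B ^ 2) by (apply esq_le_mass; auto; lra). apply ln_le; lra. }
        assert (h2 : 2 * b ^ 3 / (x ^ 2 + b ^ 2) ^ 2 <= d0).
        { unfold d0. apply Rmult_le_compat_l; [lra|]. apply Rinv_le_contravar; [lra|].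
          assert (r ^ 2 <= x ^ 2) by (rewrite <- (pow2_abs x); apply pow_incr; lra).
          assert (0 <= r ^ 2) by apply pow2_ge_0.
          replace (r ^ 4) with (r ^ 2 * r ^ 2) by ring. nra. }
        assert (L * (2 * b ^ 3 / (x ^ 2 + b ^ 2) ^ 2) <= L * d0) by (apply Rmult_le_compat_l; lra). lra. }
  assert (hk : 2 * k0 <= kernel b 0 0 Y).
  { rewrite kernel_num by lra. unfold k0. replace (0 - 0) with 0 by ring.
    replace ((Y * 0 ^ 2 + (Y + b) ^ 3 + b * (Y + b) ^ 2) / (0 ^ 2 + (Y + b) ^ 2) ^ 2)
      with (2 * / (2 * (Y + b)) + b / (Y + b) ^ 2) by (field; lra).
    assert (0 < b / (Y + b) ^ 2) by (apply Rdiv_lt_0_compat; [lra|apply pow_lt; lra]). lra. }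
  assert (hlow : / 4 <= esq l' 0 Y).
  { assert (h1 : / 2 <= eRe l' 0 Y).
    { unfold l', eRe. rewrite rsum_cons. simpl. rewrite !Rmult_0_l, Ropp_0, exp_0, cos_0.
      assert (h : - (/ (1 + Y * ln 2) * S0) <= eRe l 0 Y).
      { eapply Rle_trans with (rsum (fun p => - / (1 + Y * ln 2) * Cmod (fst p)) l).
        - rewrite rsum_scal. fold (mass l). rewrite <- Ropp_mult_distr_l. apply Ropp_le_contravar.
          apply Rmult_le_compat_l; [|exact hm]. left; apply Rinv_0_lt_compat. nra.
        - apply rsum_le. intros [[u v] t] hp. simpl fst; simpl snd. simpl Re; simpl Im.
          rewrite Rmult_0_r, cos_0, sin_0. specialize (hl _ hp); simpl in hl.
          assert (hu : - Cmod (u, v) <= u).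
          { destruct (abs_le_Cmod (u, v)) as [h _]. change (Rabs u <= Cmod (u, v)) in h.
            pose proof (Rle_abs (- u)). rewrite Rabs_Ropp in *. lra. }
          assert (he : exp (- (t * Y)) <= / (1 + Y * ln 2)).
          { rewrite exp_Ropp. apply Rinv_le_contravar; [nra|].
            pose proof (exp_ineq1_le (t * Y)). nra. }
          pose proof (exp_pos (- (t * Y))). pose proof (Cmod_ge_0 (u, v)). nra. }
      assert (/ (1 + Y * ln 2) * S0 <= / 2).
      { replace (Y * ln 2) with (2 * S0) by (unfold Y; field; lra).
        apply Rmult_le_reg_l with (1 + 2 * S0); [lra|]. rewrite <- Rmult_assoc, Rinv_r by lra. lra. }
      unfold eRe in h. lra. }
    unfold esq. pose proof (pow2_ge_0 (eIm l' 0 Y)). nra. }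
  assert (h5 : - ln 4 <= ln (esq l' 0 Y + eps0)).
  { rewrite <- ln_Rinv by lra. apply ln_le; lra. }
  unfold potential in hmain. rewrite rsum_cons in hmain. simpl fst in hmain; simpl snd in hmain.
  change (rsum _ nil) with 0 in hmain.
  assert (h6 : L * (2 * k0) <= L * kernel b 0 0 Y) by (apply Rmult_le_compat_l; lra).
  assert (h7 : L * d0 <= L * k0) by (apply Rmult_le_compat_l; [lra|exact hd0]).
  assert (h8 : L * (2 * k0) = ln (B ^ 2 + 1) + ln 4 + 1) by (unfold L; field; lra).
  lra.
Qed.

(** * Lagrange interpolation *)

Module LagrangeCoefficients.
Import all_boot all_order all_algebra qpoly Rstruct.
Import Order.TTheory GRing.Theory Num.Theory.
Local Open Scope ring_scope.

(** The Lagrange basis polynomial of the node [u i], evaluated at 0: these are the weights of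
    extrapolation to 0. *)
Definition coef (m : nat) (u : nat -> R) (i : nat) : R :=
  (\prod_(j < m | val j != i) (u i - u j))^-1 * \prod_(j < m | val j != i) (0 - u j).

Lemma coef_exact (m : nat) (u : nat -> R) (k : nat) :
  injective u -> (k < m)%N -> \sum_(i < m) coef m u i * u i ^+ k = (k == 0%N)%:R.
Proof.
move=> uinj km; have m0 : (0 < m)%N by apply: leq_ltn_trans km.
have sX : (size ('X^k : {poly R}) <= m)%N by rewrite size_polyXn.
have := congr1 (horner^~ 0) (lagrange_gen m0 uinj sX).
rewrite hornerXn expr0n => ->; rewrite horner_sum; apply: eq_bigr => i _.
rewrite hornerM hornerC hornerXn mulrC (lagrangeE m0 uinj) hornerM hornerC !horner_prod.
by congr (_ * (_^-1 * _)); apply: eq_bigr => j _; rewrite !hornerE.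
Qed.

(** The distance of [i] and [j] is written as a sum of two truncated differences, one of which is 0.
    The factors left of [i] give [i!], those right of it the other factorial. *)
Lemma prod_dist (m i : nat) : (i < m)%N ->
  (\prod_(j < m | val j != i) ((i - j) + (j - i)) = i`! * (m.-1 - i)`!)%N.
Proof.
move=> im.
rewrite -(big_mkord (fun j => j != i) (fun j => (i - j + (j - i))%N)).
rewrite (big_cat_nat (n := i)) //=; last exact: ltnW.
have prodl n : (\prod_(0 <= j < n) (n - j) = n`!)%N.
  elim: n => [|n IH]; first by rewrite big_geq.
  by rewrite big_nat_recl // factS subn0 -IH; congr (_ * _)%N; apply: eq_bigr => j _; rewrite subSS.
congr (_ * _)%N.
  rewrite -prodl big_nat_cond [RHS]big_nat_cond; apply: eq_big => [j|j].
    by rewrite andbT; case: ltngtP => //=; rewrite ?andbF.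
  by move=> /andP[/andP[_ ji] _]; rewrite (eqP (ltnW ji : (j - i == 0)%N)) addn0.
rewrite big_ltn_cond // eqxx /= big_add1 -{1}(add0n i) big_addn fact_prod [RHS]big_add1 /=.
rewrite big_nat_cond [RHS]big_nat_cond; apply: eq_big => [j|j _].
  by rewrite !andbT neq_ltn ltnS leq_addl orbT andbT.
rewrite -addSn addnK; suff /eqP-> : (i - (j.+1 + i) == 0)%N by rewrite add0n.
by rewrite subn_eq0 leq_addl.
Qed.

(** The numerator is at most [L^(m-1)] and the denominator at least [g^(m-1) i! (m-1-i)!]. Since the
    binomial coefficient is at most [2^(m-1)], the two factorials may be replaced by [(m-1)!] at the
    cost of the 2 in [2 L]. *)
Lemma coef_bound (m : nat) (u : nat -> R) (L g : R) (i : nat) :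
  (i < m)%N -> 0 < g -> 0 <= L -> (forall j, (j < m)%N -> `|u j| <= L) ->
  (forall j, (j < m)%N -> g * ((i - j) + (j - i))%:R <= `|u i - u j|) ->
  `|coef m u i| * (g ^+ m.-1 * (m.-1)`!%:R) <= (2 * L) ^+ m.-1.
Proof.
move=> im g0 L0 uL ug; rewrite normrM normfV !normr_prod.
have cardE : #|[pred j : 'I_m | val j != i]| = m.-1.
  by rewrite -[m in RHS]card_ord -(cardC1 (Ordinal im)); apply: eq_card => j; rewrite !inE.
have num : \prod_(j < m | val j != i) `|0 - u j| <= L ^+ m.-1.
  rewrite -cardE -prodr_const; apply: ler_prod => j _.
  by rewrite normr_ge0 sub0r normrN uL.
have den : g ^+ m.-1 * (i`! * (m.-1 - i)`!)%:R <= \prod_(j < m | val j != i) `|u i - u j|.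
  rewrite -(prod_dist _ _ im) natr_prod -cardE -prodr_const -big_split /=.
  apply: ler_prod => j _; rewrite ug // andbT.
  by rewrite mulr_ge0 ?ler0n // ltW.
have den0 : 0 < g ^+ m.-1 * (i`! * (m.-1 - i)`!)%:R.
  by rewrite mulr_gt0 ?exprn_gt0 // ltr0n muln_gt0 !fact_gt0.
have bin2 : ('C(m.-1, i) <= 2 ^ m.-1)%N.
  rewrite -[2%N]/(1 + 1)%N expnDn (bigD1 (inord i : 'I_m.-1.+1)) //= inordK; last by case: m im {uL ug cardE num den den0}.
  by rewrite !exp1n !muln1 leq_addr.
have im1 : (i <= m.-1)%N by case: m im {uL ug cardE num den den0 bin2}.
have fac : g ^+ m.-1 * (m.-1)`!%:R <= 2 ^+ m.-1 * \prod_(j < m | val j != i) `|u i - u j|.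
  apply: le_trans (ler_wpM2l _ den); last by rewrite exprn_ge0 ?ler0n.
  rewrite -(bin_fact im1) natrM mulrCA; apply: ler_wpM2r; first exact: ltW.
  by rewrite -natrX ler_nat.
have dpos := lt_le_trans den0 den.
apply: le_trans (ler_wpM2l _ fac) _.
  by rewrite mulr_ge0 ?invr_ge0 ?(ltW dpos) //; apply: prodr_ge0 => j _.
rewrite mulrC -mulrA [X in _ * X]mulrA mulfV ?gt_eqF // mul1r exprMn.
by apply: ler_wpM2l => //; rewrite exprn_ge0 ?ler0n.
Qed.
Lemma rsum_bigE (f : nat -> R) m : rsum f (List.seq 0 m) = \sum_(i < m) f i.
Proof.
elim: m => [|m IH]; first by rewrite big_ord0.
by rewrite List.seq_S rsum_app IH big_ord_recr /= RplusE /rsum /= Rplus_0_r.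
Qed.

Lemma factE n : Factorial.fact n = n`!.
Proof. by elim: n => //= n ->; rewrite factS mulSn. Qed.

Local Open Scope R_scope.

Lemma coef_exact_Stdlib m u k :
  injective u -> (k < m)%coq_nat ->
  rsum (fun i => coef m u i * pow (u i) k) (List.seq 0 m) = (if Nat.eqb k 0 then 1 else 0).
Proof.
move=> ui /ssrnat.ltP km; rewrite rsum_bigE; under eq_bigr do rewrite RpowE.
by rewrite (coef_exact _ _ _ ui km); case: k km.
Qed.

Lemma coef_bound_Stdlib m u (L g : R) i :
  (i < m)%coq_nat -> (0 < g) -> (0 <= L) ->
  (forall j, (j < m)%coq_nat -> (Rabs (u j) <= L)) ->
  (forall j, (j < m)%coq_nat -> (g * INR ((i - j)%coq_nat + (j - i)%coq_nat)%coq_nat <= Rabs (u i - u j))) ->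
  (Rabs (coef m u i) * (pow g (m - 1) * INR (Factorial.fact (m - 1))) <= pow (2 * L) (m - 1)).
Proof.
move=> /ssrnat.ltP im /RltP g0 /RleP L0 uL ug; apply/RleP.
rewrite RabsE !RpowE INRE factE subn1.
apply: (coef_bound m u L g i im g0 L0) => j /ssrnat.ltP jm.
  by apply/RleP; rewrite -RabsE; apply: uL.
by apply/RleP; rewrite -RabsE -INRE; apply: ug.
Qed.
End LagrangeCoefficients.

Lemma lagrange_weights (m : nat) (u : nat -> R) (L g : R) :
  0 < g -> (forall j, (j < m)%nat -> Rabs (u j) <= L) ->
  (forall i j, (i < j)%nat -> g * INR (j - i) <= u j - u i) ->
  exists c : nat -> R,
    (forall k, (k < m)%nat ->
       rsum (fun i => c i * u i ^ k) (seq 0 m) = if Nat.eqb k 0 then 1 else 0) /\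
    (forall i, (i < m)%nat ->
       Rabs (c i) * (g ^ (m - 1) * INR (fact (m - 1))) <= (2 * L) ^ (m - 1)).
Proof.
  intros hg hL hu.
  assert (hlt : forall i j, (i < j)%nat -> u i < u j).
  { intros i j h. specialize (hu i j h). assert (0 < INR (j - i)) by (apply lt_0_INR; lia). nra. }
  exists (LagrangeCoefficients.coef m u). split.
  - intros k hk. apply LagrangeCoefficients.coef_exact_Stdlib; [|exact hk].
    intros i j e. destruct (Nat.lt_trichotomy i j) as [h|[h|h]]; auto;
        apply hlt in h; rewrite e in h; lra.
  - intros i hi.
    assert (hL0 : 0 <= L) by (eapply Rle_trans; [apply Rabs_pos|apply (hL i hi)]).
    apply LagrangeCoefficients.coef_bound_Stdlib; auto.
    intros j hj. destruct (Nat.lt_trichotomy i j) as [h|[->|h]].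
    + replace (i - j + (j - i))%nat with (j - i)%nat by lia.
      rewrite Rabs_minus_sym. eapply Rle_trans; [apply (hu i j h)|apply Rle_abs].
    + replace (j - j + (j - j))%nat with O by lia. rewrite Rmult_0_r. apply Rabs_pos.
    + replace (i - j + (j - i))%nat with (i - j)%nat by lia.
      eapply Rle_trans; [apply (hu j i h)|apply Rle_abs].
Qed.

(** * Extrapolation of exponential sums *)

Lemma fact_pos n : 0 < INR (fact n).
Proof. apply lt_0_INR, lt_O_fact. Qed.

(** Passing from [n] to [n + 1] multiplies the quotient of the left side by the factorial by
    [(1 + 1/n)^n <= e <= 3]. *)
Lemma pow_self_le_fact m : INR m ^ m <= 3 ^ m * INR (fact m).
Proof.
  induction m as [|m IH]; [simpl; lra|].
  destruct m as [|m]; [simpl; lra|].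
  set (n := S m) in *. assert (hn : 0 < INR n) by (apply lt_0_INR; unfold n; lia).
  assert (h1 : (1 + / INR n) ^ n <= 3).
  { apply Rle_trans with (exp 1); [|apply exp_le_3].
    replace (exp 1) with (exp (/ INR n) ^ n).
    - apply pow_incr. split; [pose proof (Rinv_0_lt_compat _ hn); lra|]. apply exp_ineq1_le.
    - assert (e : forall k, exp (/ INR n) ^ k = exp (INR k * / INR n)).
      { induction k as [|k IHk]; [simpl; now rewrite Rmult_0_l, exp_0|].
        rewrite (S_INR k). cbn [pow]. rewrite IHk, <- exp_plus. f_equal. ring. }
      rewrite e. f_equal. field. lra. }
  assert (h2 : INR (S n) ^ n = INR n ^ n * (1 + / INR n) ^ n).
  { rewrite <- Rpow_mult_distr. f_equal. rewrite (S_INR n). field. lra. }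
  change (fact (S n)) with (S n * fact n)%nat. rewrite mult_INR.
  change (INR (S n) ^ S n) with (INR (S n) * INR (S n) ^ n).
  change (3 ^ S n) with (3 * 3 ^ n). rewrite h2.
  pose proof (pos_INR (S n)). pose proof (fact_pos n).
  assert (INR n ^ n * (1 + / INR n) ^ n <= 3 ^ n * INR (fact n) * 3).
  { apply Rmult_le_compat; auto; apply pow_le; pose proof (Rinv_0_lt_compat _ hn); lra. }
  nra.
Qed.

Lemma INR_le_pow2 m : INR m <= 2 ^ m.
Proof.
  induction m as [|m IH]; [simpl; lra|]. rewrite S_INR. simpl pow.
  assert (1 <= 2 ^ m) by (apply pow_R1_Rle; lra). lra.
Qed.

(** Writing each derivative as a quarter turn of the phase avoids a case distinction modulo 4 and
    shows the bound [t^k] at once. *)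
Lemma is_derive_n_cos t a k s :
  is_derive_n (fun s => cos (t * s + a)) k s (t ^ k * cos (t * s + a + INR k * (PI / 2))).
Proof.
  revert s; induction k as [|k IH]; intros s.
  - simpl. rewrite Rmult_1_l, Rmult_0_l, Rplus_0_r. reflexivity.
  - apply (is_derive_ext (fun s => t ^ k * cos (t * s + a + INR k * (PI / 2)))).
    { intros z. symmetry. now apply is_derive_n_unique. }
    rewrite S_INR. replace (t * s + a + (INR k + 1) * (PI / 2)) with
      (PI / 2 + (t * s + a + INR k * (PI / 2))) by ring.
    replace (cos (PI / 2 + (t * s + a + INR k * (PI / 2)))) with (- sin (t * s + a + INR k * (PI / 2)))
      by (rewrite cos_plus, cos_PI2, sin_PI2; ring).
    auto_derive; [exact I|]. simpl; ring.
Qed.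

Lemma cos_taylor t a m : 0 <= t -> (1 <= m)%nat -> exists p : nat -> R, p O = cos a /\
  forall u, 0 <= u ->
    Rabs (cos (t * u + a) - rsum (fun k => p k * u ^ k) (seq 0 m)) <= (t * u) ^ m / INR (fact m).
Proof.
  intros ht hm. destruct m as [|m]; [lia|].
  exists (fun k => t ^ k * cos (a + INR k * (PI / 2)) / INR (fact k)).
  split; [simpl; rewrite Rmult_0_l, Rplus_0_r; field|].
  intros u hu.
  assert (hsum : forall n, sum_f_R0 (fun k => (u - 0) ^ k / INR (fact k) *
        Derive_n (fun s => cos (t * s + a)) k 0) n =
      rsum (fun k => t ^ k * cos (a + INR k * (PI / 2)) / INR (fact k) * u ^ k) (seq 0 (S n))).
  { assert (hd : forall k, Derive_n (fun s => cos (t * s + a)) k 0 = t ^ k * cos (a + INR k * (PI / 2))).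
    { intros k. rewrite (is_derive_n_unique _ _ _ _ (is_derive_n_cos t a k 0)). do 3 f_equal. ring. }
    induction n as [|n IH].
    - simpl. rewrite (hd O : cos (t * 0 + a) = _). unfold rsum; simpl. field.
    - rewrite seq_S, rsum_app, <- IH, tech5, hd, rsum_cons, Rminus_0_r, Nat.add_0_l.
      unfold rsum, fold_right, Rdiv; ring. }
  destruct (Rle_lt_or_eq_dec 0 u hu) as [hu'|<-].
  - destruct (Taylor_Lagrange (fun s => cos (t * s + a)) m 0 u hu') as [z [hz e]].
    { intros s _ k _. destruct k as [|k]; [exact I|]. exists (t ^ S k * cos (t * s + a + INR (S k) * (PI / 2))).
      exact (is_derive_n_cos t a (S k) s). }
    rewrite hsum in e. rewrite e.
    match goal with |- Rabs (?A + ?B - ?A) <= _ => replace (A + B - A) with B by ring end.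
    rewrite (is_derive_n_unique _ _ _ _ (is_derive_n_cos t a (S m) z)), Rminus_0_r, Rpow_mult_distr.
    unfold Rdiv. rewrite !Rabs_mult, Rabs_inv. rewrite (Rabs_pos_eq (INR _)) by (left; apply fact_pos).
    rewrite (Rabs_pos_eq (u ^ S m)) by (apply pow_le; lra).
    rewrite (Rabs_pos_eq (t ^ S m)) by (apply pow_le; lra).
    assert (Rabs (cos (t * z + a + INR (S m) * (PI / 2))) <= 1).
    { apply Rabs_le. apply COS_bound. }
    assert (0 <= t ^ S m) by (apply pow_le; lra).
    assert (0 <= u ^ S m) by (apply pow_le; lra).
    assert (0 <= / INR (fact (S m))) by (left; apply Rinv_0_lt_compat, fact_pos).
    replace (t ^ S m * u ^ S m * / INR (fact (S m))) with (u ^ S m * / INR (fact (S m)) * (t ^ S m * 1)) by ring.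
    apply Rmult_le_compat_l; [now apply Rmult_le_pos|]. now apply Rmult_le_compat_l.
  - rewrite <- hsum. specialize (hsum m). rewrite Rmult_0_r, pow_i by lia.
    unfold Rdiv at 2; rewrite Rmult_0_l.
    assert (e : forall n, sum_f_R0 (fun k => (0 - 0) ^ k / INR (fact k) * Derive_n (fun s => cos (t * s + a)) k 0) n = cos (0 + a)).
    { clear hsum. induction n as [|n IH].
      - simpl. rewrite Rmult_0_r. field.
      - rewrite tech5, IH, Rminus_0_r, pow_i by lia. unfold Rdiv; ring. }
    rewrite e, Rminus_diag, Rabs_R0. lra.
Qed.

Lemma rsum_kronecker m (p : nat -> R) (hm : (1 <= m)%nat) :
  rsum (fun k => p k * (if Nat.eqb k 0 then 1 else 0)) (seq 0 m) = p O.
Proof.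
  destruct m as [|m]; [lia|]. simpl seq. rewrite rsum_cons. simpl Nat.eqb.
  rewrite (rsum_ext _ (fun _ => 0 * 0)).
  - rewrite rsum_scal. ring.
  - intros k hk. apply in_seq in hk. destruct k; [lia|]. simpl. ring.
Qed.

(** The free phase [a] covers cosines and sines together and absorbs the base point [x], so the same
    weights extrapolate every exponential sum from the points [x + u i] to [x]. *)
Definition close_weights (m : nat) (L : R) (u c : nat -> R) : Prop :=
  forall t a, 0 <= t ->
    Rabs (cos a - rsum (fun i => c i * cos (t * u i + a)) (seq 0 m)) <=
    rsum (fun i => Rabs (c i)) (seq 0 m) * ((t * L) ^ m / INR (fact m)).

(** Nodes that are [2 g] apart within a length [8 m g] have weights at most [(8 m)^(m-1) / (m-1)!].
    With [m <= 2^m] and [m^m <= 3^m m!] their sum is at most [(8 * 2 * 3)^m]. The weights reproduce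
    the Taylor polynomial at 0 exactly, so only its remainder counts. *)
Lemma interpolation_weights m g (u : nat -> R) :
  (1 <= m)%nat -> 0 < g -> (forall i, (i < m)%nat -> 0 <= u i <= 8 * INR m * g) ->
  (forall i j, (i < j)%nat -> 2 * g * INR (j - i) <= u j - u i) ->
  exists c : nat -> R, rsum (fun i => Rabs (c i)) (seq 0 m) <= 48 ^ m /\
    close_weights m (8 * INR m * g) u c.
Proof.
  intros hm hg hu hsep.
  set (L := 8 * INR m * g).
  assert (hm0 : 1 <= INR m) by (apply (le_INR 1); exact hm).
  assert (hL : 0 <= L) by (unfold L; nra).
  destruct (lagrange_weights m u L (2 * g)) as [c [hc1 hc2]]; [lra| |exact hsep|].
  { intros j hj. specialize (hu j hj). rewrite Rabs_pos_eq; fold L in hu; lra. }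
  exists c. split.
  - assert (hci : forall i, In i (seq 0 m) -> Rabs (c i) <= (8 * INR m) ^ (m - 1) / INR (fact (m - 1))).
    { intros i hi. apply in_seq in hi. specialize (hc2 i ltac:(lia)).
      assert (hp : 0 < (2 * g) ^ (m - 1)) by (apply pow_lt; lra).
      pose proof (fact_pos (m - 1)).
      apply Rmult_le_reg_r with ((2 * g) ^ (m - 1) * INR (fact (m - 1))); [now apply Rmult_lt_0_compat|].
      eapply Rle_trans; [exact hc2|]. right.
      replace (2 * L) with (8 * INR m * (2 * g)) by (unfold L; ring).
      rewrite (Rpow_mult_distr (8 * INR m)). field. lra. }
    eapply Rle_trans; [apply rsum_le, hci|]. rewrite rsum_const, length_seq.
    destruct m as [|m]; [lia|]. replace (S m - 1)%nat with m by lia.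
    pose proof (pow_self_le_fact (S m)) as h1. pose proof (INR_le_pow2 (S m)) as h2.
    pose proof (fact_pos m) as h3.
    change (fact (S m)) with (S m * fact m)%nat in h1. rewrite mult_INR in h1.
    change (INR (S m) ^ S m) with (INR (S m) * INR (S m) ^ m) in h1.
    assert (h4 : INR (S m) ^ m <= 3 ^ S m * INR (fact m)).
    { apply Rmult_le_reg_l with (INR (S m)); [lra|]. lra. }
    rewrite Rpow_mult_distr.
    apply Rmult_le_reg_r with (INR (fact m)); [exact h3|].
    replace (INR (S m) * (8 ^ m * INR (S m) ^ m / INR (fact m)) * INR (fact m))
      with (8 ^ m * (INR (S m) * INR (S m) ^ m)) by (field; lra).
    replace (48 ^ S m * INR (fact m)) with (8 ^ S m * (2 ^ S m * (3 ^ S m * INR (fact m)))).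
    + assert (0 < 8 ^ m) by (apply pow_lt; lra).
      apply Rmult_le_compat; [lra| |simpl; lra|].
      * apply Rmult_le_pos; [lra|apply pow_le; lra].
      * apply Rmult_le_compat; auto; [lra|apply pow_le; lra].
    + rewrite <- Rmult_assoc, <- Rmult_assoc, <- !Rpow_mult_distr. do 2 f_equal. ring.
  - intros t a ht. destruct (cos_taylor t a m ht hm) as [p [hp0 hp]].
    assert (e : rsum (fun i => c i * rsum (fun k => p k * u i ^ k) (seq 0 m)) (seq 0 m) = cos a).
    { rewrite (rsum_ext _ (fun i => rsum (fun k => p k * (c i * u i ^ k)) (seq 0 m))).
      - rewrite rsum_exchange.
        rewrite (rsum_ext _ (fun k => p k * (if Nat.eqb k 0 then 1 else 0))).
        + now rewrite rsum_kronecker.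
        + intros k hk. apply in_seq in hk. rewrite rsum_scal, hc1 by lia. reflexivity.
      - intros i _. rewrite <- rsum_scal. apply rsum_ext. intros k _. ring. }
    rewrite <- e at 1. rewrite <- rsum_minus.
    eapply Rle_trans; [apply rsum_abs|]. rewrite Rmult_comm, <- rsum_scal. apply rsum_le.
    intros i hi. apply in_seq in hi. specialize (hu i ltac:(lia)).
    rewrite <- Rmult_minus_distr_l, Rabs_mult, Rmult_comm, (Rabs_minus_sym (rsum _ _)).
    apply Rmult_le_compat_r; [apply Rabs_pos|].
    eapply Rle_trans; [apply hp; lra|].
    apply Rmult_le_compat_r; [left; apply Rinv_0_lt_compat, fact_pos|].
    apply pow_incr. split; [apply Rmult_le_pos; lra|]. apply Rmult_le_compat_l; [lra|]. apply hu.
Qed.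

Lemma close_weights_esum m L u c l x H :
  close_weights m L u c -> 0 <= L -> (forall p, In p l -> 0 <= snd p <= H) ->
  let E := 2 * mass l * (rsum (fun i => Rabs (c i)) (seq 0 m) * ((H * L) ^ m / INR (fact m))) in
  Rabs (eRe l x 0 - rsum (fun i => c i * eRe l (x + u i) 0) (seq 0 m)) <= E /\
  Rabs (eIm l x 0 - rsum (fun i => c i * eIm l (x + u i) 0) (seq 0 m)) <= E.
Proof.
  intros hc hL hl E.
  set (Q := rsum (fun i => Rabs (c i)) (seq 0 m) * ((H * L) ^ m / INR (fact m))) in E.
  assert (hQ : forall t a, 0 <= t <= H ->
     Rabs (cos a - rsum (fun i => c i * cos (t * u i + a)) (seq 0 m)) <= Q).
  { intros t a ht. eapply Rle_trans; [apply hc; lra|]. unfold Q.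
    apply Rmult_le_compat_l; [apply rsum_nonneg; intros; apply Rabs_pos|].
    apply Rmult_le_compat_r; [left; apply Rinv_0_lt_compat, fact_pos|].
    apply pow_incr. split; [apply Rmult_le_pos; lra|]. apply Rmult_le_compat_r; lra. }
  (* The real and the imaginary part are both sums of this shape, the sine being a cosine with phase
     [- PI / 2]; the two cosines account for the factor 2 in [E]. *)
  assert (hgen : forall (f g : C * R -> R) (ph : C * R -> R),
     (forall p, In p l -> Rabs (f p) <= Cmod (fst p) /\ Rabs (g p) <= Cmod (fst p)) ->
     let V := fun s => rsum (fun p => f p * cos (snd p * s) + g p * cos (snd p * s - PI / 2)) l in
     Rabs (V x - rsum (fun i => c i * V (x + u i)) (seq 0 m)) <= E).
  { intros f g _ hfg V.
    assert (e : V x - rsum (fun i => c i * V (x + u i)) (seq 0 m) =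
      rsum (fun p => f p * (cos (snd p * x) - rsum (fun i => c i * cos (snd p * u i + snd p * x)) (seq 0 m)) +
                     g p * (cos (snd p * x - PI / 2) - rsum (fun i => c i * cos (snd p * u i + (snd p * x - PI / 2))) (seq 0 m))) l).
    { unfold V. rewrite (rsum_ext (fun i => c i * _)
        (fun i => rsum (fun p => c i * (f p * cos (snd p * (x + u i)) + g p * cos (snd p * (x + u i) - PI / 2))) l))
        by (intros i _; now rewrite rsum_scal).
      rewrite rsum_exchange, <- rsum_minus. apply rsum_ext. intros p _.
      rewrite !Rmult_minus_distr_l, <- !rsum_scal.
      rewrite (rsum_ext (fun i => c i * _) (fun i => f p * (c i * cos (snd p * u i + snd p * x)) +
         g p * (c i * cos (snd p * u i + (snd p * x - PI / 2))))).
      - rewrite rsum_plus. ring.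
      - intros i _. replace (snd p * (x + u i)) with (snd p * u i + snd p * x) by ring.
        replace (snd p * u i + snd p * x - PI / 2) with (snd p * u i + (snd p * x - PI / 2)) by ring. ring. }
    rewrite e. eapply Rle_trans; [apply rsum_abs|].
    replace E with (rsum (fun p => 2 * Q * Cmod (fst p)) l) by (rewrite rsum_scal; unfold E, mass; ring).
    apply rsum_le. intros p hp. specialize (hl p hp). destruct (hfg p hp) as [h1 h2].
    eapply Rle_trans; [apply Rabs_triang|]. rewrite !Rabs_mult.
    pose proof (hQ (snd p) (snd p * x) hl) as q1. pose proof (hQ (snd p) (snd p * x - PI / 2) hl) as q2.
    apply Rle_trans with (Cmod (fst p) * Q + Cmod (fst p) * Q); [|lra].
    apply Rplus_le_compat; apply Rmult_le_compat; auto using Rabs_pos. }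
  assert (hsin : forall z, cos (z - PI / 2) = sin z).
  { intros z. rewrite cos_minus, cos_PI2, sin_PI2. ring. }
  assert (hE : forall s, eRe l s 0 = rsum (fun p => Re (fst p) * cos (snd p * s) + - Im (fst p) * cos (snd p * s - PI / 2)) l
     /\ eIm l s 0 = rsum (fun p => Im (fst p) * cos (snd p * s) + Re (fst p) * cos (snd p * s - PI / 2)) l).
  { intros s. split; apply rsum_ext; intros p _; rewrite hsin, Rmult_0_r, Ropp_0, exp_0; ring. }
  split.
  - rewrite (proj1 (hE x)), (rsum_ext (fun i => c i * _) _ _ (fun i _ => f_equal (Rmult (c i)) (proj1 (hE (x + u i))))).
    apply (hgen (fun p => Re (fst p)) (fun p => - Im (fst p)) snd).
    intros p _. rewrite Rabs_Ropp. apply abs_le_Cmod.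
  - rewrite (proj2 (hE x)), (rsum_ext (fun i => c i * _) _ _ (fun i _ => f_equal (Rmult (c i)) (proj2 (hE (x + u i))))).
    apply (hgen (fun p => Im (fst p)) (fun p => Re (fst p)) snd).
    intros p _. destruct (abs_le_Cmod (fst p)); auto.
Qed.

(* Interpolation at [m] points of the window costs [48^m]; the [m]-th Taylor
   remainder of [e^(itx)] there is [(24 H g)^m], which wins for small [g]. *)
Lemma esum_interpolation l x H D0 m g tau (u : nat -> R) :
  (forall p, In p l -> 0 <= snd p <= H) -> mass l <= D0 -> 0 <= H -> 0 <= D0 ->
  (1 <= m)%nat -> 0 < g -> 0 <= tau ->
  (forall i, (i < m)%nat -> 0 <= u i <= 8 * INR m * g) ->
  (forall i j, (i < j)%nat -> 2 * g * INR (j - i) <= u j - u i) ->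
  (forall i, (i < m)%nat -> esq l (x + u i) 0 <= tau ^ 2) ->
  esq l x 0 <= (2 * 48 ^ m * (tau + 2 * D0 * (24 * H * g) ^ m)) ^ 2.
Proof.
  intros hl hD hH hD0 hm hg htau hu hsep hsm.
  destruct (interpolation_weights m g u hm hg hu hsep) as [c [hc1 hc2]].
  assert (hm0 : 1 <= INR m) by (apply (le_INR 1); exact hm).
  destruct (close_weights_esum m (8 * INR m * g) u c l x H hc2 ltac:(nra) hl) as [h1 h2].
  set (S := rsum (fun i => Rabs (c i)) (seq 0 m)) in *.
  assert (hS : 0 <= S) by (apply rsum_nonneg; intros; apply Rabs_pos).
  assert (hmass : 0 <= mass l) by (apply rsum_nonneg; intros; apply Cmod_ge_0).
  assert (hT : (H * (8 * INR m * g)) ^ m / INR (fact m) <= (24 * H * g) ^ m).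
  { replace (H * (8 * INR m * g)) with (8 * H * g * INR m) by ring.
    replace (24 * H * g) with (8 * H * g * 3) by ring.
    rewrite !(Rpow_mult_distr (8 * H * g)). pose proof (pow_self_le_fact m). pose proof (fact_pos m).
    unfold Rdiv. rewrite Rmult_assoc. apply Rmult_le_compat_l.
    - apply pow_le. apply Rmult_le_pos; lra.
    - apply Rmult_le_reg_r with (INR (fact m)); [assumption|]. rewrite Rmult_assoc, Rinv_l; lra. }
  assert (hT0 : 0 <= (H * (8 * INR m * g)) ^ m / INR (fact m)).
  { apply Rmult_le_pos; [apply pow_le; apply Rmult_le_pos; nra|left; apply Rinv_0_lt_compat, fact_pos]. }
  set (B := 48 ^ m * (tau + 2 * D0 * (24 * H * g) ^ m)).
  assert (hbd : forall V : R -> R, (forall i, (i < m)%nat -> Rabs (V (x + u i)) <= tau) ->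
     Rabs (V x - rsum (fun i => c i * V (x + u i)) (seq 0 m)) <=
       2 * mass l * (S * ((H * (8 * INR m * g)) ^ m / INR (fact m))) -> Rabs (V x) <= B).
  { intros V hV hVx.
    assert (Rabs (rsum (fun i => c i * V (x + u i)) (seq 0 m)) <= S * tau).
    { eapply Rle_trans; [apply rsum_abs|]. rewrite Rmult_comm. unfold S. rewrite <- rsum_scal.
      apply rsum_le. intros i hi. apply in_seq in hi. rewrite Rabs_mult, Rmult_comm.
      apply Rmult_le_compat_r; [apply Rabs_pos|]. apply hV; lia. }
    assert (Rabs (V x) <= S * tau + 2 * mass l * (S * ((H * (8 * INR m * g)) ^ m / INR (fact m)))).
    { replace (V x) with (rsum (fun i => c i * V (x + u i)) (seq 0 m) +
        (V x - rsum (fun i => c i * V (x + u i)) (seq 0 m))) by ring.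
      eapply Rle_trans; [apply Rabs_triang|]. lra. }
    unfold B. set (Q := (H * (8 * INR m * g)) ^ m / INR (fact m)) in *.
    assert (S * tau <= 48 ^ m * tau) by (apply Rmult_le_compat_r; lra).
    assert (S * Q <= 48 ^ m * (24 * H * g) ^ m) by (apply Rmult_le_compat; lra).
    assert (0 <= S * Q) by (apply Rmult_le_pos; lra).
    assert (mass l * (S * Q) <= D0 * (48 ^ m * (24 * H * g) ^ m)) by (apply Rmult_le_compat; lra).
    nra. }
  assert (habs : forall a b, a ^ 2 + b ^ 2 <= tau ^ 2 -> Rabs a <= tau /\ Rabs b <= tau).
  { intros a b h. rewrite <- (pow2_abs a), <- (pow2_abs b) in h.
    pose proof (Rabs_pos a). pose proof (Rabs_pos b). split; nra. }
  assert (b1 : Rabs (eRe l x 0) <= B).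
  { apply (hbd (fun s => eRe l s 0)); [|exact h1]. intros i hi. apply (habs _ _ (hsm i hi)). }
  assert (b2 : Rabs (eIm l x 0) <= B).
  { apply (hbd (fun s => eIm l s 0)); [|exact h2]. intros i hi. apply (habs _ _ (hsm i hi)). }
  rewrite (Rmult_assoc 2). fold B. unfold esq. rewrite <- (pow2_abs (eRe l x 0)), <- (pow2_abs (eIm l x 0)).
  pose proof (Rabs_pos (eRe l x 0)). pose proof (Rabs_pos (eIm l x 0)). nra.
Qed.

(** * Jensen's inequality against divergent decay *)

Lemma ln2_bounds : / 2 <= ln 2 <= 1.
Proof.
  split.
  - rewrite <- (ln_exp (/ 2)). apply ln_le; [apply exp_pos|].
    assert (h : exp (/ 2) * exp (/ 2) <= 3).
    { rewrite <- exp_plus. replace (/ 2 + / 2) with 1 by field. apply exp_le_3. }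
    pose proof (exp_pos (/ 2)). nra.
  - rewrite <- (ln_exp 1). apply ln_le; [lra|]. pose proof (exp_ineq1_le 1). lra.
Qed.

(** Comparison of a value of [1 / (1 + z^2)] with its integral over the next step of length
    [a <= 1], along which [1 + z^2 <= 3 (1 + d^2)]. *)
Lemma atan_increment d a : 0 < a <= 1 -> / (d ^ 2 + 1) <= 3 / a * (atan (d + a) - atan d).
Proof.
  intros ha.
  destruct (MVT_cor2 atan (fun z => / (1 + z ^ 2)) d (d + a)) as [z [hz1 hz2]]; [lra| |].
  { intros z _. apply is_derive_Reals. auto_derive; [exact I|]. rewrite Rmult_1_l. f_equal; unfold Rsqr; ring. }
  rewrite hz1. replace (3 / a * (/ (1 + z ^ 2) * (d + a - d))) with (3 * / (1 + z ^ 2)) by (field; nra).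
  apply Rmult_le_reg_r with ((d ^ 2 + 1) * (1 + z ^ 2)); [nra|].
  replace (/ (d ^ 2 + 1) * ((d ^ 2 + 1) * (1 + z ^ 2))) with (1 + z ^ 2) by (field; nra).
  replace (3 * / (1 + z ^ 2) * ((d ^ 2 + 1) * (1 + z ^ 2))) with (3 * (d ^ 2 + 1)) by (field; nra).
  assert ((z - d) ^ 2 <= 1) by nra. pose proof (pow2_ge_0 (2 * d - z)). nra.
Qed.

(** The increments of [atan] telescope. Their total is less than [PI <= 4] wherever [x] lies, and
    [ln 2 >= 1/2], which gives [3 * 4 * 2]. *)
Lemma sum_inv_sq_le x J :
  rsum (fun j => / ((x - INR j * ln 2) ^ 2 + 1)) (seq 1 J) <= 24.
Proof.
  destruct ln2_bounds as [hl1 hl2]. set (a := ln 2) in *.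
  assert (h : forall n, rsum (fun j => / ((x - INR j * a) ^ 2 + 1)) (seq 1 n) <=
     3 / a * (atan (INR (S n) * a - x) - atan (a - x))).
  { induction n as [|n IH].
    - unfold rsum; simpl. rewrite Rmult_1_l, Rminus_diag. lra.
    - rewrite seq_S, rsum_app, rsum_cons. change (rsum _ nil) with 0.
      pose proof (atan_increment (INR (S n) * a - x) a ltac:(lra)) as h.
      replace ((x - INR (1 + n) * a) ^ 2 + 1) with ((INR (S n) * a - x) ^ 2 + 1)
        by (change (1 + n)%nat with (S n); ring).
      replace (INR (S n) * a - x + a) with (INR (S (S n)) * a - x) in h by (rewrite (S_INR (S n)); ring).
      lra. }
  eapply Rle_trans; [apply h|].
  pose proof (atan_bound (INR (S J) * a - x)). pose proof (atan_bound (a - x)). pose proof PI_4.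
  apply Rle_trans with (3 / a * 4).
  - apply Rmult_le_compat_l; [|lra]. apply Rmult_le_pos; [lra|left; apply Rinv_0_lt_compat; lra].
  - apply Rmult_le_reg_r with a; [lra|]. unfold Rdiv. replace (3 * / a * 4 * a) with 12 by (field; lra). lra.
Qed.

(** The radius [r0] depends on the kernels and the bound [B] but not on F. The boundary inequality
    is thus needed only on a range that is known before the exponential sum is chosen. *)
Lemma halfplane_bound_loc b ks eta B c :
  0 < b -> 0 < eta -> (forall k, In k ks -> 0 <= fst k) -> ln (B ^ 2 + eta) < c ->
  exists r0, forall l x0 y0, (forall p, In p l -> 0 <= snd p) -> mass l <= B ->
    (forall x, Rabs x < r0 -> ln (esq l x 0 + eta) + 2 * potential b ks x 0 <= c) ->
    0 <= y0 -> ln (esq l x0 y0 + eta) + 2 * potential b ks x0 y0 <= c.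
Proof.
  intros hb heta hks hc.
  destruct (potential_far b ks ((c - ln (B ^ 2 + eta)) / 2) hb ltac:(lra) hks) as [r0 [hr0 hfar]].
  exists r0. intros l x0 y0 hl hm hbd hy0.
  apply halfplane_bound with (B := B); auto.
  intros x. destruct (Rlt_le_dec (Rabs x) r0) as [h|h]; [now apply hbd|].
  specialize (hfar x 0 (Rle_refl 0) (or_introl h)).
  assert (ln (esq l x 0 + eta) <= ln (B ^ 2 + eta)).
  { assert (esq l x 0 <= B ^ 2) by (apply esq_le_mass; auto; lra).
    pose proof (esq_nonneg l x 0). apply ln_le; lra. }
  lra.
Qed.

Lemma exp_nat_pow c m : exp (INR m * c) = exp c ^ m.
Proof.
  induction m as [|m IH]; [simpl; now rewrite Rmult_0_l, exp_0|].
  rewrite S_INR. cbn [pow]. rewrite <- IH, <- exp_plus. f_equal. ring.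
Qed.

Lemma exp_ge_2 : 2 <= exp 1.
Proof. pose proof (exp_ineq1_le 1). lra. Qed.

(** Extrapolation from about [W / 7] nodes to the right of [x]. The samples contribute
    [48^m e^(-W) <= e^(6m - W) <= e^(-m)] and the Taylor remainder [(48 * 24 * H g)^m <= 3^(-m)],
    which is where [3456 = 48 * 24 * 3] comes from. *)
Lemma decay_between_samples l H D0 s0 tau0 g W x X j :
  (forall p, In p l -> 0 <= snd p <= H) -> mass l <= D0 -> 0 < H -> 0 < D0 -> 0 < tau0 -> 0 < g ->
  3456 * (H * g) <= 1 -> s0 <= x -> 0 <= W -> INR j * ln 2 - x <= 2 * g / 7 * W ->
  x + 2 * g * W + 2 * g <= X ->
  (forall s, s0 <= s <= X -> INR j * ln 2 <= s ->
     exists xi, s <= xi <= s + 2 * g /\ esq l xi 0 <= (tau0 * exp (- W)) ^ 2) ->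
  esq l x 0 <= (6 * (tau0 + 2 * D0) * exp (- (W / 7))) ^ 2.
Proof.
  intros hl hm hH hD0 htau hg hgH hx hW hj hX hs.
  assert (he3 : / 3 <= exp (-(1))).
  { rewrite exp_Ropp. apply Rinv_le_contravar; [apply exp_pos|apply exp_le_3]. }
  (* If [m = 0] then [W < 7], and the trivial bound by the mass is enough. *)
  destruct (nfloor_ex (W / 7)) as [m [hm1 hm2]]; [lra|].
  destruct m as [|m0].
  - simpl in hm2. assert (esq l x 0 <= D0 ^ 2).
    { apply esq_le_mass; [lra| |exact hm]. intros p hp; apply hl, hp. }
    eapply Rle_trans; [eassumption|]. apply pow_incr. split; [lra|].
    assert (exp (-(1)) <= exp (- (W / 7))) by (left; apply exp_increasing; lra). nra.
  - set (m := S m0) in *.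
    assert (hm0 : 1 <= INR m) by (apply (le_INR 1); unfold m; lia).
    set (s := Rmax x (INR j * ln 2)).
    assert (hs1 : x <= s) by apply Rmax_l. assert (hs2 : INR j * ln 2 <= s) by apply Rmax_r.
    assert (hs3 : s <= x + 4 * INR m * g).
    { unfold s. apply Rmax_lub; [nra|]. assert (2 * g / 7 * W <= 4 * INR m * g) by nra. lra. }
    (* Windows of length [2 g] starting [4 g] apart keep the nodes [2 g] apart, and with
       [s <= x + 4 m g] they all fit into [8 m g]. From index [m] on dummy nodes continue the
       sequence, since the separation is required for all indices. *)
    assert (hch : forall i : nat, exists xi, (s + 4 * INR i * g <= xi <= s + 4 * INR i * g + 2 * g) /\
      ((i < m)%nat -> esq l xi 0 <= (tau0 * exp (- W)) ^ 2)).
    { intros i. pose proof (pos_INR i). destruct (Nat.lt_ge_cases i m) as [hi|hi].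
      - assert (hi' : INR i + 1 <= INR m) by (rewrite <- S_INR; apply le_INR; lia).
        assert (INR i * g + g <= INR m * g) by nra.
        assert (INR m * g <= W / 7 * g) by (apply Rmult_le_compat_r; lra).
        assert (0 <= INR i * g) by nra.
        destruct (hs (s + 4 * INR i * g)) as [xi [h1 h2]].
        + split; nra.
        + nra.
        + exists xi; auto.
      - exists (s + 4 * INR i * g). split; [split; nra|]. intros; lia. }
    apply choice in hch. destruct hch as [xi hxi].
    eapply Rle_trans.
    + apply (esum_interpolation l x H D0 m g (tau0 * exp (- W)) (fun i => xi i - x)); try lra; auto.
      * unfold m; lia.
      * pose proof (exp_pos (- W)). nra.
      * intros i hi. pose proof (pos_INR i).
        assert (hi' : INR i + 1 <= INR m) by (rewrite <- S_INR; apply le_INR; lia).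
        destruct (hxi i) as [[h1 h2] _].
        assert (0 <= INR i * g) by nra. assert (INR i * g + g <= INR m * g) by nra. split; lra.
      * intros i k hik. destruct (hxi i) as [[h1 h2] _]. destruct (hxi k) as [[h3 h4] _].
        rewrite minus_INR by lia. assert (INR i + 1 <= INR k) by (rewrite <- S_INR; apply le_INR; lia).
        nra.
      * intros i hi. replace (x + (xi i - x)) with (xi i) by ring. now apply hxi.
    + set (E := exp (- INR m)).
      assert (hE : 0 < E) by apply exp_pos.
      assert (h48 : 48 ^ m <= exp (6 * INR m)).
      { rewrite Rmult_comm, exp_nat_pow. apply pow_incr. split; [lra|].
        replace 6 with (1 + 1 + 1 + 1 + 1 + 1) by ring. rewrite !exp_plus.
        pose proof exp_ge_2 as h2. set (e := exp 1) in *.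
        assert (8 <= e * e * e) by nra. nra. }
      assert (hE' : E = exp (-(1)) ^ m) by (unfold E; rewrite <- exp_nat_pow; f_equal; ring).
      assert (h3 : 48 ^ m * (24 * H * g) ^ m <= E).
      { rewrite <- Rpow_mult_distr, hE'. apply pow_incr. split; [|nra].
        assert (0 < H * g) by (apply Rmult_lt_0_compat; lra). nra. }
      assert (h4 : 48 ^ m * exp (- W) <= E).
      { apply Rle_trans with (exp (6 * INR m) * exp (- W)).
        - apply Rmult_le_compat_r; [left; apply exp_pos|exact h48].
        - rewrite <- exp_plus. unfold E.
          destruct (Req_dec (6 * INR m + - W) (- INR m)) as [->|]; [lra|].
          left; apply exp_increasing. lra. }
      assert (h5 : E <= 3 * exp (- (W / 7))).
      { unfold E. apply Rle_trans with (exp (1 + - (W / 7))).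
        - left; apply exp_increasing. lra.
        - rewrite exp_plus. apply Rmult_le_compat_r; [left; apply exp_pos|apply exp_le_3]. }
      assert (0 <= 48 ^ m) by (apply pow_le; lra).
      assert (0 <= (24 * H * g) ^ m) by (apply pow_le; assert (0 < H * g) by (apply Rmult_lt_0_compat; lra); nra).
      apply pow_incr. split.
      * pose proof (exp_pos (- W)). assert (0 <= tau0 * exp (- W)) by nra.
        assert (0 <= D0 * (24 * H * g) ^ m) by nra.
        apply Rmult_le_pos; [nra|lra].
      * replace (2 * 48 ^ m * (tau0 * exp (- W) + 2 * D0 * (24 * H * g) ^ m)) with
          (2 * (tau0 * (48 ^ m * exp (- W)) + 2 * D0 * (48 ^ m * (24 * H * g) ^ m))) by ring.
        nra.
Qed.

(** Here the quartic decay pays: a weight that grows like the distance [|d|] still leaves the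
    summable [1 / (d^2 + 1)], whereas a kernel of size [1 / (d^2 + 1)] would leave a logarithmically
    divergent sum. *)
Lemma kernel_term_bound w K d : 0 <= w -> 0 <= K -> w <= K * (Rabs d + 1) ->
  w * (2 / (d ^ 2 + 1) ^ 2) <= 4 * K * / (d ^ 2 + 1).
Proof.
  intros hw hK h. rewrite <- (pow2_abs d). set (a := Rabs d) in *. assert (0 <= a) by apply Rabs_pos.
  apply Rmult_le_reg_r with ((a ^ 2 + 1) ^ 2); [nra|].
  replace (w * (2 / (a ^ 2 + 1) ^ 2) * (a ^ 2 + 1) ^ 2) with (2 * w) by (field; nra).
  replace (4 * K * / (a ^ 2 + 1) * (a ^ 2 + 1) ^ 2) with (4 * K * (a ^ 2 + 1)) by (field; nra).
  assert (0 <= (a - 1) ^ 2) by apply pow2_ge_0. nra.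
Qed.

(** Frequencies at most [H] make F change by at most [D0 H y] along the imaginary axis, so the lower
    bound at 0 passes to a point inside the half-plane. *)
Lemma eRe_vertical l H D0 y : (forall p, In p l -> 0 <= snd p <= H) -> mass l <= D0 -> 0 <= H -> 0 <= y ->
  eRe l 0 0 - D0 * (H * y) <= eRe l 0 y.
Proof.
  intros hl hm hH hy.
  assert (h : eRe l 0 0 - eRe l 0 y <= mass l * (H * y)).
  { unfold eRe, mass. rewrite <- rsum_minus, Rmult_comm, <- rsum_scal. apply rsum_le.
    intros [[a b] t] hp. specialize (hl _ hp). simpl in hl. simpl fst; simpl snd; simpl Re; simpl Im.
    rewrite !Rmult_0_r, cos_0, sin_0, Ropp_0, exp_0.
    assert (he1 : 1 - H * y <= exp (- (t * y))) by (pose proof (exp_ineq1_le (- (t * y))); nra).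
    assert (he2 : exp (- (t * y)) <= 1).
    { rewrite <- exp_0. destruct (Req_dec (t * y) 0) as [e0|e0]; [rewrite e0, Ropp_0; lra|].
      left; apply exp_increasing. nra. }
    assert (ha : Rabs a <= Cmod (a, b)).
    { apply (abs_le_Cmod (a, b)). }
    pose proof (Rle_abs a). assert (0 <= H * y) by nra.
    assert (a * (1 - exp (- (t * y))) <= Cmod (a, b) * (H * y)).
    { apply Rle_trans with (Cmod (a, b) * (1 - exp (- (t * y)))); [apply Rmult_le_compat_r; lra|].
      apply Rmult_le_compat_l; [apply Cmod_ge_0|lra]. }
    lra. }
  assert (mass l * (H * y) <= D0 * (H * y)) by (apply Rmult_le_compat_r; [nra|lra]). lra.
Qed.

(* Jensen's inequality for [F] in the upper half-plane, tested at [i Y] against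
   the majorant built from the weights [W]. *)
Lemma divergent_decay_impossible H l0 D0 s0 tau0 g (W : nat -> R) :
  0 < H -> 0 < l0 -> 0 < D0 -> 0 <= s0 -> 0 < tau0 -> 0 < g -> 3456 * (H * g) <= 1 ->
  (forall j, 0 <= W j <= INR j) ->
  (forall B, exists J, B <= rsum (fun j => W j / INR j ^ 2) (seq 1 J)) ->
  exists X, forall l, (forall p, In p l -> 0 <= snd p <= H) -> mass l <= D0 -> l0 <= eRe l 0 0 ->
    (forall j s, (1 <= j)%nat -> s0 <= s <= X -> INR j * ln 2 <= s ->
       exists xi, s <= xi <= s + 2 * g /\ esq l xi 0 <= (tau0 * exp (- W j)) ^ 2) -> False.
Proof.
  intros hH hl0 hD0 hs0 htau hg hgH hW hdiv.
  destruct ln2_bounds as [hl1 hl2].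
  set (D := 6 * (tau0 + 2 * D0)).
  assert (hD : D0 < D) by (unfold D; lra).
  (* [K1] covers the weights not controlled by the decay at [x]: [7 / (2g)] when [j ln 2] lies far
     to the right of [x], and [2 + 2 s0] when [x < s0], where [W j <= j <= 2 j ln 2]. *)
  set (K1 := 1 + 7 / (2 * g) + 2 + 2 * s0).
  set (Y := Rmin 1 (l0 / (2 * D0 * H))).
  assert (hDH : 0 < D0 * H) by (apply Rmult_lt_0_compat; lra).
  assert (hY : 0 < Y <= 1).
  { split; [apply Rmin_pos; [lra|apply Rdiv_lt_0_compat; lra]|apply Rmin_l]. }
  (* [672 = 7 * 4 * 24]. The sum of the kernels is at most [4 * 24 * (q + K1)], so twice the
     potential is at most [2 (q + K1) / 7], and [2 q / 7] is exactly the deficit of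
     [ln (esq + eta)]. *)
  set (gam := / 672).
  set (c := ln (D ^ 2 + 1) + 200 * K1).
  assert (h72g : 0 < 7 / (2 * g)) by (apply Rdiv_lt_0_compat; lra).
  assert (hK1 : 0 < K1) by (unfold K1; lra).
  assert (hlnmono : forall a b, 0 < a -> a <= b -> ln a <= ln b) by (intros; now apply ln_le).
  destruct (hdiv ((c - ln (l0 ^ 2 / 4) + 1) * 289 / (2 * gam * Y))) as [J hJ].
  (* Since [W j <= j <= J], the regulariser stays below every [e^(-2 W j / 7)] and does not mask the
     decay. *)
  set (eta := exp (- INR J)).
  assert (heta : 0 < eta <= 1).
  { split; [apply exp_pos|]. unfold eta. rewrite <- exp_0. pose proof (pos_INR J).
    destruct (Req_dec (INR J) 0) as [->|]; [rewrite Ropp_0; lra|left; apply exp_increasing; lra]. }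
  set (ks := map (fun j => (gam * W j, INR j * ln 2)) (seq 1 J)).
  assert (hks : forall k, In k ks -> 0 <= fst k).
  { intros k hk. apply in_map_iff in hk. destruct hk as [j [<- _]]. simpl. unfold gam. pose proof (hW j). lra. }
  assert (hpot : forall x y, potential 1 ks x y =
     gam * rsum (fun j => W j * kernel 1 (INR j * ln 2) x y) (seq 1 J)).
  { intros x y. unfold potential, ks. rewrite rsum_map, <- rsum_scal. apply rsum_ext.
    intros; simpl; ring. }
  assert (hDD : D0 ^ 2 < D ^ 2) by nra.
  assert (hcB : ln (D0 ^ 2 + eta) < c).
  { assert (ln (D0 ^ 2 + eta) <= ln (D ^ 2 + 1)) by (apply hlnmono; nra). unfold c. lra. }
  destruct (halfplane_bound_loc 1 ks eta D0 c ltac:(lra) ltac:(lra) hks hcB) as [r0 hbd].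
  (* Extrapolation to a point [x] with [|x| < r0] uses samples at most [2 g W j + 2 g] to its right,
     and [W j <= J]. *)
  exists (Rabs r0 + 2 * g * INR J + 2 * g).
  intros l hl hm hl0' hxi.
  assert (hl' : forall p, In p l -> 0 <= snd p) by (intros p hp; apply hl, hp).
  assert (hmain : ln (esq l 0 Y + eta) + 2 * potential 1 ks 0 Y <= c).
  { apply hbd; auto; [|lra].
    intros x hx. rewrite hpot. pose proof (esq_nonneg l x 0) as he0.
    assert (heB : esq l x 0 <= D0 ^ 2) by (apply esq_le_mass; auto; lra).
    (* The largest decay exponent that the actual size of F at [x] permits: a decay [D e^(-W j / 7)]
       at [x] forces [W j <= q]. *)
    set (q := 7 / 2 * (ln (D ^ 2 + 1) - ln (esq l x 0 + eta))).
    assert (hq : 0 <= q).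
    { assert (ln (esq l x 0 + eta) <= ln (D ^ 2 + 1)) by (apply hlnmono; lra). unfold q; lra. }
    assert (hsum : rsum (fun j => W j * kernel 1 (INR j * ln 2) x 0) (seq 1 J) <= 4 * (q + K1) * 24).
    { eapply Rle_trans; [|apply Rmult_le_compat_l; [lra|apply (sum_inv_sq_le x J)]].
      rewrite <- rsum_scal. apply rsum_le. intros j hj. apply in_seq in hj.
      rewrite kernel_boundary by lra. rewrite pow1, (pow1 2), Rmult_1_r.
      pose proof (hW j) as hWj.
      (* Three cases: [x] left of all samples, [j ln 2] near enough or to the left so that the decay
         at [x] bounds [W j] by [q], and [j ln 2] so far to the right that the distance bounds
         [W j]. *)
      apply kernel_term_bound; [lra|lra|].
      pose proof (Rabs_pos (x - INR j * ln 2)) as hab.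
      assert (hd : INR j * ln 2 - x <= Rabs (x - INR j * ln 2)).
      { rewrite Rabs_minus_sym. apply Rle_abs. }
      destruct (Rlt_le_dec x s0) as [hxs|hxs].
      - assert (W j <= 2 * (INR j * ln 2)) by nra.
        assert (W j <= K1 * (Rabs (x - INR j * ln 2) + 1)) by (unfold K1; nra). nra.
      - destruct (Rle_lt_dec (INR j * ln 2 - x) (2 * g / 7 * W j)) as [hgood|hbad].
        + assert (hJj : W j <= INR J) by (pose proof (le_INR j J ltac:(lia)); lra).
          assert (hdec := decay_between_samples l H D0 s0 tau0 g (W j) x (Rabs r0 + 2 * g * INR J + 2 * g) j
            hl hm hH hD0 htau hg hgH hxs ltac:(lra) hgood).
          assert (hdec' : esq l x 0 <= (D * exp (- (W j / 7))) ^ 2).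
          { apply hdec; [|intros; apply hxi; auto; lia].
            pose proof (Rle_abs x). pose proof (Rle_abs r0). assert (g * W j <= g * INR J) by nra. lra. }
          assert (hee : exp (- (W j / 7)) ^ 2 = exp (- (2 * W j / 7))).
          { simpl. rewrite Rmult_1_r, <- exp_plus. f_equal. field. }
          rewrite Rpow_mult_distr, hee in hdec'.
          assert (heta' : eta <= exp (- (2 * W j / 7))).
          { unfold eta. destruct (Req_dec (- INR J) (- (2 * W j / 7))) as [->|]; [lra|].
            left; apply exp_increasing. lra. }
          assert (hln : ln (esq l x 0 + eta) <= ln (D ^ 2 + 1) - 2 * W j / 7).
          { replace (ln (D ^ 2 + 1) - 2 * W j / 7) with (ln ((D ^ 2 + 1) * exp (- (2 * W j / 7)))).
            - apply hlnmono; lra.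
            - rewrite ln_mult, ln_exp; [ring|nra|apply exp_pos]. }
          assert (W j <= q) by (unfold q; lra). nra.
        + assert (W j <= 7 / (2 * g) * Rabs (x - INR j * ln 2)).
          { apply Rmult_le_reg_l with (2 * g / 7); [lra|].
            replace (2 * g / 7 * (7 / (2 * g) * Rabs (x - INR j * ln 2))) with (Rabs (x - INR j * ln 2)) by (field; lra).
            lra. }
          unfold K1. nra. }
    assert (gam * rsum (fun j => W j * kernel 1 (INR j * ln 2) x 0) (seq 1 J) <= (q + K1) / 7).
    { apply Rle_trans with (gam * (4 * (q + K1) * 24)); [apply Rmult_le_compat_l; [unfold gam; lra|exact hsum]|].
      unfold gam; lra. }
    unfold c. assert (ln (esq l x 0 + eta) = ln (D ^ 2 + 1) - 2 * q / 7) by (unfold q; field). lra. }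
  assert (hre : l0 / 2 <= eRe l 0 Y).
  { pose proof (eRe_vertical l H D0 Y hl hm ltac:(lra) ltac:(lra)).
    assert (D0 * (H * Y) <= l0 / 2).
    { apply Rle_trans with (D0 * H * (l0 / (2 * D0 * H))).
      - rewrite <- Rmult_assoc. apply Rmult_le_compat_l; [lra|apply Rmin_r].
      - right; field; lra. }
    lra. }
  assert (hlow : ln (l0 ^ 2 / 4) <= ln (esq l 0 Y + eta)).
  { apply hlnmono; [nra|]. unfold esq. pose proof (pow2_ge_0 (eIm l 0 Y)). nra. }
  (* [289 = 17^2]: with [a = j ln 2 >= 1/2] and [(Y + 1)^2 <= 4], the denominator is at most
     [(17 a^2)^2]. *)
  assert (hker : Y / 289 * rsum (fun j => W j / INR j ^ 2) (seq 1 J) <=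
     rsum (fun j => W j * kernel 1 (INR j * ln 2) 0 Y) (seq 1 J)).
  { rewrite <- rsum_scal. apply rsum_le. intros j hj. apply in_seq in hj.
    assert (hj1 : 1 <= INR j) by (apply (le_INR 1); lia). pose proof (hW j).
    replace (Y / 289 * (W j / INR j ^ 2)) with (W j * (Y / 289 * / INR j ^ 2)) by (unfold Rdiv; ring).
    apply Rmult_le_compat_l; [lra|].
    rewrite kernel_num by lra.
    set (a := INR j * ln 2). assert (ha : / 2 <= a) by (unfold a; nra).
    assert (haj : a ^ 2 <= INR j ^ 2) by (apply pow_incr; unfold a; nra).
    replace ((0 - a) ^ 2) with (a ^ 2) by ring.
    assert (ha2 : / 4 <= a ^ 2) by nra.
    apply Rle_trans with (Y * a ^ 2 / (17 * a ^ 2) ^ 2).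
    - replace (Y * a ^ 2 / (17 * a ^ 2) ^ 2) with (Y / 289 * / a ^ 2) by (field; nra).
      apply Rmult_le_compat_l; [lra|]. apply Rinv_le_contravar; lra.
    - assert (h1 : (Y + 1) ^ 2 <= 4) by nra.
      assert (h0 : 0 <= (Y + 1) ^ 2) by apply pow2_ge_0.
      apply Rmult_le_compat.
      + nra.
      + left; apply Rinv_0_lt_compat; nra.
      + assert (0 <= (Y + 1) ^ 3) by (apply pow_le; lra). lra.
      + apply Rinv_le_contravar; [nra|]. apply pow_incr. lra. }
  rewrite hpot in hmain.
  assert (hfin : (c - ln (l0 ^ 2 / 4) + 1) <= 2 * gam * (Y / 289 * rsum (fun j => W j / INR j ^ 2) (seq 1 J))).
  { replace (c - ln (l0 ^ 2 / 4) + 1) with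
      (2 * gam * (Y / 289 * ((c - ln (l0 ^ 2 / 4) + 1) * 289 / (2 * gam * Y)))) by (unfold gam; field; lra).
    apply Rmult_le_compat_l; [unfold gam; lra|]. apply Rmult_le_compat_l; [lra|exact hJ]. }
  assert (gam * (Y / 289 * rsum (fun j => W j / INR j ^ 2) (seq 1 J)) <=
    gam * rsum (fun j => W j * kernel 1 (INR j * ln 2) 0 Y) (seq 1 J)).
  { apply Rmult_le_compat_l; [unfold gam; lra|exact hker]. }
  lra.
Qed.

(** * Condensation *)

Lemma rsum_blocks (t : nat -> R) J :
  rsum t (seq 2 (2 ^ S J - 2)) = rsum (fun j => rsum t (seq (2 ^ j) (2 ^ j))) (seq 1 J).
Proof.
  induction J as [|J IH]; [reflexivity|].
  assert (h : (2 <= 2 ^ S J)%nat) by (simpl; pose proof (Nat.pow_nonzero 2 J); lia).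
  replace (2 ^ S (S J) - 2)%nat with ((2 ^ S J - 2) + 2 ^ S J)%nat
    by (rewrite (Nat.pow_succ_r' 2 (S J)); lia).
  rewrite seq_app, rsum_app, IH, (seq_S J 1), rsum_app.
  replace (2 + (2 ^ S J - 2))%nat with (2 ^ S J)%nat by lia.
  rewrite rsum_cons. change (rsum _ nil) with 0. simpl (1 + J)%nat. ring.
Qed.

Lemma rsum_seq_mono (t : nat -> R) a n m : (n <= m)%nat -> (forall i, (a <= i)%nat -> 0 <= t i) ->
  rsum t (seq a n) <= rsum t (seq a m).
Proof.
  intros hnm ht. replace m with (n + (m - n))%nat by lia. rewrite seq_app.
  apply rsum_incl_le. intros i hi. apply in_seq in hi. apply ht. lia.
Qed.

Lemma INR_pow2 j : INR (2 ^ j) = 2 ^ j.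
Proof. rewrite pow_INR. reflexivity. Qed.

Lemma le_pow2 n : (n < 2 ^ n)%nat.
Proof. induction n as [|n IH]; simpl; lia. Qed.

Lemma rsum_block_bounds (t : nat -> R) lo up j :
  (forall n, (2 ^ j <= n < 2 ^ S j)%nat -> lo <= 2 ^ j * t n <= up) ->
  lo <= rsum t (seq (2 ^ j) (2 ^ j)) <= up.
Proof.
  intros h. assert (hp : 0 < 2 ^ j) by (apply pow_lt; lra).
  assert (hn : forall n, In n (seq (2 ^ j) (2 ^ j)) -> lo / 2 ^ j <= t n <= up / 2 ^ j).
  { intros n hn. apply in_seq in hn. rewrite Nat.pow_succ_r' in h. specialize (h n ltac:(lia)).
    split; apply Rmult_le_reg_l with (2 ^ j); auto; unfold Rdiv.
    - replace (2 ^ j * (lo * / 2 ^ j)) with lo by (field; lra). lra.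
    - replace (2 ^ j * (up * / 2 ^ j)) with up by (field; lra). lra. }
  split.
  - apply Rle_trans with (rsum (fun _ => lo / 2 ^ j) (seq (2 ^ j) (2 ^ j))).
    + rewrite rsum_const, length_seq, INR_pow2. right; field; lra.
    + apply rsum_le. intros n hin. apply hn, hin.
  - apply Rle_trans with (rsum (fun _ => up / 2 ^ j) (seq (2 ^ j) (2 ^ j))).
    + apply rsum_le. intros n hin. apply hn, hin.
    + rewrite rsum_const, length_seq, INR_pow2. right; field; lra.
Qed.

Lemma ln_block j n : (1 <= j)%nat -> (2 ^ j <= n < 2 ^ S j)%nat ->
  INR j * ln 2 <= ln (INR n) <= INR (S j) * ln 2 /\ 2 ^ j <= INR n <= 2 ^ S j.
Proof.
  intros hj [h1 h2]. apply le_INR in h1. apply lt_INR in h2. rewrite INR_pow2 in h1, h2.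
  assert (hp : 0 < 2 ^ j) by (apply pow_lt; lra).
  split; [|lra]. rewrite <- !ln_pow by lra. split; apply ln_le; lra.
Qed.

Definition log_term (psi : nat -> R) (n : nat) : R := psi n / (INR n * ln (INR n) ^ 2).

(** On the block [2^j <= n < 2^(j+1)] the logarithm is comparable to [j]. By monotonicity [psi] is
    caught between the two ends of the block, whence the shifted index in the upper bound. *)
Lemma log_term_block psi j n :
  (forall m, (1 <= m)%nat -> 0 <= psi m) ->
  (forall m n, (1 <= m <= n)%nat -> psi m <= psi n) ->
  (1 <= j)%nat -> (2 ^ j <= n < 2 ^ S j)%nat ->
  psi (2 ^ j)%nat / INR j ^ 2 / 8 <= 2 ^ j * log_term psi n <=
    16 * (psi (2 ^ S j)%nat / INR (S j) ^ 2).
Proof.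
  intros hpos hmono hj hn. destruct (ln_block j n hj hn) as [[l1 l2] [n1 n2]].
  destruct ln2_bounds as [b1 b2].
  assert (hj1 : 1 <= INR j) by (apply (le_INR 1); lia).
  assert (hp : 1 <= 2 ^ j) by (apply pow_R1_Rle; lra).
  assert (h2j : (1 <= 2 ^ j)%nat) by (pose proof (le_pow2 j); lia).
  assert (m1 : psi (2 ^ j)%nat <= psi n) by (apply hmono; lia).
  assert (m2 : psi n <= psi (2 ^ S j)%nat) by (apply hmono; lia).
  pose proof (hpos (2 ^ j)%nat h2j) as hp0.
  unfold log_term. rewrite S_INR in *. set (x := ln (INR n)) in *.
  assert (hx1 : INR j / 2 <= x) by nra. assert (hx2 : x <= 2 * INR j) by nra.
  assert (hx3 : (INR j + 1) / 4 <= x) by lra.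
  assert (hxx : x ^ 2 <= 4 * INR j ^ 2) by nra.
  assert (hx4 : (INR j + 1) ^ 2 / 16 <= x ^ 2) by nra.
  assert (hj2 : 0 < INR j ^ 2) by nra.
  assert (hjS : 0 < (INR j + 1) ^ 2) by nra.
  assert (hx0 : 0 < x ^ 2) by nra.
  simpl pow in n2 at 1.
  split.
  - apply Rle_trans with (psi n * (/ INR j ^ 2 / 8)).
    + unfold Rdiv. rewrite Rmult_assoc. apply Rmult_le_compat_r; [|exact m1].
      apply Rmult_le_pos; [left; apply Rinv_0_lt_compat; lra|lra].
    + replace (2 ^ j * (psi n / (INR n * x ^ 2))) with (psi n * (2 ^ j / (INR n * x ^ 2))) by (field; lra).
      apply Rmult_le_compat_l; [lra|].
      apply Rmult_le_reg_r with (8 * INR j ^ 2 * (INR n * x ^ 2)); [apply Rmult_lt_0_compat; nra|].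
      replace (/ INR j ^ 2 / 8 * (8 * INR j ^ 2 * (INR n * x ^ 2))) with (INR n * x ^ 2) by (field; lra).
      replace (2 ^ j / (INR n * x ^ 2) * (8 * INR j ^ 2 * (INR n * x ^ 2))) with (2 * 2 ^ j * (4 * INR j ^ 2)) by (field; lra).
      apply Rmult_le_compat; lra.
  - apply Rle_trans with (psi n * (16 / (INR j + 1) ^ 2)).
    + replace (2 ^ j * (psi n / (INR n * x ^ 2))) with (psi n * (2 ^ j / (INR n * x ^ 2))) by (field; lra).
      apply Rmult_le_compat_l; [lra|].
      apply Rmult_le_reg_r with ((INR j + 1) ^ 2 * (INR n * x ^ 2)); [apply Rmult_lt_0_compat; nra|].
      replace (16 / (INR j + 1) ^ 2 * ((INR j + 1) ^ 2 * (INR n * x ^ 2))) with (16 * (INR n * x ^ 2)) by (field; lra).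
      replace (2 ^ j / (INR n * x ^ 2) * ((INR j + 1) ^ 2 * (INR n * x ^ 2))) with (2 ^ j * (INR j + 1) ^ 2) by (field; lra).
      apply Rle_trans with (16 * (2 ^ j * ((INR j + 1) ^ 2 / 16))); [lra|].
      apply Rmult_le_compat_l; [lra|]. apply Rmult_le_compat; lra.
    + replace (16 * (psi (2 ^ S j)%nat / (INR j + 1) ^ 2)) with (psi (2 ^ S j)%nat * (16 / (INR j + 1) ^ 2)) by (field; lra).
      apply Rmult_le_compat_r; [|exact m2]. apply Rmult_le_pos; [lra|left; apply Rinv_0_lt_compat; lra].
Qed.

Lemma condensation_lower psi B :
  (forall m, (1 <= m)%nat -> 0 <= psi m) ->
  (forall m n, (1 <= m <= n)%nat -> psi m <= psi n) ->
  (forall N, rsum (log_term psi) (seq 2 N) <= B) ->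
  forall J, rsum (fun j => psi (2 ^ j)%nat / INR j ^ 2) (seq 1 J) <= 8 * B.
Proof.
  intros hpos hmono hB J. specialize (hB (2 ^ S J - 2)%nat). rewrite rsum_blocks in hB.
  apply Rle_trans with (8 * rsum (fun j => rsum (log_term psi) (seq (2 ^ j) (2 ^ j))) (seq 1 J)); [|lra].
  rewrite <- rsum_scal. apply rsum_le. intros j hj. apply in_seq in hj.
  destruct (rsum_block_bounds (log_term psi) (psi (2 ^ j)%nat / INR j ^ 2 / 8)
     (16 * (psi (2 ^ S j)%nat / INR (S j) ^ 2)) j) as [h _]; [|lra].
  intros n hn. apply log_term_block; auto; lia.
Qed.

Lemma log_term_nonneg psi : (forall m, (1 <= m)%nat -> 0 <= psi m) ->
  forall n, (2 <= n)%nat -> 0 <= log_term psi n.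
Proof.
  intros hpos n hn. unfold log_term. apply Rmult_le_pos; [apply hpos; lia|].
  left; apply Rinv_0_lt_compat. assert (h2 : 2 <= INR n) by (apply (le_INR 2); lia).
  assert (0 < ln (INR n)) by (rewrite <- ln_1; apply ln_increasing; lra).
  apply Rmult_lt_0_compat; [lra|nra].
Qed.

(** The upper estimates are indexed from the right end of each block, so they give the condensed sum
    without its first term, which is nonnegative. *)
Lemma condensation_upper psi B :
  (forall m, (1 <= m)%nat -> 0 <= psi m) ->
  (forall m n, (1 <= m <= n)%nat -> psi m <= psi n) ->
  (forall J, rsum (fun j => psi (2 ^ j)%nat / INR j ^ 2) (seq 1 J) <= B) ->
  forall N, rsum (log_term psi) (seq 2 N) <= 16 * B.
Proof.
  intros hpos hmono hB N.
  apply Rle_trans with (rsum (log_term psi) (seq 2 (2 ^ S N - 2))).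
  { apply rsum_seq_mono; [pose proof (le_pow2 N); simpl; lia|]. now apply log_term_nonneg. }
  rewrite rsum_blocks.
  apply Rle_trans with (16 * rsum (fun j => psi (2 ^ S j)%nat / INR (S j) ^ 2) (seq 1 N)).
  - rewrite <- rsum_scal. apply rsum_le. intros j hj. apply in_seq in hj.
    destruct (rsum_block_bounds (log_term psi) (psi (2 ^ j)%nat / INR j ^ 2 / 8)
     (16 * (psi (2 ^ S j)%nat / INR (S j) ^ 2)) j) as [_ h]; [|exact h].
    intros n hn. apply log_term_block; auto; lia.
  - apply Rmult_le_compat_l; [lra|]. specialize (hB (S N)). simpl seq in hB. rewrite rsum_cons in hB.
    rewrite <- (rsum_map (fun j => psi (2 ^ j)%nat / INR j ^ 2) S), seq_shift.
    assert (0 <= psi (2 ^ 1)%nat / INR 1 ^ 2).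
    { apply Rmult_le_pos; [apply hpos; simpl; lia|]. left; apply Rinv_0_lt_compat. simpl; lra. }
    lra.
Qed.

Lemma inv_sq_sum J : rsum (fun j => 1 / INR j ^ 2) (seq 1 J) <= 2.
Proof.
  assert (h : forall n, rsum (fun j => 1 / INR j ^ 2) (seq 1 (S n)) <= 2 - / INR (S n)).
  { induction n as [|n IH]; [unfold rsum; simpl; lra|].
    rewrite seq_S, rsum_app, rsum_cons. change (rsum _ nil) with 0.
    change (1 + S n)%nat with (S (S n)). rewrite (S_INR (S n)).
    set (x := INR (S n)) in *. assert (1 <= x) by (apply (le_INR 1); lia).
    assert (1 / (x + 1) ^ 2 <= / x - / (x + 1)); [|lra].
    replace (/ x - / (x + 1)) with (1 / (x * (x + 1))) by (field; lra).
    unfold Rdiv. rewrite !Rmult_1_l. apply Rinv_le_contravar; nra. }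
  destruct J as [|J]; [unfold rsum; simpl; lra|].
  specialize (h J). assert (0 < / INR (S J)) by (apply Rinv_0_lt_compat, lt_0_INR; lia). lra.
Qed.

Lemma sum_n_rsum (f : nat -> R) n : sum_n f n = rsum f (seq 0 (S n)).
Proof.
  induction n as [|n IH].
  - rewrite sum_O. unfold rsum; simpl; ring.
  - rewrite sum_Sn, IH, (seq_S (S n)), rsum_app. unfold rsum at 3. simpl fold_right. rewrite Rplus_0_r. reflexivity.
Qed.

Lemma ex_series_bounded (f : nat -> R) : (forall k, 0 <= f k) ->
  (ex_series f <-> exists B, forall n, rsum f (seq 0 n) <= B).
Proof.
  intros hf.
  assert (hinc : forall n, sum_n f n <= sum_n f (S n)).
  { intros n. rewrite sum_Sn. change plus with Rplus. pose proof (hf (S n)). lra. }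
  split.
  - intros [l hl]. exists l. intros n.
    assert (h := is_lim_seq_incr_compare (sum_n f) l hl hinc n). rewrite sum_n_rsum in h.
    eapply Rle_trans; [|exact h]. apply rsum_seq_mono; [lia|auto].
  - intros [B hB]. destruct (ex_finite_lim_seq_incr (sum_n f) B hinc) as [l hl].
    + intros n. rewrite sum_n_rsum. apply hB.
    + exists l. exact hl.
Qed.

Lemma rsum_shift2 (f : nat -> R) n : rsum (fun k => f (k + 2)%nat) (seq 0 n) = rsum f (seq 2 n).
Proof.
  rewrite <- (seq_shift n 1), <- (seq_shift n 0), !rsum_map.
  apply rsum_ext. intros k _. f_equal. lia.
Qed.

(** Subtracting [ln (Phi 1)] makes the exponents nonnegative even if [Phi] starts below 1; on the
    series this has the effect of a convergent correction. *)
Definition log_growth (Phi : nat -> R) (j : nat) : R := ln (Phi (2 ^ j)%nat) - ln (Phi 1%nat).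

Lemma exp_neg_log_growth Phi j : 0 < Phi 1%nat -> 0 < Phi (2 ^ j)%nat ->
  exp (- log_growth Phi j) = Phi 1%nat / Phi (2 ^ j)%nat.
Proof.
  intros h1 h2. unfold log_growth.
  replace (- (ln (Phi (2 ^ j)%nat) - ln (Phi 1%nat))) with (ln (Phi 1%nat) + - ln (Phi (2 ^ j)%nat)) by ring.
  rewrite exp_plus, exp_Ropp, !exp_ln by assumption. reflexivity.
Qed.

Lemma log_series_condensed (Phi : nat -> R) :
  (forall n, (1 <= n)%nat -> 0 < Phi n) ->
  (forall m n, (1 <= m)%nat -> (m <= n)%nat -> Phi m <= Phi n) ->
  (ex_series (fun k => ln (Phi (k + 2)%nat) / (INR (k + 2) * ln (INR (k + 2)) ^ 2)) <->
   exists B, forall J, rsum (fun j => log_growth Phi j / INR j ^ 2) (seq 1 J) <= B).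
Proof.
  intros hpos hmono.
  set (psi := fun n => ln (Phi n) - ln (Phi 1%nat)).
  assert (psi0 : forall m, (1 <= m)%nat -> 0 <= psi m).
  { intros m hm. unfold psi. pose proof (ln_le _ _ (hpos 1%nat ltac:(lia)) (hmono 1%nat m ltac:(lia) hm)). lra. }
  assert (psim : forall m n, (1 <= m <= n)%nat -> psi m <= psi n).
  { intros m n hmn. unfold psi. pose proof (ln_le _ _ (hpos m ltac:(lia)) (hmono m n ltac:(lia) ltac:(lia))). lra. }
  (* Condensation with [psi = 1] shows that the sum of [1 / (n log^2 n)] converges; multiplied by
     [ln (Phi 1)], this is the difference between the two series. *)
  set (one := fun _ : nat => 1).
  assert (hone : ex_series (fun k => log_term one (k + 2))).
  { apply ex_series_bounded.
    - intros k. apply log_term_nonneg; [intros; unfold one; lra|lia].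
    - exists (16 * 2). intros n. rewrite (rsum_shift2 (log_term one)). apply condensation_upper.
      + intros; unfold one; lra.
      + intros; unfold one; lra.
      + apply inv_sq_sum. }
  assert (hpsi : ex_series (fun k => log_term psi (k + 2)) <->
     exists B, forall J, rsum (fun j => log_growth Phi j / INR j ^ 2) (seq 1 J) <= B).
  { rewrite ex_series_bounded by (intros k; apply log_term_nonneg; [exact psi0|lia]).
    split; intros [B hB].
    - exists (8 * B). apply (condensation_lower psi); auto.
      intros N. rewrite <- rsum_shift2. apply hB.
    - exists (16 * B). intros n. rewrite (rsum_shift2 (log_term psi)). now apply condensation_upper. }
  rewrite <- hpsi. split; intros h.
  - eapply ex_series_ext; [|apply (ex_series_minus _ _ h (ex_series_scal (ln (Phi 1%nat)) _ hone))].
    intros k. unfold log_term, psi, one, minus, plus, opp, scal; simpl. unfold mult; simpl. unfold Rdiv. ring.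
  - eapply ex_series_ext; [|apply (ex_series_plus _ _ h (ex_series_scal (ln (Phi 1%nat)) _ hone))].
    intros k. unfold log_term, psi, one, plus, scal; simpl. unfold mult; simpl. unfold Rdiv. ring.
Qed.

(* A value [W j > j] contributes at least [1/4] to the truncated sum over
   [[j, 2 j)], by monotonicity. *)
Lemma truncated_sum_diverges (W : nat -> R) :
  (forall j, 0 <= W j) -> (forall i j, (i <= j)%nat -> W i <= W j) ->
  (forall B, exists J, B < rsum (fun j => W j / INR j ^ 2) (seq 1 J)) ->
  forall B, exists J, B <= rsum (fun j => Rmin (W j) (INR j) / INR j ^ 2) (seq 1 J).
Proof.
  intros hpos hmono hdiv B.
  set (V := fun j => Rmin (W j) (INR j) / INR j ^ 2).
  assert (hinv : forall j, (1 <= j)%nat -> 0 < / INR j ^ 2).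
  { intros j hj. apply Rinv_0_lt_compat, pow_lt, lt_0_INR; lia. }
  assert (hV : forall j, (1 <= j)%nat -> 0 <= V j).
  { intros j hj. apply Rmult_le_pos; [|left; now apply hinv].
    apply Rmin_glb; [apply hpos|apply pos_INR]. }
  destruct (classic (exists j0, forall j, (j0 <= j)%nat -> W j <= INR j)) as [[j0 hj0]|hinf].
  - destruct (hdiv (B + rsum (fun j => W j / INR j ^ 2) (seq 1 j0))) as [J hJ].
    exists J. apply Rnot_lt_le; intros hlt.
    assert (h : forall n, rsum (fun j => W j / INR j ^ 2) (seq 1 n) <=
       rsum V (seq 1 n) + rsum (fun j => W j / INR j ^ 2) (seq 1 j0)).
    { intros n. destruct (Nat.le_gt_cases n j0) as [hn|hn].
      - assert (rsum (fun j => W j / INR j ^ 2) (seq 1 n) <= rsum (fun j => W j / INR j ^ 2) (seq 1 j0)).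
        { apply rsum_seq_mono; [lia|]. intros i hi. apply Rmult_le_pos; [apply hpos|left; now apply hinv]. }
        assert (0 <= rsum V (seq 1 n)).
        { apply rsum_nonneg. intros i hi. apply in_seq in hi. apply hV; lia. }
        lra.
      - replace n with (j0 + (n - j0))%nat by lia. rewrite seq_app, !rsum_app.
        assert (0 <= rsum V (seq 1 j0)).
        { apply rsum_nonneg. intros i hi. apply in_seq in hi. apply hV; lia. }
        assert (rsum (fun j => W j / INR j ^ 2) (seq (1 + j0) (n - j0)) <= rsum V (seq (1 + j0) (n - j0))).
        { apply rsum_le. intros i hi. apply in_seq in hi. unfold V.
          rewrite Rmin_left by (apply hj0; lia). lra. }
        lra. }
    specialize (h J). fold V in hlt. lra.
  - assert (hstep : forall k : nat, exists J, INR k / 4 <= rsum V (seq 1 J)).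
    { induction k as [|k [J hJ]].
      - exists O. unfold rsum; simpl; lra.
      - assert (hj : exists j, (S J <= j)%nat /\ INR j < W j).
        { apply NNPP; intros hno. apply hinf. exists (S J). intros j hj.
          apply Rnot_lt_le; intros hl. apply hno; exists j; auto. }
        destruct hj as [j [hj1 hj2]].
        exists ((j - 1) + j)%nat. rewrite seq_app, rsum_app, S_INR.
        replace (1 + (j - 1))%nat with j by lia.
        assert (rsum V (seq 1 J) <= rsum V (seq 1 (j - 1))) by (apply rsum_seq_mono; [lia|exact hV]).
        assert (hj3 : 1 <= INR j) by (apply (le_INR 1); lia).
        assert (/ 4 <= rsum V (seq j j)).
        { apply Rle_trans with (rsum (fun _ => / (4 * INR j)) (seq j j)).
          - rewrite rsum_const, length_seq. right; field; lra.
          - apply rsum_le. intros i hi. apply in_seq in hi. unfold V.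
            assert (i1 : INR j <= INR i) by (apply le_INR; lia).
            assert (i2 : INR i <= 2 * INR j).
            { rewrite <- (mult_INR 2). apply le_INR; lia. }
            assert (i3 : INR j <= Rmin (W i) (INR i)).
            { apply Rmin_glb; [|exact i1]. specialize (hmono j i ltac:(lia)). lra. }
            apply Rle_trans with (INR j / (2 * INR j) ^ 2); [right; field; lra|].
            apply Rmult_le_compat; [lra| |exact i3|].
            + left; apply Rinv_0_lt_compat; nra.
            + apply Rinv_le_contravar; nra. }
        lra. }
    destruct (INR_unbounded (4 * B)) as [k hk]. destruct (hstep k) as [J hJ]. exists J. fold V. lra.
Qed.

(** A second dyadic grouping: the block [[2^k, 2^(k+1))] holds [2^k] terms, each at least
    [W (2^k) / (2 * 2^k)^2]. The result has the shape of a total width of boxes at the scales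
    [2^(-k)]. *)
Lemma condensation_twice (W : nat -> R) B :
  (forall j, 0 <= W j) -> (forall i j, (i <= j)%nat -> W i <= W j) ->
  (forall J, rsum (fun j => W j / INR j ^ 2) (seq 1 J) <= B) ->
  forall K, rsum (fun k => W (2 ^ k)%nat / 2 ^ k) (seq 1 K) <= 4 * B.
Proof.
  intros hpos hmono hB K.
  set (t := fun j => W j / INR j ^ 2).
  assert (ht : forall j, (1 <= j)%nat -> 0 <= t j).
  { intros j hj. apply Rmult_le_pos; [apply hpos|]. left; apply Rinv_0_lt_compat, pow_lt, lt_0_INR; lia. }
  assert (h : rsum t (seq 2 (2 ^ S K - 2)) <= B).
  { specialize (hB (S (2 ^ S K - 2))). cbn [seq] in hB. rewrite rsum_cons in hB.
    pose proof (ht 1%nat ltac:(lia)) as h1. fold (t 1%nat) in hB. fold t in hB. lra. }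
  rewrite rsum_blocks in h.
  apply Rle_trans with (4 * rsum (fun j => rsum t (seq (2 ^ j) (2 ^ j))) (seq 1 K)); [|lra].
  rewrite <- rsum_scal. apply rsum_le. intros k hk. apply in_seq in hk.
  assert (hp : 0 < 2 ^ k) by (apply pow_lt; lra).
  apply Rle_trans with (4 * (W (2 ^ k)%nat / 2 ^ k / 4)); [lra|]. apply Rmult_le_compat_l; [lra|].
  replace (W (2 ^ k)%nat / 2 ^ k / 4) with (INR (2 ^ k) * (W (2 ^ k)%nat / (2 * 2 ^ k) ^ 2))
    by (rewrite INR_pow2; field; lra).
  rewrite <- (length_seq (2 ^ k) (2 ^ k)) at 1. rewrite <- rsum_const.
  apply rsum_le. intros j hj. apply in_seq in hj. unfold t.
  assert (hj1 : (1 <= j)%nat) by (pose proof (le_pow2 k); lia).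
  assert (INR j <= 2 * 2 ^ k).
  { rewrite <- INR_pow2. rewrite <- (mult_INR 2). apply le_INR. lia. }
  assert (0 < INR j) by (apply lt_0_INR; lia).
  apply Rmult_le_compat; [apply hpos| |apply hmono; lia|].
  - left; apply Rinv_0_lt_compat; nra.
  - apply Rinv_le_contravar; nra.
Qed.

(** * The minimum problem *)

Definition dirichlet_list (a : nat -> C) (N : nat) : list (C * R) :=
  (RtoC 1, 0) :: map (fun n => ((Re (a n) / INR n, Im (a n) / INR n), ln (INR n))) (seq 2 (N - 1)).

Lemma nat_cpow_line n t : (1 <= n)%nat ->
  nat_cpow n (Ci * RtoC t - 1)%C = (cos (ln (INR n) * t) / INR n, sin (ln (INR n) * t) / INR n).
Proof.
  intros hn. assert (h : 0 < INR n) by (apply lt_0_INR; lia).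
  unfold nat_cpow, Cexp, Ci, RtoC, Cminus, Cplus, Copp, Cmult, Re, Im. simpl.
  set (x := ln (INR n)).
  replace ((0 * t - 1 * 0 + - (1)) * x - (0 * 0 + 1 * t + - 0) * 0) with (- x) by ring.
  replace ((0 * t - 1 * 0 + - (1)) * 0 + (0 * 0 + 1 * t + - 0) * x) with (x * t) by ring.
  unfold x. rewrite exp_Ropp, exp_ln by exact h. f_equal; field; lra.
Qed.

Lemma dirichlet_poly_ec a N t : dirichlet_poly a N t = ec (dirichlet_list a N) t 0.
Proof.
  unfold dirichlet_poly, ec.
  assert (h : forall M, sum_n_m (fun n => a n * nat_cpow n (Ci * RtoC t - 1))%C 2 M =
    (eRe (map (fun n => ((Re (a n) / INR n, Im (a n) / INR n), ln (INR n))) (seq 2 (M - 1))) t 0,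
     eIm (map (fun n => ((Re (a n) / INR n, Im (a n) / INR n), ln (INR n))) (seq 2 (M - 1))) t 0)).
  { intros M. destruct M as [|M]; [now rewrite sum_n_m_zero by lia|].
    induction M as [|M IH]; [now rewrite sum_n_m_zero by lia|].
    rewrite sum_n_Sm by lia. rewrite IH. replace (S (S M) - 1)%nat with (S (S M - 1)) by lia.
    rewrite (seq_S (S M - 1)), map_app. unfold eRe, eIm. rewrite !rsum_app.
    replace (2 + (S M - 1))%nat with (S (S M)) by lia.
    simpl map. rewrite !rsum_cons. change (rsum _ nil) with 0.
    rewrite nat_cpow_line by lia. set (m := S (S M)).
    assert (hm : INR m <> 0) by (apply not_0_INR; unfold m; lia).
    destruct (a m) as [p q]. unfold plus; simpl. unfold Cplus, Cmult, Re, Im; simpl.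
    rewrite Rmult_0_r, Ropp_0, exp_0. f_equal; f_equal; field; exact hm. }
  rewrite h. unfold dirichlet_list, eRe, eIm. rewrite !rsum_cons. unfold Cplus, RtoC; simpl.
  rewrite !Rmult_0_l, Ropp_0, exp_0, cos_0, sin_0. apply f_equal2; ring.
Qed.

Lemma eRe_continuous l t : continuous (fun s => eRe l s 0) t.
Proof. apply (ex_derive_continuous (V := R_NormedModule) (fun s : R => eRe l s 0)). eexists. apply eRe_dx. Qed.

Lemma eIm_continuous l t : continuous (fun s => eIm l s 0) t.
Proof. apply (ex_derive_continuous (V := R_NormedModule) (fun s : R => eIm l s 0)). eexists. apply eIm_dx. Qed.

Lemma continuous_Rmult (f g : R -> R) t : continuous f t -> continuous g t -> continuous (fun s => f s * g s) t.
Proof. exact (continuous_mult f g t). Qed.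

Lemma continuous_Rplus (f g : R -> R) t : continuous f t -> continuous g t -> continuous (fun s => f s + g s) t.
Proof. exact (continuous_plus f g t). Qed.

Lemma esq_continuous l t : continuous (fun s => esq l s 0) t.
Proof.
  apply (continuous_ext (fun s : R => (eRe l s 0 * eRe l s 0 + eIm l s 0 * eIm l s 0 : R)) (fun s : R => (esq l s 0 : R))).
  - intros s. unfold esq. change (eRe l s 0 * eRe l s 0 + eIm l s 0 * eIm l s 0 = eRe l s 0 ^ 2 + eIm l s 0 ^ 2 :> R). ring.
  - apply (continuous_Rplus (fun s => eRe l s 0 * eRe l s 0) (fun s => eIm l s 0 * eIm l s 0)).
    + apply (continuous_Rmult (fun s => eRe l s 0) (fun s => eRe l s 0)); apply eRe_continuous.
    + apply (continuous_Rmult (fun s => eIm l s 0) (fun s => eIm l s 0)); apply eIm_continuous.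
Qed.

Lemma continuous_ex_RInt (f : R -> R) a b : (forall t, continuous f t) -> ex_RInt f a b.
Proof. intros h. apply (ex_RInt_continuous (V := R_CompleteNormedModule)). auto. Qed.

Lemma RInt_Rminus (f g : R -> R) a b : (forall t, continuous f t) -> (forall t, continuous g t) ->
  RInt (fun t => f t - g t) a b = RInt f a b - RInt g a b.
Proof. intros hf hg. apply (RInt_minus (V := R_CompleteNormedModule)); now apply continuous_ex_RInt. Qed.

Lemma continuous_Rminus (f g : R -> R) t : continuous f t -> continuous g t -> continuous (fun s => f s - g s) t.
Proof. exact (continuous_minus f g t). Qed.

Lemma mean_square_esq H a N : mean_square H a N = RInt (fun t => esq (dirichlet_list a N) t 0) 0 H.
Proof.
  apply RInt_ext. intros t _. now rewrite dirichlet_poly_ec, esq_Cmod.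
Qed.

Lemma Cmod_le_abs (p q : R) : Cmod (p, q) <= Rabs p + Rabs q.
Proof.
  unfold Cmod; simpl. pose proof (Rabs_pos p). pose proof (Rabs_pos q).
  rewrite <- (sqrt_Rsqr (Rabs p + Rabs q)) by lra. apply sqrt_le_1_alt. unfold Rsqr.
  replace (p * (p * 1) + q * (q * 1)) with (p ^ 2 + q ^ 2) by ring.
  rewrite <- (pow2_abs p), <- (pow2_abs q). nra.
Qed.

Lemma dirichlet_term_mass n (z : C) : (1 <= n)%nat -> Cmod (Re z / INR n, Im z / INR n) = Cmod z / INR n.
Proof.
  intros hn. assert (h : 0 < INR n) by (apply lt_0_INR; lia).
  replace (Re z / INR n, Im z / INR n) with (Cmult (RtoC (/ INR n)) z).
  - rewrite Cmod_mult, Cmod_R, Rabs_pos_eq by (left; now apply Rinv_0_lt_compat). unfold Rdiv; ring.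
  - destruct z as [x y]. unfold Cmult, RtoC, Re, Im; simpl. f_equal; field; lra.
Qed.

Lemma dirichlet_list_freq a N p : In p (dirichlet_list a N) -> 0 <= snd p.
Proof.
  intros [<-|hp]; [simpl; lra|]. apply in_map_iff in hp. destruct hp as [n [<- hn]]. apply in_seq in hn. simpl.
  rewrite <- ln_1. apply ln_le; [lra|]. apply (le_INR 1). lia.
Qed.

Lemma dirichlet_list_mass a A N : (forall n, (2 <= n <= N)%nat -> Cmod (a n) <= A n) ->
  mass (dirichlet_list a N) <= 1 + rsum (fun n => A n / INR n) (seq 2 (N - 1)).
Proof.
  intros h. unfold mass, dirichlet_list. rewrite rsum_cons, rsum_map. simpl fst at 1. rewrite Cmod_1.
  apply Rplus_le_compat_l, rsum_le. intros n hn. apply in_seq in hn. simpl fst.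
  rewrite dirichlet_term_mass by lia. apply Rmult_le_compat_r; [|apply h; lia].
  left; apply Rinv_0_lt_compat, lt_0_INR; lia.
Qed.

Lemma dirichlet_list_diff a b N d t : 0 <= d ->
  (forall n, (2 <= n <= N)%nat -> Rabs (Re (a n) - Re (b n)) <= d /\ Rabs (Im (a n) - Im (b n)) <= d) ->
  Rabs (eRe (dirichlet_list a N) t 0 - eRe (dirichlet_list b N) t 0) <= 2 * INR N * d /\
  Rabs (eIm (dirichlet_list a N) t 0 - eIm (dirichlet_list b N) t 0) <= 2 * INR N * d.
Proof.
  intros hd h. unfold eRe, eIm, dirichlet_list. rewrite !rsum_cons, !rsum_map. simpl fst; simpl snd.
  assert (hgen : forall F G : nat -> R, (forall n, (2 <= n <= N)%nat -> Rabs (F n - G n) <= 2 * d) ->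
    forall X, Rabs (X + rsum F (seq 2 (N - 1)) - (X + rsum G (seq 2 (N - 1)))) <= 2 * INR N * d).
  { intros F G hFG X.
    replace (X + rsum F (seq 2 (N - 1)) - (X + rsum G (seq 2 (N - 1)))) with (rsum (fun n => F n - G n) (seq 2 (N - 1)))
      by (rewrite rsum_minus; ring).
    eapply Rle_trans; [apply rsum_abs|].
    eapply Rle_trans; [apply (rsum_le _ (fun _ => 2 * d))|].
    - intros n hn. apply in_seq in hn. apply hFG; lia.
    - rewrite rsum_const, length_seq. pose proof (le_INR (N - 1) N ltac:(lia)). nra. }
  assert (htr : forall n, (2 <= n <= N)%nat -> forall c s : R, Rabs c <= 1 -> Rabs s <= 1 ->
    Rabs ((Re (a n) - Re (b n)) / INR n * c + (Im (a n) - Im (b n)) / INR n * s) <= 2 * d).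
  { intros n hn c s hc hs. destruct (h n hn) as [h1 h2].
    assert (hn1 : 1 <= INR n) by (apply (le_INR 1); lia).
    assert (hi : 0 <= / INR n <= 1).
    { split; [left; apply Rinv_0_lt_compat; lra|]. rewrite <- Rinv_1. apply Rinv_le_contravar; lra. }
    assert (hone : forall x y, Rabs x <= d -> Rabs y <= 1 -> Rabs (x / INR n * y) <= d).
    { intros x y hx hy. unfold Rdiv. rewrite !Rabs_mult, (Rabs_pos_eq (/ INR n)) by lra.
      replace d with (d * 1 * 1) by ring.
      apply Rmult_le_compat; auto using Rabs_pos.
      - apply Rmult_le_pos; [apply Rabs_pos|lra].
      - apply Rmult_le_compat; try lra. apply Rabs_pos. }
    eapply Rle_trans; [apply Rabs_triang|].
    pose proof (hone _ _ h1 hc). pose proof (hone _ _ h2 hs). lra. }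
  assert (hcos : forall z, Rabs (cos z) <= 1) by (intros; apply Rabs_le, COS_bound).
  assert (hsin : forall z, Rabs (sin z) <= 1) by (intros; apply Rabs_le, SIN_bound).
  split; apply hgen; intros n hn; rewrite Rmult_0_r, Ropp_0, exp_0; simpl Re; simpl Im.
  - replace (1 * (Re (a n) / INR n * cos (ln (INR n) * t) - Im (a n) / INR n * sin (ln (INR n) * t)) -
      1 * (Re (b n) / INR n * cos (ln (INR n) * t) - Im (b n) / INR n * sin (ln (INR n) * t)))
      with ((Re (a n) - Re (b n)) / INR n * cos (ln (INR n) * t) + (Im (a n) - Im (b n)) / INR n * - sin (ln (INR n) * t))
      by (unfold Rdiv; ring).
    apply htr; auto. rewrite Rabs_Ropp. auto.
  - replace (1 * (Re (a n) / INR n * sin (ln (INR n) * t) + Im (a n) / INR n * cos (ln (INR n) * t)) -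
      1 * (Re (b n) / INR n * sin (ln (INR n) * t) + Im (b n) / INR n * cos (ln (INR n) * t)))
      with ((Re (a n) - Re (b n)) / INR n * sin (ln (INR n) * t) + (Im (a n) - Im (b n)) / INR n * cos (ln (INR n) * t))
      by (unfold Rdiv; ring).
    apply htr; auto.
Qed.

(** Each of fewer than [N] terms moves by at most [2 d]. For real and imaginary part alike, the
    square then changes by at most [2 B * 2 N d], as both values are bounded by [B]. *)
Lemma mean_square_close H A a b N d : 0 < H -> 0 <= d ->
  (forall n, (2 <= n <= N)%nat -> Cmod (a n) <= A n /\ Cmod (b n) <= A n) ->
  (forall n, (2 <= n <= N)%nat -> Rabs (Re (a n) - Re (b n)) <= d /\ Rabs (Im (a n) - Im (b n)) <= d) ->
  Rabs (mean_square H a N - mean_square H b N) <=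
    H * (8 * (1 + rsum (fun n => A n / INR n) (seq 2 (N - 1))) * INR N * d).
Proof.
  intros hH hd hA hab. set (B := 1 + rsum (fun n => A n / INR n) (seq 2 (N - 1))).
  rewrite !mean_square_esq.
  pose proof (esq_continuous (dirichlet_list a N)) as ia.
  pose proof (esq_continuous (dirichlet_list b N)) as ib.
  rewrite <- (RInt_Rminus (fun t => esq (dirichlet_list a N) t 0) (fun t => esq (dirichlet_list b N) t 0)) by assumption.
  replace H with (H - 0) at 2 by ring. apply abs_RInt_le_const; [lra| |].
  - apply continuous_ex_RInt. intros t. apply continuous_Rminus; auto.
  - intros t _.
    destruct (dirichlet_list_diff a b N d t hd hab) as [h1 h2].
    assert (hm : forall c, (forall n, (2 <= n <= N)%nat -> Cmod (c n) <= A n) ->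
       Rabs (eRe (dirichlet_list c N) t 0) <= B /\ Rabs (eIm (dirichlet_list c N) t 0) <= B).
    { intros c hc. destruct (abs_le_Cmod (ec (dirichlet_list c N) t 0)) as [k1 k2].
      pose proof (Cmod_ec_le (dirichlet_list c N) t 0 (Rle_refl 0) (dirichlet_list_freq c N)).
      pose proof (dirichlet_list_mass c A N hc). unfold B.
      change (Rabs (eRe (dirichlet_list c N) t 0) <= Cmod (ec (dirichlet_list c N) t 0)) in k1.
      change (Rabs (eIm (dirichlet_list c N) t 0) <= Cmod (ec (dirichlet_list c N) t 0)) in k2. lra. }
    destruct (hm a (fun n hn => proj1 (hA n hn))) as [a1 a2].
    destruct (hm b (fun n hn => proj2 (hA n hn))) as [b1 b2].
    unfold esq.
    set (p := eRe (dirichlet_list a N) t 0) in *. set (q := eIm (dirichlet_list a N) t 0) in *.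
    set (p' := eRe (dirichlet_list b N) t 0) in *. set (q' := eIm (dirichlet_list b N) t 0) in *.
    assert (hsq : forall x y, Rabs x <= B -> Rabs y <= B -> Rabs (x - y) <= 2 * INR N * d ->
      Rabs (x ^ 2 - y ^ 2) <= 2 * B * (2 * INR N * d)).
    { intros x y hx hy hxy. replace (x ^ 2 - y ^ 2) with ((x + y) * (x - y)) by ring.
      rewrite Rabs_mult. apply Rmult_le_compat; auto using Rabs_pos.
      eapply Rle_trans; [apply Rabs_triang|]. lra. }
    replace (p ^ 2 + q ^ 2 - (p' ^ 2 + q' ^ 2)) with ((p ^ 2 - p' ^ 2) + (q ^ 2 - q' ^ 2)) by ring.
    eapply Rle_trans; [apply Rabs_triang|].
    pose proof (hsq p p' a1 b1 h1). pose proof (hsq q q' a2 b2 h2). lra.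
Qed.

Lemma mean_square_min_exists H A N : 0 < H -> (forall n, (1 <= n)%nat -> 0 < A n) ->
  exists m, is_minimum (mean_square_values A H N) m.
Proof.
  intros hH hA.
  set (co := fun (s : nat -> R) (n : nat) => (s (2 * n)%nat, s (2 * n + 1)%nat) : C).
  (* All indices up to [N] are constrained, including 0 and 1, so that every coordinate is bounded;
     [Rabs] is needed because nothing is assumed about the sign of [A 0]. *)
  set (K := fun s : nat -> R => forall n, (n <= N)%nat -> Cmod (co s n) <= Rabs (A n)).
  set (f := fun s => mean_square H (co s) N).
  assert (hKA : forall s, K s -> forall n, (2 <= n <= N)%nat -> Cmod (co s n) <= A n).
  { intros s hs n hn. rewrite <- (Rabs_pos_eq (A n)) by (left; apply hA; lia). apply hs; lia. }
  set (B := rsum (fun n => Rabs (A n)) (seq 0 (S N))).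
  assert (hB : forall n, (n <= N)%nat -> Rabs (A n) <= B).
  { intros n hn. unfold B. replace (S N) with (n + S (N - n))%nat by lia.
    rewrite seq_app, rsum_app. cbn [seq]. rewrite rsum_cons. simpl (0 + n)%nat.
    assert (0 <= rsum (fun i => Rabs (A i)) (seq 0 n)) by (apply rsum_nonneg; intros; apply Rabs_pos).
    assert (0 <= rsum (fun i => Rabs (A i)) (seq (S n) (N - n))) by (apply rsum_nonneg; intros; apply Rabs_pos).
    lra. }
  destruct (compact_min_attained (2 * S N) (fun _ => B) K f) as [s [hs1 hs2]].
  - intros s i hs hi. set (n := (i / 2)%nat).
    assert (hn : (n <= N)%nat) by (unfold n; pose proof (Nat.div_lt_upper_bound i 2 (S N)); lia).
    specialize (hs n hn). specialize (hB n hn). destruct (abs_le_Cmod (co s n)) as [h1 h2].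
    simpl in h1, h2.
    destruct (Nat.Even_or_Odd i) as [[k hk]|[k hk]].
    + assert (e : n = k) by (unfold n; rewrite hk, Nat.mul_comm; apply Nat.div_mul; lia).
      rewrite hk, <- e. simpl. lra.
    + assert (e : n = k).
      { unfold n. rewrite hk, Nat.mul_comm, Nat.div_add_l by lia. simpl. lia. }
      rewrite hk, <- e. simpl. lra.
  - intros s hs eps heps.
    set (Q := 8 * (1 + rsum (fun n => A n / INR n) (seq 2 (N - 1))) * INR N).
    assert (hQ : 0 <= Q).
    { unfold Q. apply Rmult_le_pos; [|apply pos_INR].
      assert (0 <= rsum (fun n => A n / INR n) (seq 2 (N - 1))); [|lra].
      apply rsum_nonneg. intros n hn. apply in_seq in hn.
      apply Rmult_le_pos; [left; apply hA; lia|left; apply Rinv_0_lt_compat, lt_0_INR; lia]. }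
    assert (hpos : 0 < H * Q + 1) by nra.
    exists (eps / (H * Q + 1)). assert (hd : 0 < eps / (H * Q + 1)) by (apply Rdiv_lt_0_compat; lra).
    split; [exact hd|]. intros y hy hyd. unfold f.
    eapply Rle_lt_trans; [apply (mean_square_close H A (co y) (co s) N (eps / (H * Q + 1)))|].
    + exact hH.
    + lra.
    + intros n hn. split; now apply hKA.
    + intros n hn. split; simpl; left; apply hyd; lia.
    + fold Q. rewrite <- Rmult_assoc. apply Rmult_lt_reg_r with (H * Q + 1); [exact hpos|].
      replace (H * Q * (eps / (H * Q + 1)) * (H * Q + 1)) with (H * Q * eps) by (field; lra). nra.
  - intros s hs. unfold K in hs. apply not_all_ex_not in hs. destruct hs as [n hs].
    apply imply_to_and in hs. destruct hs as [hn hs].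
    exists ((Cmod (co s n) - Rabs (A n)) / 3). split; [lra|].
    intros y hy hk. specialize (hk n hn).
    pose proof (hy (2 * n)%nat ltac:(lia)) as y1. pose proof (hy (2 * n + 1)%nat ltac:(lia)) as y2.
    assert (Cmod (co s n) <= Cmod (co y n) + (Rabs (y (2 * n)%nat - s (2 * n)%nat) + Rabs (y (2 * n + 1)%nat - s (2 * n + 1)%nat))).
    { replace (co s n) with (Cplus (co y n) (s (2 * n)%nat - y (2 * n)%nat, s (2 * n + 1)%nat - y (2 * n + 1)%nat)).
      - eapply Rle_trans; [apply Cmod_triangle|]. apply Rplus_le_compat_l.
        eapply Rle_trans; [apply Cmod_le_abs|]. rewrite !(Rabs_minus_sym (s _)). lra.
      - unfold co, Cplus; simpl. f_equal; ring. }
    lra.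
  - exists (fun _ => 0). intros n _. unfold co. change (Cmod (RtoC 0) <= Rabs (A n)). rewrite Cmod_0. apply Rabs_pos.
  - exists (f s). split.
    + exists (co s). split; [now apply hKA|reflexivity].
    + intros v [a [ha ->]].
      (* The competitor [a] is unconstrained outside [2..N]; cutting it off there puts it into [K]
         and leaves its mean square unchanged. *)
      set (s' := fun i => let n := (i / 2)%nat in
        if le_lt_dec 2 n then if le_lt_dec n N then
          (if Nat.even i then Re (a n) else Im (a n)) else 0 else 0).
      assert (hco : forall n, co s' n = if le_lt_dec 2 n then if le_lt_dec n N then a n else 0%C else 0%C).
      { intros n. unfold co, s'.
        assert (d1 : (2 * n / 2 = n)%nat) by (rewrite Nat.mul_comm; apply Nat.div_mul; lia).
        assert (d2 : ((2 * n + 1) / 2 = n)%nat) by (rewrite Nat.mul_comm, Nat.div_add_l by lia; simpl; lia).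
        assert (d3 : Nat.even (2 * n) = true) by (apply Nat.even_spec; exists n; reflexivity).
        assert (d4 : Nat.even (2 * n + 1) = false).
        { rewrite <- Nat.negb_odd. replace (Nat.odd (2 * n + 1)) with true; [reflexivity|].
          symmetry. apply Nat.odd_spec. exists n; reflexivity. }
        rewrite d1, d2, d3, d4. destruct (le_lt_dec 2 n); [|reflexivity].
        destruct (le_lt_dec n N); [|reflexivity]. now destruct (a n). }
      assert (hk : K s').
      { intros n hn. rewrite hco. destruct (le_lt_dec 2 n) as [h2|h2].
        - destruct (le_lt_dec n N) as [h3|h3].
          + rewrite Rabs_pos_eq by (left; apply hA; lia). apply ha; lia.
          + rewrite Cmod_0. apply Rabs_pos.
        - rewrite Cmod_0. apply Rabs_pos. }
      replace (mean_square H a N) with (f s'); [now apply hs2|].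
      unfold f. rewrite !mean_square_esq. apply RInt_ext. intros t _.
      unfold dirichlet_list. do 2 f_equal. apply map_ext_in. intros n hn. apply in_seq in hn.
      rewrite hco. destruct (le_lt_dec 2 n); [|lia]. destruct (le_lt_dec n N); [reflexivity|lia].
Qed.

Lemma mean_square_nonneg H a N : 0 < H -> 0 <= mean_square H a N.
Proof.
  intros hH. rewrite mean_square_esq. apply RInt_ge_0; [lra| |intros; apply esq_nonneg].
  apply continuous_ex_RInt, esq_continuous.
Qed.

(** Extending a tuple by a zero coefficient keeps it admissible, so the minima decrease, and they
    are bounded below by 0. *)
Lemma minima_limit H A : 0 < H -> (forall n, (1 <= n)%nat -> 0 < A n) ->
  exists (mu : nat -> R) (l : R), (forall N, is_minimum (mean_square_values A H N) (mu N)) /\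
    is_lim_seq mu l /\ (forall N, l <= mu N).
Proof.
  intros hH hA.
  destruct (choice _ (fun N => mean_square_min_exists H A N hH hA)) as [mu hmu].
  assert (hdec : forall N, mu (S N) <= mu N).
  { intros N. destruct (hmu N) as [[a [ha ->]] _]. destruct (hmu (S N)) as [_ hmin].
    set (a' := fun n => if le_lt_dec n N then a n else 0%C).
    apply hmin. exists a'. split.
    - intros n hn. unfold a'. destruct (le_lt_dec n N); [apply ha; lia|].
      rewrite Cmod_0. left; apply hA; lia.
    - rewrite !mean_square_esq. apply RInt_ext. intros t _. destruct N as [|N]; [reflexivity|].
      set (g := fun c : nat -> C => fun n => ((Re (c n) / INR n, Im (c n) / INR n) : C, ln (INR n))).
      assert (e : dirichlet_list a' (S (S N)) = dirichlet_list a (S N) ++ ((RtoC 0, ln (INR (S (S N)))) :: nil)).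
      { unfold dirichlet_list. replace (S (S N) - 1)%nat with (S (S N - 1)) by lia.
        rewrite seq_S, map_app. simpl app at 2. f_equal. f_equal.
        - apply map_ext_in. intros n hn. apply in_seq in hn. unfold a'.
          destruct (le_lt_dec n (S N)); [reflexivity|lia].
        - cbn [map]. replace (2 + (S N - 1))%nat with (S (S N)) by lia.
          unfold a'. destruct (le_lt_dec (S (S N)) (S N)) as [hle|_]; [lia|].
          change (Re 0%C) with 0. change (Im 0%C) with 0. unfold Rdiv. rewrite Rmult_0_l. reflexivity. }
      rewrite e. unfold esq, eRe, eIm. rewrite !rsum_app, !rsum_cons.
      change (rsum _ nil) with 0. simpl Re; simpl Im. f_equal; f_equal; ring. }
  destruct (ex_finite_lim_seq_decr mu 0 hdec) as [l hl].
  { intros N. destruct (hmu N) as [[a [ha ->]] _]. now apply mean_square_nonneg. }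
  exists mu, l. repeat split; auto; try apply hmu.
  intros N. apply (is_lim_seq_decr_compare mu l hl hdec N).
Qed.

(** * Duality *)

Definition riemann (H : R) (k : nat) (f : R -> R) : R :=
  rsum (fun i => H / INR k * f (INR i * (H / INR k))) (seq 0 k).

(** Uniform continuity bounds the error on each cell by its length times [eps / (2 H)]; the
    induction adds up the cells from the left. *)
Lemma riemann_limit H (f : R -> R) : 0 < H -> (forall t, continuous f t) ->
  is_lim_seq (fun k => riemann H (S k) f) (RInt f 0 H).
Proof.
  intros hH hf. apply is_lim_seq_spec. intros eps.
  assert (heps : 0 < eps / (2 * H)) by (destruct eps as [e he]; simpl; apply Rdiv_lt_0_compat; lra).
  assert (hu := Heine f (fun c => 0 <= c <= H) (compact_P3 0 H)).
  destruct hu with (eps := mkposreal _ heps) as [d hd].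
  { intros x _. apply continuity_pt_filterlim. apply hf. }
  simpl in hd.
  destruct (INR_unbounded (H / d)) as [k0 hk0].
  exists k0. intros k hk. set (n := S k). set (h := H / INR n).
  assert (hn : 0 < INR n) by (apply lt_0_INR; unfold n; lia).
  assert (hh : 0 < h) by (apply Rdiv_lt_0_compat; lra).
  assert (hhd : h < d).
  { unfold h. destruct d as [d hdp]; cbn [pos] in *. apply Rmult_lt_reg_r with (INR n); [lra|].
    replace (H / INR n * INR n) with H by (field; lra).
    assert (INR k0 <= INR n) by (apply le_INR; unfold n; lia).
    assert (H < INR k0 * d).
    { apply Rmult_lt_compat_r with (r := d) in hk0; [|exact hdp].
      replace (H / d * d) with H in hk0 by (field; lra). lra. }
    nra. }
  assert (hnh : INR n * h = H) by (unfold h; field; lra).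
  assert (hind : forall j, (j <= n)%nat ->
    Rabs (rsum (fun i => h * f (INR i * h)) (seq 0 j) - RInt f 0 (INR j * h)) <= INR j * h * (eps / (2 * H))).
  { induction j as [|j IH]; intros hj.
    - simpl INR. rewrite Rmult_0_l, RInt_point. unfold rsum, zero; simpl. rewrite Rminus_0_r, Rabs_R0. lra.
    - specialize (IH ltac:(lia)). rewrite seq_S, rsum_app, rsum_cons. change (rsum _ nil) with 0.
      rewrite Nat.add_0_l, Rplus_0_r.
      rewrite <- (RInt_Chasles f 0 (INR j * h) (INR (S j) * h)) by (apply continuous_ex_RInt; exact hf).
      change plus with Rplus.
      assert (hj2 : INR (S j) * h <= H).
      { rewrite <- hnh. apply Rmult_le_compat_r; [lra|]. apply le_INR; lia. }
      rewrite S_INR in *. pose proof (pos_INR j).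
      assert (hstep : Rabs (h * f (INR j * h) - RInt f (INR j * h) ((INR j + 1) * h)) <= h * (eps / (2 * H))).
      { replace (h * f (INR j * h)) with (RInt (fun _ => f (INR j * h)) (INR j * h) ((INR j + 1) * h)).
        - rewrite <- (RInt_Rminus (fun _ => f (INR j * h)) f) by (auto; intros; apply continuous_const).
          replace (h * (eps / (2 * H))) with (((INR j + 1) * h - INR j * h) * (eps / (2 * H))) by ring.
          apply abs_RInt_le_const; [nra| |].
          + apply continuous_ex_RInt. intros t. apply continuous_Rminus; [apply continuous_const|apply hf].
          + intros t ht. left. apply hd; try nra. rewrite Rabs_minus_sym, Rabs_pos_eq; lra.
        - rewrite RInt_const. apply Rminus_diag_uniq. unfold scal; simpl. unfold mult; simpl. ring. }
      match goal with |- Rabs (?A + ?B - (?P + ?Q)) <= _ => replace (A + B - (P + Q)) with ((A - P) + (B - Q)) by ring end.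
      eapply Rle_trans; [apply Rabs_triang|]. lra. }
  specialize (hind n (Nat.le_refl n)). rewrite hnh in hind.
  unfold riemann. fold h. eapply Rle_lt_trans; [exact hind|].
  destruct eps as [e he]; cbn [pos] in *. replace (H * (e / (2 * H))) with (e / 2) by (field; lra). lra.
Qed.

Lemma is_lim_seq_rsum {I : Type} (f : nat -> I -> R) (g : I -> R) l :
  (forall i, is_lim_seq (fun k => f k i) (g i)) ->
  is_lim_seq (fun k => rsum (f k) l) (rsum g l).
Proof.
  intros h. induction l as [|i l IH]; [apply is_lim_seq_const|].
  apply (is_lim_seq_plus' _ _ (g i) (rsum g l)); [apply h|exact IH].
Qed.

Lemma is_lim_seq_eventually_lt (u : nat -> R) (l c : R) : is_lim_seq u l -> l < c ->
  exists k0, forall k, (k0 <= k)%nat -> u k < c.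
Proof.
  intros h hl. apply is_lim_seq_spec in h. destruct (h (mkposreal (c - l) ltac:(lra))) as [k0 hk].
  exists k0. intros k hk'. specialize (hk k hk'). simpl in hk. apply Rabs_def2 in hk. lra.
Qed.

Lemma RInt_Rplus (f g : R -> R) a b : (forall t, continuous f t) -> (forall t, continuous g t) ->
  RInt (fun t => f t + g t) a b = RInt f a b + RInt g a b.
Proof. intros hf hg. apply (RInt_plus (V := R_CompleteNormedModule)); now apply continuous_ex_RInt. Qed.

Lemma RInt_Rscal (f : R -> R) c a b : (forall t, continuous f t) ->
  RInt (fun t => c * f t) a b = c * RInt f a b.
Proof. intros hf. apply (RInt_scal (V := R_CompleteNormedModule)); now apply continuous_ex_RInt. Qed.

Lemma continuous_rsum {I : Type} (f : I -> R -> R) l t : (forall i, continuous (f i) t) ->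
  continuous (fun s => rsum (fun i => f i s) l) t.
Proof.
  intros h. induction l as [|i l IH]; [apply continuous_const|]. now apply continuous_Rplus.
Qed.

Lemma RInt_rsum {I : Type} (f : I -> R -> R) l a b : (forall i t, continuous (f i) t) ->
  RInt (fun t => rsum (fun i => f i t) l) a b = rsum (fun i => RInt (f i) a b) l.
Proof.
  intros h. induction l as [|i l IH].
  - unfold rsum; simpl. rewrite RInt_const. apply Rminus_diag_uniq. unfold scal; simpl. unfold mult; simpl. ring.
  - rewrite rsum_cons, <- IH, <- RInt_Rplus; auto. intros t; apply continuous_rsum; auto.
Qed.

Lemma continuous_cos_scaled x t : continuous (fun s => cos (x * s)) t.
Proof.
  apply (ex_derive_continuous (V := R_NormedModule) (fun s : R => cos (x * s))).
  auto_derive. exact I.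
Qed.

Lemma continuous_sin_scaled x t : continuous (fun s => sin (x * s)) t.
Proof.
  apply (ex_derive_continuous (V := R_NormedModule) (fun s : R => sin (x * s))).
  auto_derive. exact I.
Qed.

(* Real and imaginary part of the pairing of [conj f] with [e^(i x t)]. *)
Definition pair_re (l : list (C * R)) (x s : R) : R := eRe l s 0 * cos (x * s) + eIm l s 0 * sin (x * s).
Definition pair_im (l : list (C * R)) (x s : R) : R := eRe l s 0 * sin (x * s) - eIm l s 0 * cos (x * s).

Lemma pair_re_continuous l x t : continuous (pair_re l x) t.
Proof.
  apply continuous_Rplus; apply continuous_Rmult; auto using eRe_continuous, eIm_continuous,
    continuous_cos_scaled, continuous_sin_scaled.
Qed.

Lemma pair_im_continuous l x t : continuous (pair_im l x) t.
Proof.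
  apply continuous_Rminus; apply continuous_Rmult; auto using eRe_continuous, eIm_continuous,
    continuous_cos_scaled, continuous_sin_scaled.
Qed.

(** The left side is the real part of [conj f] times the polynomial with coefficients [b]. Expanding
    it separates the constant term from a part that is real-linear in [b]. *)
Lemma pairing_expansion l b N t :
  eRe l t 0 * eRe (dirichlet_list b N) t 0 + eIm l t 0 * eIm (dirichlet_list b N) t 0 =
  eRe l t 0 + rsum (fun n => Re (b n) / INR n * pair_re l (ln (INR n)) t +
                             - (Im (b n) / INR n) * pair_im l (ln (INR n)) t) (seq 2 (N - 1)).
Proof.
  unfold dirichlet_list. unfold eRe at 2. unfold eIm at 2. rewrite !rsum_cons, !rsum_map.
  simpl fst; simpl snd. simpl Re; simpl Im.
  rewrite !Rmult_0_l, Ropp_0, exp_0, cos_0, sin_0, !Rmult_plus_distr_l, <- !rsum_scal.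
  rewrite (rsum_ext (fun n => Re (b n) / INR n * _ + _) (fun n =>
     eRe l t 0 * (exp (- (ln (INR n) * 0)) * (Re (b n) / INR n * cos (ln (INR n) * t) - Im (b n) / INR n * sin (ln (INR n) * t))) +
     eIm l t 0 * (exp (- (ln (INR n) * 0)) * (Re (b n) / INR n * sin (ln (INR n) * t) + Im (b n) / INR n * cos (ln (INR n) * t))))).
  - rewrite rsum_plus. ring.
  - intros n _. rewrite Rmult_0_r, Ropp_0, exp_0. unfold pair_re, pair_im. ring.
Qed.

Lemma dirichlet_list_affine a b N th t :
  let c n := (Cplus (a n) (Cmult (RtoC th) (Cminus (b n) (a n)))) in
  eRe (dirichlet_list c N) t 0 = eRe (dirichlet_list a N) t 0 +
     th * (eRe (dirichlet_list b N) t 0 - eRe (dirichlet_list a N) t 0) /\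
  eIm (dirichlet_list c N) t 0 = eIm (dirichlet_list a N) t 0 +
     th * (eIm (dirichlet_list b N) t 0 - eIm (dirichlet_list a N) t 0).
Proof.
  intros c.
  assert (hc : forall n, Re (c n) = Re (a n) + th * (Re (b n) - Re (a n)) /\
     Im (c n) = Im (a n) + th * (Im (b n) - Im (a n))).
  { intros n. unfold c. destruct (a n), (b n). unfold Cplus, Cmult, Cminus, Copp, Cplus, RtoC, Re, Im; simpl.
    split; ring. }
  clearbody c. unfold eRe, eIm, dirichlet_list. rewrite !rsum_cons, !rsum_map.
  assert (hgen : forall (F G K : nat -> R) X l, (forall n, In n l -> F n = G n + th * (K n - G n)) ->
    X + rsum F l = X + rsum G l + th * (X + rsum K l - (X + rsum G l))).
  { intros F G K X l h. rewrite (rsum_ext _ _ l h), rsum_plus, rsum_scal, rsum_minus. ring. }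
  split; apply hgen; intros n _; specialize (hc n); destruct hc as [e1 e2];
    unfold Re, Im in *; cbn [fst snd] in *; rewrite e1, e2; unfold Rdiv; ring.
Qed.

(** First-order condition on a convex set: moving from [a] towards an admissible [b] cannot lower
    the mean square, so the derivative [2 * RInt P] along the segment is nonnegative. *)
Lemma minimizer_variation H A N a b : 0 < H ->
  (forall n, (2 <= n <= N)%nat -> Cmod (a n) <= A n) ->
  (forall n, (2 <= n <= N)%nat -> Cmod (b n) <= A n) ->
  (forall v, mean_square_values A H N v -> mean_square H a N <= v) ->
  mean_square H a N <= RInt (fun t =>
    eRe (dirichlet_list a N) t 0 * eRe (dirichlet_list b N) t 0 +
    eIm (dirichlet_list a N) t 0 * eIm (dirichlet_list b N) t 0) 0 H.
Proof.
  intros hH ha hb hmin.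
  set (la := dirichlet_list a N) in *. set (lb := dirichlet_list b N) in *.
  set (P := fun t => (eRe la t 0 * eRe lb t 0 + eIm la t 0 * eIm lb t 0) + - 1 * esq la t 0).
  set (Q := fun t => (eRe lb t 0 - eRe la t 0) * (eRe lb t 0 - eRe la t 0) +
                     (eIm lb t 0 - eIm la t 0) * (eIm lb t 0 - eIm la t 0)).
  assert (cX : forall t, continuous (fun t => eRe la t 0 * eRe lb t 0 + eIm la t 0 * eIm lb t 0) t).
  { intros t. apply continuous_Rplus; apply continuous_Rmult; auto using eRe_continuous, eIm_continuous. }
  assert (cS : forall t, continuous (fun t => - 1 * esq la t 0) t).
  { intros t. apply continuous_Rmult; [apply continuous_const|apply esq_continuous]. }
  assert (cP : forall t, continuous P t) by (intros t; now apply continuous_Rplus).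
  assert (cQ : forall t, continuous Q t).
  { intros t. apply continuous_Rplus; apply continuous_Rmult; apply continuous_Rminus;
      auto using eRe_continuous, eIm_continuous. }
  assert (hP : RInt P 0 H = RInt (fun t => eRe la t 0 * eRe lb t 0 + eIm la t 0 * eIm lb t 0) 0 H - mean_square H a N).
  { unfold P. rewrite RInt_Rplus, RInt_Rscal by auto using esq_continuous. rewrite mean_square_esq. fold la.
    apply Rminus_diag_uniq. ring. }
  assert (hvar : forall th, 0 < th <= 1 -> 0 <= 2 * RInt P 0 H + th * RInt Q 0 H).
  { intros th hth.
    set (c := fun n => Cplus (a n) (Cmult (RtoC th) (Cminus (b n) (a n)))).
    assert (hc : mean_square_values A H N (mean_square H c N)).
    { exists c. split; [|reflexivity]. intros n hn. unfold c.
      replace (Cplus (a n) (Cmult (RtoC th) (Cminus (b n) (a n)))) with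
        (Cplus (Cmult (RtoC (1 - th)) (a n)) (Cmult (RtoC th) (b n))).
      - eapply Rle_trans; [apply Cmod_triangle|]. rewrite !Cmod_mult, !Cmod_R, !Rabs_pos_eq by lra.
        specialize (ha n hn). specialize (hb n hn). nra.
      - destruct (a n), (b n). unfold Cplus, Cmult, Cminus, Copp, Cplus, RtoC; simpl. f_equal; ring. }
    apply hmin in hc. rewrite !mean_square_esq in hc. fold la in hc.
    rewrite (RInt_ext (fun t => esq (dirichlet_list c N) t 0) (fun t => esq la t 0 + (2 * th * P t + th * th * Q t))) in hc.
    - rewrite !RInt_Rplus, !RInt_Rscal in hc; auto using esq_continuous.
      + apply Rmult_le_reg_l with th; lra.
      + intros t; apply continuous_Rmult; auto using continuous_const.
      + intros t; apply continuous_Rmult; auto using continuous_const.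
      + intros t; apply continuous_Rplus; apply continuous_Rmult; auto using continuous_const.
    - intros t _. destruct (dirichlet_list_affine a b N th t) as [h1 h2].
      unfold esq at 1. fold c in h1, h2. rewrite h1, h2. fold la lb. apply Rminus_diag_uniq. unfold P, Q, esq. ring. }
  assert (0 <= RInt P 0 H).
  { apply Rnot_lt_le; intros hneg.
    assert (h1 := hvar 1 ltac:(lra)).
    assert (hQ : 0 < RInt Q 0 H) by lra.
    (* The minimum point of the parabola [2 th P + th^2 Q], where its value is negative; if it lies
       beyond 1, the endpoint [th = 1] already contradicts [hvar]. *)
    set (th := - RInt P 0 H / RInt Q 0 H).
    assert (hth : 0 < th) by (unfold th; apply Rdiv_lt_0_compat; lra).
    assert (e : th * RInt Q 0 H = - RInt P 0 H) by (unfold th; field; lra).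
    destruct (Rle_lt_dec th 1) as [hle|hgt].
    - specialize (hvar th ltac:(lra)). lra.
    - nra. }
  lra.
Qed.

(** In the variational inequality take [b n] of modulus [A n] with the phase opposite to the pairing
    at [log n]: every term then contributes minus [A n / n] times the modulus of the pairing. *)
Lemma minimizer_duality H A N a : 0 < H -> (forall n, (1 <= n)%nat -> 0 < A n) ->
  (forall n, (2 <= n <= N)%nat -> Cmod (a n) <= A n) ->
  (forall v, mean_square_values A H N v -> mean_square H a N <= v) ->
  let l := dirichlet_list a N in
  mean_square H a N + rsum (fun n => A n / INR n *
     sqrt (RInt (pair_re l (ln (INR n))) 0 H ^ 2 + RInt (pair_im l (ln (INR n))) 0 H ^ 2)) (seq 2 (N - 1)) <=
  RInt (fun t => eRe l t 0) 0 H.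
Proof.
  intros hH hA ha hmin l.
  set (Fr := fun n => RInt (pair_re l (ln (INR n))) 0 H).
  set (Fi := fun n => RInt (pair_im l (ln (INR n))) 0 H).
  set (m := fun n => sqrt (Fr n ^ 2 + Fi n ^ 2)).
  (* the optimal phases; where the pairing vanishes, [/ 0 = 0] makes them harmless *)
  set (b := fun n => (- (A n * Fr n / m n), A n * Fi n / m n) : C).
  assert (hm0 : forall n, 0 <= Fr n ^ 2 + Fi n ^ 2).
  { intros n. pose proof (pow2_ge_0 (Fr n)). pose proof (pow2_ge_0 (Fi n)). lra. }
  assert (hm2 : forall n, m n ^ 2 = Fr n ^ 2 + Fi n ^ 2) by (intros n; apply pow2_sqrt; auto).
  assert (hmpos : forall n, 0 <= m n) by (intros n; apply sqrt_pos).
  assert (hb : forall n, (2 <= n <= N)%nat -> Cmod (b n) <= A n).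
  { intros n hn. pose proof (hA n ltac:(lia)). unfold b, Cmod. simpl fst; simpl snd.
    destruct (Req_dec (m n) 0) as [e|e].
    - rewrite e. unfold Rdiv. rewrite Rinv_0, !Rmult_0_r, Ropp_0.
      replace (0 ^ 2 + 0 ^ 2) with 0 by ring. rewrite sqrt_0. lra.
    - replace ((- (A n * Fr n / m n)) ^ 2 + (A n * Fi n / m n) ^ 2) with (A n ^ 2).
      + rewrite sqrt_pow2; lra.
      + replace ((- (A n * Fr n / m n)) ^ 2 + (A n * Fi n / m n) ^ 2) with (A n ^ 2 * (Fr n ^ 2 + Fi n ^ 2) / m n ^ 2)
          by (field; exact e).
        rewrite <- hm2. field. exact e. }
  pose proof (minimizer_variation H A N a b hH ha hb hmin) as hv. fold l in hv.
  rewrite (RInt_ext _ _ _ _ (fun t _ => pairing_expansion l b N t)) in hv.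
  assert (c0 : forall t, continuous (fun t => eRe l t 0) t) by (intros; apply eRe_continuous).
  assert (c1 : forall n t, continuous (fun t => Re (b n) / INR n * pair_re l (ln (INR n)) t) t).
  { intros n t. apply continuous_Rmult; [apply continuous_const|apply pair_re_continuous]. }
  assert (c2 : forall n t, continuous (fun t => - (Im (b n) / INR n) * pair_im l (ln (INR n)) t) t).
  { intros n t. apply continuous_Rmult; [apply continuous_const|apply pair_im_continuous]. }
  assert (c3 : forall n t, continuous (fun t => Re (b n) / INR n * pair_re l (ln (INR n)) t +
     - (Im (b n) / INR n) * pair_im l (ln (INR n)) t) t).
  { intros n t. now apply continuous_Rplus. }
  rewrite RInt_Rplus in hv; [|exact c0|intros t; now apply continuous_rsum].
  rewrite RInt_rsum in hv by exact c3.
  rewrite (rsum_ext _ (fun n => - 1 * (A n / INR n * m n))) in hv.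
  - rewrite rsum_scal in hv. unfold m, Fr, Fi in hv. lra.
  - intros n hn. apply in_seq in hn. rewrite RInt_Rplus by auto.
    rewrite (RInt_Rscal (pair_re l (ln (INR n)))) by (apply pair_re_continuous).
    rewrite (RInt_Rscal (pair_im l (ln (INR n)))) by (apply pair_im_continuous).
    fold (Fr n) (Fi n). unfold b; simpl Re; simpl Im.
    assert (hn0 : INR n <> 0) by (apply not_0_INR; lia).
    destruct (Req_dec (m n) 0) as [e|e].
    + rewrite e. unfold Rdiv. rewrite Rinv_0. ring.
    + replace (- (A n * Fr n / m n) / INR n * Fr n + - (A n * Fi n / m n / INR n) * Fi n)
        with (- (A n / INR n) * ((Fr n ^ 2 + Fi n ^ 2) / m n)) by (field; auto).
      rewrite <- hm2. field. auto.
Qed.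

(* The Riemann sums of [int conj f(t) e^(i z t) dt], [f] the minimiser, are
   exponential sums in [z]. *)
Lemma dual_exponential_sum H A N mu l0 : 0 < H -> (forall n, (1 <= n)%nat -> 0 < A n) ->
  is_minimum (mean_square_values A H N) mu -> 0 < l0 -> l0 <= mu ->
  exists l, (forall p, In p l -> 0 <= snd p <= H) /\ mass l <= 2 * H /\ l0 / 2 <= eRe l 0 0 /\
    rsum (fun n => A n / INR n * sqrt (esq l (ln (INR n)) 0)) (seq 2 (N - 1)) <= 2 * H.
Proof.
  intros hH hA [[a [ha hmu]] hmin] hl0 hle.
  assert (hmin' : forall v, mean_square_values A H N v -> mean_square H a N <= v).
  { intros v hv. rewrite <- hmu. now apply hmin. }
  pose proof (minimizer_duality H A N a hH hA ha hmin') as hdual.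
  set (f := dirichlet_list a N) in *. cbv zeta in hdual. rewrite <- hmu in hdual.
  (* Times and frequencies change places: the nodes of the partition of [[0, H]] become the
     frequencies, and the coefficients are the conjugated values of [f] times the mesh. *)
  set (lst := fun k => map (fun i => ((H / INR k * eRe f (INR i * (H / INR k)) 0,
      - (H / INR k * eIm f (INR i * (H / INR k)) 0)) : C, INR i * (H / INR k))) (seq 0 k)).
  assert (hre : forall k x, eRe (lst k) x 0 = riemann H k (pair_re f x)).
  { intros k x. unfold eRe at 1, lst, riemann. rewrite rsum_map. apply rsum_ext. intros i _.
    unfold Re, Im; cbn [fst snd]. rewrite Rmult_0_r, Ropp_0, exp_0. unfold pair_re.
    rewrite (Rmult_comm x). ring. }
  assert (him : forall k x, eIm (lst k) x 0 = riemann H k (pair_im f x)).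
  { intros k x. unfold eIm at 1, lst, riemann. rewrite rsum_map. apply rsum_ext. intros i _.
    unfold Re, Im; cbn [fst snd]. rewrite Rmult_0_r, Ropp_0, exp_0. unfold pair_im.
    rewrite (Rmult_comm x). ring. }
  (* [(1 + |f|^2) / 2] dominates both [|f|] and the real part of [f]. Its integral is
     [(H + mu) / 2 <= H], where [mu <= H] comes from the zero coefficients. *)
  assert (cE : forall t, continuous (fun t => / 2 * (1 + esq f t 0)) t).
  { intros t. apply continuous_Rmult; [apply continuous_const|].
    apply continuous_Rplus; [apply continuous_const|apply esq_continuous]. }
  assert (hmuH : mu <= H).
  { apply hmin. exists (fun _ => 0%C). split.
    - intros n hn. rewrite Cmod_0. left; apply hA; lia.
    - rewrite mean_square_esq, (RInt_ext _ (fun _ => 1)).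
      + rewrite RInt_const. apply Rminus_diag_uniq. unfold scal; simpl. unfold mult; simpl. ring.
      + intros t _. unfold esq, eRe, eIm, dirichlet_list. rewrite !rsum_cons, !rsum_map.
        assert (e : forall F : nat -> R, (forall n, F n = 0) -> rsum F (seq 2 (N - 1)) = 0).
        { intros F hF. rewrite (rsum_ext F (fun _ => 0)), rsum_const by auto. ring. }
        rewrite !e.
        * simpl. rewrite !Rmult_0_l, Ropp_0, exp_0, cos_0, sin_0. ring.
        * intros n. simpl. unfold Rdiv. ring.
        * intros n. simpl. unfold Rdiv. ring. }
  assert (hintE : RInt (fun t => / 2 * (1 + esq f t 0)) 0 H = (H + mu) / 2).
  { rewrite (RInt_Rscal (fun t => 1 + esq f t 0)).
    - rewrite (RInt_Rplus (fun _ => 1)) by (intros; apply continuous_const || apply esq_continuous).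
      rewrite RInt_const, hmu, mean_square_esq. fold f. apply Rminus_diag_uniq. unfold scal; simpl. unfold mult; simpl. field.
    - intros t. apply continuous_Rplus; [apply continuous_const|apply esq_continuous]. }
  assert (hintu : RInt (fun t => eRe f t 0) 0 H <= (H + mu) / 2).
  { rewrite <- hintE. apply RInt_le; [lra| | |].
    - apply continuous_ex_RInt. intros; apply eRe_continuous.
    - apply continuous_ex_RInt. exact cE.
    - intros t _. unfold esq. pose proof (pow2_ge_0 (eRe f t 0 - 1)). pose proof (pow2_ge_0 (eIm f t 0)). nra. }
  set (G := fun n => sqrt (RInt (pair_re f (ln (INR n))) 0 H ^ 2 + RInt (pair_im f (ln (INR n))) 0 H ^ 2)).
  assert (hGnn : 0 <= rsum (fun n => A n / INR n * G n) (seq 2 (N - 1))).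
  { apply rsum_nonneg. intros n hn. apply in_seq in hn. apply Rmult_le_pos; [|apply sqrt_pos].
    apply Rmult_le_pos; [left; apply hA; lia|left; apply Rinv_0_lt_compat, lt_0_INR; lia]. }
  fold G in hdual. change (mu + rsum (fun n => A n / INR n * G n) (seq 2 (N - 1)) <= RInt (fun t => eRe f t 0) 0 H) in hdual.
  assert (L1 : is_lim_seq (fun k => rsum (fun n => A n / INR n * sqrt (esq (lst (S k)) (ln (INR n)) 0)) (seq 2 (N - 1)))
     (rsum (fun n => A n / INR n * G n) (seq 2 (N - 1)))).
  { apply (is_lim_seq_rsum (fun k n => A n / INR n * sqrt (esq (lst (S k)) (ln (INR n)) 0)) (fun n => A n / INR n * G n)).
    intros n. apply (is_lim_seq_scal_l (fun k => sqrt (esq (lst (S k)) (ln (INR n)) 0)) _ (G n)).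
    apply (is_lim_seq_continuous sqrt).
    - apply continuity_pt_sqrt. pose proof (pow2_ge_0 (RInt (pair_re f (ln (INR n))) 0 H)).
      pose proof (pow2_ge_0 (RInt (pair_im f (ln (INR n))) 0 H)). lra.
    - apply (is_lim_seq_ext (fun k => riemann H (S k) (pair_re f (ln (INR n))) * riemann H (S k) (pair_re f (ln (INR n))) +
         riemann H (S k) (pair_im f (ln (INR n))) * riemann H (S k) (pair_im f (ln (INR n))))).
      + intros k. unfold esq. rewrite hre, him. ring.
      + replace (RInt (pair_re f (ln (INR n))) 0 H ^ 2 + RInt (pair_im f (ln (INR n))) 0 H ^ 2)
          with (RInt (pair_re f (ln (INR n))) 0 H * RInt (pair_re f (ln (INR n))) 0 H +
             RInt (pair_im f (ln (INR n))) 0 H * RInt (pair_im f (ln (INR n))) 0 H) by ring.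
        pose proof (riemann_limit H (pair_re f (ln (INR n))) hH (pair_re_continuous f _)) as r1.
        pose proof (riemann_limit H (pair_im f (ln (INR n))) hH (pair_im_continuous f _)) as r2.
        apply is_lim_seq_plus'; apply is_lim_seq_mult'; assumption. }
  assert (L2 : is_lim_seq (fun k => riemann H (S k) (fun t => / 2 * (1 + esq f t 0))) ((H + mu) / 2)).
  { rewrite <- hintE. apply riemann_limit; auto. }
  assert (L3 : is_lim_seq (fun k => - eRe (lst (S k)) 0 0) (- RInt (fun t => eRe f t 0) 0 H)).
  { apply (is_lim_seq_opp _ (RInt (fun t => eRe f t 0) 0 H)).
    apply (is_lim_seq_ext (fun k => riemann H (S k) (fun t => eRe f t 0))).
    - intros k. rewrite hre. unfold riemann. apply rsum_ext. intros i _. unfold pair_re.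
      rewrite Rmult_0_l, cos_0, sin_0. ring.
    - apply riemann_limit; auto. intros; apply eRe_continuous. }
  (* The limits satisfy bounds with [H] and [l0]; the slack in [2 H] and [l0 / 2] lets one fine
     partition meet all three requirements. *)
  destruct (is_lim_seq_eventually_lt _ _ (2 * H) L1 ltac:(lra)) as [k1 h1].
  destruct (is_lim_seq_eventually_lt _ _ (2 * H) L2 ltac:(lra)) as [k2 h2].
  destruct (is_lim_seq_eventually_lt _ _ (- (l0 / 2)) L3 ltac:(lra)) as [k3 h3].
  set (k := (k1 + k2 + k3)%nat). specialize (h1 k ltac:(unfold k; lia)).
  specialize (h2 k ltac:(unfold k; lia)). specialize (h3 k ltac:(unfold k; lia)).
  assert (hk : 0 < INR (S k)) by (apply lt_0_INR; lia).
  assert (hw : 0 < H / INR (S k)) by (apply Rdiv_lt_0_compat; lra).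
  exists (lst (S k)). split; [|split; [|split]]; try lra.
  - intros p hp. apply in_map_iff in hp. destruct hp as [i [<- hi]]. apply in_seq in hi. cbn [snd].
    assert (INR i <= INR (S k)) by (apply le_INR; lia). pose proof (pos_INR i).
    split; [apply Rmult_le_pos; lra|].
    apply Rle_trans with (INR (S k) * (H / INR (S k))); [apply Rmult_le_compat_r; lra|right; field; lra].
  - eapply Rle_trans; [|left; exact h2]. unfold mass, lst, riemann. rewrite rsum_map. apply rsum_le.
    intros i _. cbn [fst]. set (t := INR i * (H / INR (S k))). set (w := H / INR (S k)) in *.
    replace (w * eRe f t 0, - (w * eIm f t 0)) with (Cmult (RtoC w) (eRe f t 0, - eIm f t 0)).
    + rewrite Cmod_mult, Cmod_R, Rabs_pos_eq by lra. apply Rmult_le_compat_l; [lra|].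
      set (z := Cmod (eRe f t 0, - eIm f t 0)).
      assert (hz : z ^ 2 = esq f t 0).
      { unfold z, Cmod, esq. cbn [fst snd]. rewrite pow2_sqrt; [ring|].
        pose proof (pow2_ge_0 (eRe f t 0)). pose proof (pow2_ge_0 (- eIm f t 0)). lra. }
      rewrite <- hz. pose proof (pow2_ge_0 (z - 1)). lra.
    + unfold Cmult, RtoC; cbn [fst snd]. apply f_equal2; ring.
Qed.

(** * Small samples in short windows *)

Lemma sum_n_m_rsum (f : nat -> R) a m : sum_n_m f a (a + m) = rsum f (seq a (S m)).
Proof.
  induction m as [|m IH].
  - rewrite Nat.add_0_r, sum_n_n. unfold rsum; simpl. lra.
  - rewrite <- plus_n_Sm, sum_n_Sm by lia. rewrite IH, (seq_S (S m)), rsum_app, rsum_cons.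
    change (rsum _ nil) with 0. rewrite <- plus_n_Sm. change plus with Rplus. lra.
Qed.

Lemma exp_ge_of_le a b : a <= b -> exp a <= exp b.
Proof. intros [h| ->]; [left; now apply exp_increasing|lra]. Qed.

(** A window of fixed relative length between [g / 2] and [g] becomes admissible once [log log T]
    exceeds [2 / g]; on the logarithmic scale it has length at most [2 g]. *)
Lemma window_choice delta T0 g : 0 < delta -> 0 < g <= / 2 ->
  exists s0, 0 <= s0 /\ forall s, s0 <= s -> exists T M : nat,
    admissible_window delta T0 T M /\ exp s < INR T <= exp s + 1 /\
    g * INR T / 2 <= INR M <= g * INR T /\ (2 <= T)%nat /\
    forall n, (T <= n <= T + M)%nat -> s <= ln (INR n) <= s + 2 * g.
Proof.
  intros hd hg.
  assert (hig : 2 <= / g) by (replace 2 with (/ / 2) by field; apply Rinv_le_contravar; lra).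
  (* As [T > e^s] and [s] is at least [e^(2/g + 1)], this forces [ln (ln T) >= 2 / g + 1]; the other
     summand takes care of [T0 <= T]. *)
  exists (exp (2 / g + 1) + Rabs T0).
  assert (hE := exp_ineq1_le (2 / g + 1)). pose proof (Rabs_pos T0). pose proof (Rle_abs T0).
  assert (h2g : 2 / g = 2 * / g) by reflexivity.
  split; [lra|]. intros s hs.
  assert (hes := exp_ineq1_le s).
  destruct (nfloor_ex (exp s)) as [T' [hT1 hT2]]; [lra|].
  set (T := S T'). assert (hT : exp s < INR T <= exp s + 1) by (unfold T; rewrite S_INR; lra).
  destruct (nfloor_ex (g * INR T)) as [M [hM1 hM2]]; [nra|].
  assert (hgT : 2 <= g * INR T).
  { replace 2 with (g * (2 / g)) by (field; lra). apply Rmult_le_compat_l; lra. }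
  exists T, M.
  assert (hM : g * INR T / 2 <= INR M <= g * INR T) by lra.
  assert (hs0 : 0 < s) by lra.
  assert (hlnT : s < ln (INR T)).
  { rewrite <- (ln_exp s). apply ln_increasing; [apply exp_pos|lra]. }
  assert (hll : 2 / g + 1 <= ln (ln (INR T))).
  { rewrite <- (ln_exp (2 / g + 1)). apply ln_le; [apply exp_pos|]. lra. }
  assert (hMT : (M <= T)%nat) by (apply INR_le; nra).
  split; [|split; [exact hT|split; [exact hM|split]]].
  - split; [unfold T; lia|]. split; [apply INR_le; change (INR 1) with 1; lra|]. split; [lra|]. split; [|exact hMT].
    assert (hr : 2 / g <= Rpower (ln (ln (INR T))) (1 + delta)).
    { apply Rle_trans with (ln (ln (INR T))); [lra|].
      rewrite <- (Rpower_1 (ln (ln (INR T)))) at 1 by lra. apply Rle_Rpower; lra. }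
    eapply Rle_trans; [|apply hM].
    replace (g * INR T / 2) with (INR T / (2 / g)) by (field; lra).
    apply Rmult_le_compat_l; [lra|]. apply Rinv_le_contravar; lra.
  - apply INR_le. change (INR 2) with (1 + 1). lra.
  - intros n [hn1 hn2]. apply le_INR in hn1. apply le_INR in hn2. rewrite plus_INR in hn2.
    split; [left; eapply Rlt_le_trans; [exact hlnT|apply ln_le; lra]|].
    rewrite <- (ln_exp (s + 2 * g)). apply ln_le; [lra|].
    assert (hinv : 1 <= g * exp s).
    { replace 1 with (g * / g) by (field; lra). apply Rmult_le_compat_l; lra. }
    assert (h1 : INR n <= exp s * ((1 + g) * (1 + g))) by nra.
    eapply Rle_trans; [exact h1|]. replace (s + 2 * g) with (s + (g + g)) by ring.
    rewrite exp_plus. apply Rmult_le_compat_l; [lra|]. rewrite exp_plus.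
    pose proof (exp_ineq1_le g). apply Rmult_le_compat; lra.
Qed.

Lemma rsum_sub_interval (f : nat -> R) T M N : (2 <= T)%nat -> (T + M <= N)%nat ->
  (forall n, (2 <= n)%nat -> 0 <= f n) -> rsum f (seq T (S M)) <= rsum f (seq 2 (N - 1)).
Proof.
  intros hT hN hf.
  replace (N - 1)%nat with ((T - 2) + (S M + (N - T - M)))%nat by lia.
  rewrite !seq_app, !rsum_app. replace (2 + (T - 2))%nat with T by lia.
  assert (0 <= rsum f (seq 2 (T - 2))) by (apply rsum_nonneg; intros n hn; apply in_seq in hn; apply hf; lia).
  assert (0 <= rsum f (seq (T + S M) (N - T - M))) by (apply rsum_nonneg; intros n hn; apply in_seq in hn; apply hf; lia).
  lra.
Qed.

(** If F were large at every [log n] in a window, the lower bound for the mean of [A] there would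
    push the weighted sum above [2 H]. The condition on [N] keeps the window, which ends at [2 T] at
    most, inside the range of summation. *)
Lemma small_samples H A delta T0 Phi c g :
  0 < H -> (forall n, (1 <= n)%nat -> 0 < A n) -> 0 < delta ->
  (forall n, (1 <= n)%nat -> 0 < Phi n) ->
  (forall m n, (1 <= m)%nat -> (m <= n)%nat -> Phi m <= Phi n) -> 0 < c ->
  (forall T M, admissible_window delta T0 T M -> c * Phi T <= window_mean A T M) ->
  0 < g <= / 2 ->
  exists s0 tau0, 0 <= s0 /\ 0 < tau0 /\ forall N l,
    rsum (fun n => A n / INR n * sqrt (esq l (ln (INR n)) 0)) (seq 2 (N - 1)) <= 2 * H ->
    forall j s, (1 <= j)%nat -> s0 <= s -> 2 * (exp s + 1) <= INR N -> INR j * ln 2 <= s ->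
      exists xi, s <= xi <= s + 2 * g /\ esq l xi 0 <= (tau0 * exp (- log_growth Phi j)) ^ 2.
Proof.
  intros hH hA hdelta hPhi hmono hc hwin hg.
  destruct (window_choice delta T0 g hdelta hg) as [s0 [hs0 hch]].
  assert (hP1 : 0 < Phi 1%nat) by (apply hPhi; lia).
  (* Since [1 / n >= 1 / (2 T)] and [M >= g T / 2], the window would contribute at least
     [(c g / 4) tau Phi T >= 9 H / 4], which is above [2 H]. *)
  set (tau0 := 9 * H / (c * g) / Phi 1%nat).
  assert (hcg : 0 < c * g) by nra.
  assert (htau0 : 0 < tau0) by (unfold tau0; repeat apply Rdiv_lt_0_compat; lra).
  exists s0, tau0. repeat split; auto.
  intros N l hsum j s hj hs hN hjs.
  destruct (hch s hs) as [T [M [hadm [hT [hM [hT2 hln]]]]]].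
  set (tau := tau0 * exp (- log_growth Phi j)).
  assert (htau : 0 < tau) by (apply Rmult_lt_0_compat; [exact htau0|apply exp_pos]).
  assert (hTpos : 0 < INR T) by (apply lt_0_INR; lia).
  apply NNPP; intros hno.
  assert (hbig : forall n, (T <= n <= T + M)%nat -> tau <= sqrt (esq l (ln (INR n)) 0)).
  { intros n hn. apply Rnot_lt_le; intros hlt. apply hno. exists (ln (INR n)). split; [now apply hln|].
    fold tau. rewrite <- (pow2_sqrt (esq l (ln (INR n)) 0)) by apply esq_nonneg.
    apply pow_incr. split; [apply sqrt_pos|lra]. }
  assert (hMT : (M <= T)%nat) by (apply hadm).
  assert (hTM : (T + M <= N)%nat).
  { apply INR_le. rewrite plus_INR. apply le_INR in hMT. lra. }
  assert (hsub : rsum (fun n => A n / INR n * sqrt (esq l (ln (INR n)) 0)) (seq T (S M)) <= 2 * H).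
  { eapply Rle_trans; [apply (rsum_sub_interval _ T M N hT2 hTM)|exact hsum].
    intros n hn. apply Rmult_le_pos; [|apply sqrt_pos].
    apply Rmult_le_pos; [left; apply hA; lia|left; apply Rinv_0_lt_compat, lt_0_INR; lia]. }
  assert (hlow : tau / (2 * INR T) * rsum A (seq T (S M)) <= 2 * H).
  { eapply Rle_trans; [|exact hsub]. rewrite <- rsum_scal. apply rsum_le. intros n hn. apply in_seq in hn.
    specialize (hbig n ltac:(lia)). pose proof (hA n ltac:(lia)).
    assert (hn0 : 0 < INR n) by (apply lt_0_INR; lia).
    assert (hn2 : INR n <= 2 * INR T) by (rewrite <- (mult_INR 2); apply le_INR; lia).
    replace (tau / (2 * INR T) * A n) with (A n * (/ (2 * INR T) * tau)) by (unfold Rdiv; ring).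
    unfold Rdiv. rewrite Rmult_assoc. apply Rmult_le_compat_l; [lra|].
    apply Rmult_le_compat; [left; apply Rinv_0_lt_compat; lra|lra| |exact hbig].
    apply Rinv_le_contravar; lra. }
  assert (hMpos : 0 < INR M) by (apply lt_0_INR; destruct hadm; lia).
  assert (hAw : c * Phi T * INR M <= rsum A (seq T (S M))).
  { specialize (hwin T M hadm). unfold window_mean in hwin. rewrite sum_n_m_rsum in hwin.
    apply Rmult_le_reg_l with (/ INR M); [now apply Rinv_0_lt_compat|].
    replace (/ INR M * (c * Phi T * INR M)) with (c * Phi T) by (field; lra). exact hwin. }
  assert (hPT : Phi (2 ^ j)%nat <= Phi T).
  { apply hmono; [pose proof (le_pow2 j); lia|]. apply INR_le. rewrite INR_pow2. left.
    eapply Rle_lt_trans; [|apply hT]. rewrite <- (exp_ln (2 ^ j)) by (apply pow_lt; lra).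
    rewrite ln_pow by lra. now apply exp_ge_of_le. }
  assert (hP2 : 0 < Phi (2 ^ j)%nat) by (apply hPhi; pose proof (le_pow2 j); lia).
  assert (e : tau * Phi (2 ^ j)%nat = 9 * H / (c * g)).
  { unfold tau, tau0. rewrite exp_neg_log_growth by assumption. field. repeat split; lra. }
  assert (h1 : 9 * H / (c * g) <= tau * Phi T) by (rewrite <- e; apply Rmult_le_compat_l; lra).
  assert (h2 : tau / (2 * INR T) * (c * Phi T * (g * INR T / 2)) <= 2 * H).
  { eapply Rle_trans; [|exact hlow]. apply Rmult_le_compat_l.
    - left; apply Rdiv_lt_0_compat; lra.
    - eapply Rle_trans; [|exact hAw]. apply Rmult_le_compat_l; [|lra]. apply Rmult_le_pos; lra. }
  replace (tau / (2 * INR T) * (c * Phi T * (g * INR T / 2))) with (c * g / 4 * (tau * Phi T)) in h2 by (field; lra).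
  assert (h3 : c * g / 4 * (9 * H / (c * g)) <= c * g / 4 * (tau * Phi T)) by (apply Rmult_le_compat_l; lra).
  replace (c * g / 4 * (9 * H / (c * g))) with (9 * H / 4) in h3 by (field; lra). lra.
Qed.

Lemma log_growth_mono Phi : (forall n, (1 <= n)%nat -> 0 < Phi n) ->
  (forall m n, (1 <= m)%nat -> (m <= n)%nat -> Phi m <= Phi n) ->
  (forall j, 0 <= log_growth Phi j) /\ (forall i j, (i <= j)%nat -> log_growth Phi i <= log_growth Phi j).
Proof.
  intros hPhi hmono.
  assert (h : forall i j, (i <= j)%nat -> log_growth Phi i <= log_growth Phi j).
  { intros i j hij. unfold log_growth.
    assert (h1 : (1 <= 2 ^ i)%nat) by (pose proof (le_pow2 i); lia).
    pose proof (ln_le _ _ (hPhi _ h1) (hmono _ _ h1 (Nat.pow_le_mono_r 2 i j ltac:(lia) hij))). lra. }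
  split; [|exact h]. intros j. specialize (h O j ltac:(lia)). unfold log_growth at 1 in h. simpl in h. lra.
Qed.

Lemma positive_limit_imp_converges H A delta T0 Phi mu l :
  0 < H -> (forall n, (1 <= n)%nat -> 0 < A n) -> 0 < delta ->
  (forall n, (1 <= n)%nat -> 0 < Phi n) ->
  (forall m n, (1 <= m)%nat -> (m <= n)%nat -> Phi m <= Phi n) ->
  asymp_on (admissible_window delta T0) (window_mean A) (fun T _ => Phi T) ->
  (forall N, is_minimum (mean_square_values A H N) (mu N)) -> (forall N, l <= mu N) -> 0 < l ->
  exists B, forall J, rsum (fun j => log_growth Phi j / INR j ^ 2) (seq 1 J) <= B.
Proof.
  intros hH hA hdelta hPhi hmono [c [C [hc [hC hwin]]]] hmin hlmu hl.
  apply NNPP; intros hno.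
  destruct (log_growth_mono Phi hPhi hmono) as [hW0 hWm].
  (* The cap at [j] gives the linear growth that the kernel sum tolerates, and by
     [truncated_sum_diverges] it keeps the divergence. *)
  set (W := fun j => Rmin (log_growth Phi j) (INR j)).
  assert (hdiv : forall B, exists J, B <= rsum (fun j => W j / INR j ^ 2) (seq 1 J)).
  { apply truncated_sum_diverges; auto. intros B. apply NNPP; intros h. apply hno. exists B.
    intros J. apply Rnot_lt_le; intros hlt. apply h; exists J; auto. }
  set (g := Rmin (/ 2) (/ (3456 * H))).
  assert (hg : 0 < g <= / 2).
  { split; [apply Rmin_pos; [lra|apply Rinv_0_lt_compat; lra]|apply Rmin_l]. }
  assert (hgH : 3456 * (H * g) <= 1).
  { assert (h : g <= / (3456 * H)) by apply Rmin_r.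
    apply Rmult_le_compat_l with (r := 3456 * H) in h; [|lra]. rewrite Rinv_r in h by lra. lra. }
  destruct (small_samples H A delta T0 Phi c g hH hA hdelta hPhi hmono hc
    (fun T M h => proj1 (hwin T M h)) hg) as [s0 [tau0 [hs0 [htau0 hsmall]]]].
  assert (hWb : forall j, 0 <= W j <= INR j).
  { intros j. split; [apply Rmin_glb; [apply hW0|apply pos_INR]|apply Rmin_r]. }
  destruct (divergent_decay_impossible H (l / 2) (2 * H) s0 tau0 g W hH ltac:(lra) ltac:(lra) hs0 htau0
    ltac:(lra) hgH hWb hdiv) as [X hX].
  (* [X] does not depend on the exponential sum, so [N] can be taken large enough for all windows up
     to [X] before the minimiser for this [N] is formed. *)
  destruct (INR_unbounded (2 * (exp X + 1))) as [N hN].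
  destruct (dual_exponential_sum H A N (mu N) l hH hA (hmin N) hl (hlmu N)) as [le [h1 [h2 [h3 h4]]]].
  apply (hX le h1 h2 h3). intros j s hj hs hjs.
  assert (hexp : exp s <= exp X) by (apply exp_ge_of_le; lra).
  destruct (hsmall N le h4 j s hj ltac:(lra) ltac:(lra) hjs) as [xi [hxi1 hxi2]].
  exists xi. split; [exact hxi1|]. eapply Rle_trans; [exact hxi2|]. apply pow_incr.
  split; [apply Rmult_le_pos; [lra|left; apply exp_pos]|].
  apply Rmult_le_compat_l; [lra|]. apply exp_ge_of_le, Ropp_le_contravar, Rmin_l.
Qed.

(** * Smoothing by iterated averages *)

(** The factor by which the average over [[x - rho, x + rho]] multiplies the frequency [t]. *)
Definition sinc (rho t : R) : R := if Req_EM_T t 0 then 1 else sin (rho * t) / (rho * t).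

Definition avg (rho : R) (l : list (C * R)) : list (C * R) :=
  map (fun p => (Cmult (RtoC (sinc rho (snd p))) (fst p), snd p)) l.

Lemma sinc_integral rho t a b x : 0 < rho ->
  RInt (fun s => a * cos (t * s) + b * sin (t * s)) (x - rho) (x + rho) =
  2 * rho * (sinc rho t * (a * cos (t * x) + b * sin (t * x))).
Proof.
  intros hr. unfold sinc. destruct (Req_EM_T t 0) as [->|ht].
  - rewrite (RInt_ext _ (fun _ => a)).
    + rewrite RInt_const. apply Rminus_diag_uniq. unfold scal; simpl. unfold mult; simpl.
      rewrite !Rmult_0_l, cos_0, sin_0. ring.
    + intros s _. apply Rminus_diag_uniq. rewrite !Rmult_0_l, cos_0, sin_0. ring.
  - apply is_RInt_unique.
    replace (2 * rho * (sin (rho * t) / (rho * t) * (a * cos (t * x) + b * sin (t * x)))) with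
      ((a * sin (t * (x + rho)) - b * cos (t * (x + rho))) / t - (a * sin (t * (x - rho)) - b * cos (t * (x - rho))) / t).
    + apply (is_RInt_derive (V := R_CompleteNormedModule) (fun s : R => (a * sin (t * s) - b * cos (t * s)) / t)
        (fun s => a * cos (t * s) + b * sin (t * s))).
      * intros s _. change (is_derive (fun s : R => (a * sin (t * s) - b * cos (t * s)) / t) s
          (a * cos (t * s) + b * sin (t * s))). auto_derive; [exact I|]. field. exact ht.
      * intros s _. apply continuous_Rplus; (apply continuous_Rmult; [apply continuous_const|]).
        -- apply continuous_cos_scaled.
        -- apply continuous_sin_scaled.
    + rewrite Rmult_minus_distr_l, Rmult_plus_distr_l.
      rewrite sin_plus, sin_minus, cos_plus, cos_minus, (Rmult_comm rho t). field. split; [lra|exact ht].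
Qed.

Lemma avg_integral rho l x : 0 < rho ->
  RInt (fun s => eRe l s 0) (x - rho) (x + rho) = 2 * rho * eRe (avg rho l) x 0 /\
  RInt (fun s => eIm l s 0) (x - rho) (x + rho) = 2 * rho * eIm (avg rho l) x 0.
Proof.
  intros hr.
  assert (hgen : forall f g : C * R -> R,
    RInt (fun s => rsum (fun p => f p * cos (snd p * s) + g p * sin (snd p * s)) l) (x - rho) (x + rho) =
    2 * rho * rsum (fun p => sinc rho (snd p) * (f p * cos (snd p * x) + g p * sin (snd p * x))) l).
  { intros f g. rewrite (RInt_rsum (fun p s => f p * cos (snd p * s) + g p * sin (snd p * s))).
    - rewrite <- rsum_scal. apply rsum_ext. intros p _. now apply sinc_integral.
    - intros p t. apply continuous_Rplus.
      + apply continuous_Rmult; [apply continuous_const|apply continuous_cos_scaled].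
      + apply continuous_Rmult; [apply continuous_const|apply continuous_sin_scaled]. }
  split.
  - rewrite (RInt_ext _ (fun s => rsum (fun p => Re (fst p) * cos (snd p * s) + - Im (fst p) * sin (snd p * s)) l)).
    + rewrite (hgen (fun p => Re (fst p)) (fun p => - Im (fst p))). f_equal. unfold eRe, avg. rewrite rsum_map.
      apply rsum_ext. intros [[a b] t] _. unfold Cmult, RtoC, Re, Im; cbn [fst snd].
      rewrite Rmult_0_r, Ropp_0, exp_0. ring.
    + intros s _. apply rsum_ext. intros p _. rewrite Rmult_0_r, Ropp_0, exp_0. ring.
  - rewrite (RInt_ext _ (fun s => rsum (fun p => Im (fst p) * cos (snd p * s) + Re (fst p) * sin (snd p * s)) l)).
    + rewrite (hgen (fun p => Im (fst p)) (fun p => Re (fst p))). f_equal. unfold eIm, avg. rewrite rsum_map.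
      apply rsum_ext. intros [[a b] t] _. unfold Cmult, RtoC, Re, Im; cbn [fst snd].
      rewrite Rmult_0_r, Ropp_0, exp_0. ring.
    + intros s _. apply rsum_ext. intros p _. rewrite Rmult_0_r, Ropp_0, exp_0. ring.
Qed.

(** Cauchy-Schwarz: the average paired with F is at most half the sum of both squares. This is how a
    bound on the integral becomes a pointwise one. *)
Lemma avg_mean_square rho l x : 0 < rho ->
  esq (avg rho l) x 0 <= / (2 * rho) * RInt (fun s => esq l s 0) (x - rho) (x + rho).
Proof.
  intros hr. destruct (avg_integral rho l x hr) as [h1 h2].
  set (p := eRe (avg rho l) x 0) in *. set (q := eIm (avg rho l) x 0) in *.
  assert (cu : forall t, continuous (fun s => p * eRe l s 0) t).
  { intros t. apply continuous_Rmult; [apply continuous_const|apply eRe_continuous]. }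
  assert (cv : forall t, continuous (fun s => q * eIm l s 0) t).
  { intros t. apply continuous_Rmult; [apply continuous_const|apply eIm_continuous]. }
  assert (ce : forall t, continuous (fun s => / 2 * esq l s 0) t).
  { intros t. apply continuous_Rmult; [apply continuous_const|apply esq_continuous]. }
  assert (hle : RInt (fun s => p * eRe l s 0 + q * eIm l s 0) (x - rho) (x + rho) <=
    RInt (fun s => (p ^ 2 + q ^ 2) / 2 + / 2 * esq l s 0) (x - rho) (x + rho)).
  { apply RInt_le; [lra| | |].
    - apply continuous_ex_RInt. intros t. apply continuous_Rplus; auto.
    - apply continuous_ex_RInt. intros t. apply continuous_Rplus; [apply continuous_const|apply ce].
    - intros s _. unfold esq. pose proof (pow2_ge_0 (p - eRe l s 0)). pose proof (pow2_ge_0 (q - eIm l s 0)). nra. }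
  rewrite (RInt_Rplus (fun s => p * eRe l s 0)) in hle by assumption.
  rewrite (RInt_Rplus (fun _ => (p ^ 2 + q ^ 2) / 2)) in hle by (assumption || (intros; apply continuous_const)).
  rewrite (RInt_Rscal (fun s => eRe l s 0)) in hle by (apply eRe_continuous).
  rewrite (RInt_Rscal (fun s => eIm l s 0)) in hle by (apply eIm_continuous).
  rewrite (RInt_Rscal (fun s => esq l s 0)) in hle by (apply esq_continuous).
  rewrite h1, h2, RInt_const in hle. unfold scal in hle; simpl in hle. unfold mult in hle; simpl in hle.
  set (I := RInt (fun s => esq l s 0) (x - rho) (x + rho)) in *.
  change (p ^ 2 + q ^ 2 <= / (2 * rho) * I).
  apply Rmult_le_reg_l with rho; [exact hr|].
  replace (rho * (/ (2 * rho) * I)) with (I / 2) by (field; lra). nra.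
Qed.

Definition avgs (rs : list R) (l : list (C * R)) : list (C * R) := fold_right avg l rs.

(** Each average costs its half-width [rho] at both ends of the interval, so the list costs
    [rsum id rs] altogether. *)
Lemma avgs_bound rs l lo up B : (forall rho, In rho rs -> 0 < rho) ->
  (forall s, lo - rsum id rs <= s <= up + rsum id rs -> esq l s 0 <= B) ->
  forall t, lo <= t <= up -> esq (avgs rs l) t 0 <= B.
Proof.
  revert lo up; induction rs as [|rho rs IH]; intros lo up hr hB t ht.
  - apply hB. unfold rsum; simpl; lra.
  - assert (hrho : 0 < rho) by (apply hr; now left).
    simpl avgs. eapply Rle_trans; [now apply avg_mean_square|].
    apply Rmult_le_reg_l with (2 * rho); [lra|]. rewrite <- Rmult_assoc, Rinv_r, Rmult_1_l by lra.
    apply Rle_trans with (RInt (fun _ => B) (t - rho) (t + rho)).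
    + apply RInt_le; [lra| | |].
      * apply continuous_ex_RInt, esq_continuous.
      * apply continuous_ex_RInt. intros; apply continuous_const.
      * intros s hs. apply (IH (lo - rho) (up + rho)); [intros; apply hr; now right| |lra].
        intros z hz. apply hB. rewrite rsum_cons. unfold id at 1 3. lra.
    + rewrite RInt_const. unfold scal; simpl. unfold mult; simpl. lra.
Qed.

Definition multiplier (rs : list R) (t : R) : R := fold_right (fun rho m => sinc rho t * m) 1 rs.

Lemma avgs_map rs l :
  avgs rs l = map (fun p => (Cmult (RtoC (multiplier rs (snd p))) (fst p), snd p)) l.
Proof.
  induction rs as [|rho rs IH].
  - simpl. rewrite <- (map_id l) at 1. apply map_ext. intros [d t]. cbn [fst snd]. now rewrite Cmult_1_l.
  - simpl avgs. rewrite IH. unfold avg. rewrite map_map. apply map_ext. intros [d t]. cbn [fst snd multiplier fold_right].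
    fold (multiplier rs t). now rewrite RtoC_mult, Cmult_assoc.
Qed.

Lemma sinc_zero rho : sinc rho 0 = 1.
Proof. unfold sinc. destruct (Req_EM_T 0 0); [reflexivity|lra]. Qed.

Lemma multiplier_zero rs : multiplier rs 0 = 1.
Proof. induction rs as [|rho rs IH]; [reflexivity|]. simpl. fold (multiplier rs 0). rewrite IH, sinc_zero. ring. Qed.

Lemma sin_abs_le x : 0 <= x -> Rabs (sin x) <= x.
Proof.
  intros hx. destruct (Req_dec x 0) as [->|h]; [rewrite sin_0, Rabs_R0; lra|].
  apply Rabs_le. split.
  - destruct (Rle_lt_dec 1 x) as [h1|h1]; [pose proof (SIN_bound x); lra|].
    pose proof PI_RGT_0. pose proof PI2_1. assert (0 <= sin x) by (apply sin_ge_0; lra). lra.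
  - left. apply sin_lt_x. lra.
Qed.

Lemma sinc_bounds rho t : 0 < rho -> 0 <= t -> Rabs (sinc rho t) <= 1 /\ (3 <= rho * t -> Rabs (sinc rho t) <= / 3).
Proof.
  intros hr ht. unfold sinc. destruct (Req_EM_T t 0) as [->|h].
  - rewrite Rabs_R1. split; [lra|]. rewrite Rmult_0_r. lra.
  - assert (hp : 0 < rho * t) by (apply Rmult_lt_0_compat; lra).
    unfold Rdiv. rewrite Rabs_mult, (Rabs_pos_eq (/ (rho * t))) by (left; now apply Rinv_0_lt_compat).
    split.
    + apply Rmult_le_reg_r with (rho * t); [exact hp|]. rewrite Rmult_assoc, Rinv_l by lra.
      pose proof (sin_abs_le (rho * t) ltac:(lra)). lra.
    + intros h3. assert (Rabs (sin (rho * t)) <= 1) by (apply Rabs_le, SIN_bound).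
      apply Rle_trans with (1 * / (rho * t)).
      * apply Rmult_le_compat_r; [left; now apply Rinv_0_lt_compat|assumption].
      * rewrite Rmult_1_l. apply Rinv_le_contravar; lra.
Qed.

Lemma multiplier_app rs1 rs2 t : multiplier (rs1 ++ rs2) t = multiplier rs1 t * multiplier rs2 t.
Proof.
  induction rs1 as [|rho rs IH]; [simpl; ring|].
  change (sinc rho t * multiplier (rs ++ rs2) t = sinc rho t * multiplier rs t * multiplier rs2 t).
  rewrite IH. ring.
Qed.

Lemma multiplier_le_1 rs t : (forall rho, In rho rs -> 0 < rho) -> 0 <= t -> Rabs (multiplier rs t) <= 1.
Proof.
  intros hr ht. induction rs as [|rho rs IH]; [simpl; rewrite Rabs_R1; lra|].
  simpl. fold (multiplier rs t). rewrite Rabs_mult.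
  destruct (sinc_bounds rho t) as [h _]; [apply hr; now left|exact ht|].
  specialize (IH (fun r hin => hr r (or_intror hin))).
  rewrite <- (Rmult_1_l 1). apply Rmult_le_compat; auto using Rabs_pos.
Qed.

Lemma multiplier_repeat rho m t : 0 < rho -> 0 <= t -> 3 <= rho * t ->
  Rabs (multiplier (repeat rho m) t) <= exp (- INR m).
Proof.
  intros hr ht h3. induction m as [|m IH]; [simpl; rewrite Rabs_R1, Ropp_0, exp_0; lra|].
  simpl repeat. unfold multiplier. simpl fold_right. fold (multiplier (repeat rho m) t).
  rewrite Rabs_mult, S_INR, Ropp_plus_distr, exp_plus, Rmult_comm.
  apply Rmult_le_compat; auto using Rabs_pos.
  destruct (sinc_bounds rho t hr ht) as [_ h]. eapply Rle_trans; [now apply h|].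
  rewrite exp_Ropp. apply Rinv_le_contravar; [apply exp_pos|apply exp_le_3].
Qed.

(** The half-width at scale [k] makes [rho t >= 3] for all [t >= 2^k ln 2]; every box then
    contributes a factor at most [1/3], which is below [1/e]. *)
Definition box_widths (M : nat -> nat) (ks : list nat) : list R :=
  flat_map (fun k => repeat (3 / (2 ^ k * ln 2)) (M k)) ks.

Lemma box_width_pos k : 0 < 3 / (2 ^ k * ln 2).
Proof.
  destruct ln2_bounds. apply Rdiv_lt_0_compat; [lra|]. apply Rmult_lt_0_compat; [apply pow_lt; lra|lra].
Qed.

Lemma box_widths_pos M ks rho : In rho (box_widths M ks) -> 0 < rho.
Proof.
  intros h. apply in_flat_map in h. destruct h as [k [_ h]]. apply repeat_spec in h. rewrite h. apply box_width_pos.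
Qed.

Lemma box_widths_sum M ks : rsum id (box_widths M ks) = rsum (fun k => INR (M k) * (3 / (2 ^ k * ln 2))) ks.
Proof.
  induction ks as [|k ks IH]; [reflexivity|]. simpl box_widths. rewrite rsum_app, rsum_cons. fold (box_widths M ks).
  rewrite IH. f_equal. generalize (M k) as m. intros m. induction m as [|m IHm]; [unfold rsum; simpl; ring|].
  simpl repeat. rewrite rsum_cons, IHm, S_INR. unfold id. ring.
Qed.

Lemma box_widths_multiplier M ks k t : In k ks -> 2 ^ k * ln 2 <= t ->
  Rabs (multiplier (box_widths M ks) t) <= exp (- INR (M k)).
Proof.
  intros hk ht. assert (hp : 0 < 2 ^ k * ln 2).
  { destruct ln2_bounds. apply Rmult_lt_0_compat; [apply pow_lt; lra|lra]. }
  induction ks as [|k' ks IH]; [destruct hk|].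
  simpl box_widths. rewrite multiplier_app, Rabs_mult. fold (box_widths M ks).
  destruct hk as [->|hk].
  - rewrite <- (Rmult_1_r (exp _)). apply Rmult_le_compat; auto using Rabs_pos.
    + apply multiplier_repeat; [apply box_width_pos|lra|].
      apply Rmult_le_reg_r with (2 ^ k * ln 2); [exact hp|].
      replace (3 / (2 ^ k * ln 2) * t * (2 ^ k * ln 2)) with (3 * t) by (field; split; [destruct ln2_bounds; lra|apply pow_nonzero; lra]).
      lra.
    + apply multiplier_le_1; [apply box_widths_pos|lra].
  - rewrite <- (Rmult_1_l (exp _)). apply Rmult_le_compat; auto using Rabs_pos.
    apply multiplier_le_1; [|lra]. intros rho hrho. apply repeat_spec in hrho. rewrite hrho. apply box_width_pos.
Qed.

Lemma small_tail (r : nat -> R) B eps : (forall k, 0 <= r k) -> (forall n, rsum r (seq 0 n) <= B) -> 0 < eps ->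
  exists k0, forall n, rsum r (seq k0 n) <= eps.
Proof.
  intros hr hB heps.
  set (E := fun x => exists n, x = rsum r (seq 0 n)).
  destruct (completeness E) as [m [hm1 hm2]].
  - exists B. intros x [n ->]. apply hB.
  - exists (rsum r (seq 0 0)), O. reflexivity.
  - assert (h : exists k0, m - eps < rsum r (seq 0 k0)).
    { apply NNPP; intros hno. assert (m <= m - eps); [|lra]. apply hm2. intros x [n ->].
      apply Rnot_lt_le; intros hl. apply hno; exists n; auto. }
    destruct h as [k0 hk0]. exists k0. intros n.
    assert (h : rsum r (seq 0 (k0 + n)) <= m) by (apply hm1; exists (k0 + n)%nat; reflexivity).
    rewrite seq_app, rsum_app in h. simpl (0 + k0)%nat in h. lra.
Qed.

Definition shift (tau : R) (l : list (C * R)) : list (C * R) :=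
  map (fun p => (Cmult (cos (snd p * tau), sin (snd p * tau)) (fst p), snd p)) l.

Lemma esq_shift tau l t : esq (shift tau l) t 0 = esq l (t + tau) 0.
Proof.
  unfold esq, eRe, eIm, shift. rewrite !rsum_map.
  f_equal; f_equal; apply rsum_ext; intros [[a b] w] _; unfold Cmult, Re, Im; cbn [fst snd];
    rewrite (Rmult_plus_distr_l w t tau), cos_plus, sin_plus; ring.
Qed.

Lemma linear_geometric_sum n : rsum (fun k => (2 * INR k + 3) / 2 ^ k) (seq 0 n) <= 10.
Proof.
  assert (h : rsum (fun k => (2 * INR k + 3) / 2 ^ k) (seq 0 n) = 10 - 2 * (2 * INR n + 5) / 2 ^ n).
  { induction n as [|n IH]; [unfold rsum; simpl; field|].
    rewrite seq_S, rsum_app, rsum_cons, IH, S_INR, Nat.add_0_l. change (rsum _ nil) with 0. cbn [pow].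
    field. apply pow_nonzero; lra. }
  rewrite h. assert (0 <= 2 * (2 * INR n + 5) / 2 ^ n); [|lra].
  apply Rmult_le_pos; [pose proof (pos_INR n); lra|]. left; apply Rinv_0_lt_compat, pow_lt; lra.
Qed.

(* At the dyadic scale [2^k <= j < 2^(k+1)], [M k] boxes of width [3 / (2^k ln 2)]
   gain the factor [e^(-M k)]. *)
Lemma smoothing_widths (W : nat -> R) H B : 0 < H -> (forall j, 0 <= W j) ->
  (forall i j, (i <= j)%nat -> W i <= W j) ->
  (forall J, rsum (fun j => W j / INR j ^ 2) (seq 1 J) <= B) ->
  exists j0, forall J, exists rs, (forall rho, In rho rs -> 0 < rho) /\ rsum id rs <= H / 8 /\
    forall j t, (j0 <= j <= J)%nat -> INR j * ln 2 <= t ->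
      Rabs (multiplier rs t) <= exp (- W j) * (1 / INR j ^ 2).
Proof.
  intros hH hpos hmono hB. destruct ln2_bounds as [l1 l2].
  (* By monotonicity [W (2^(k+1))] serves all [j] of the block. The extra [2 (k + 1)] gains
     [e^(-2(k+1)) <= 1 / j^2], as [j < 2^(k+1)], and so makes the result summable over [j]. *)
  set (V := fun k => W (2 ^ S k)%nat + 2 * INR (S k)).
  assert (hV : forall k, exists m, V k <= INR m <= V k + 1).
  { intros k. assert (hv0 : 0 <= V k) by (unfold V; pose proof (hpos (2 ^ S k)%nat); pose proof (pos_INR (S k)); lra).
    destruct (nfloor_ex (V k) hv0) as [m [h1 h2]]. exists (S m). rewrite S_INR. lra. }
  apply choice in hV. destruct hV as [M hM].
  set (r := fun k => INR (M k) * (3 / (2 ^ k * ln 2))).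
  assert (hr0 : forall k, 0 <= r k).
  { intros k. apply Rmult_le_pos; [apply pos_INR|left; apply box_width_pos]. }
  assert (hrB : forall n, rsum r (seq 0 n) <= 6 * (2 * (4 * B) + 10)).
  { intros n. apply Rle_trans with (6 * (2 * rsum (fun k => W (2 ^ k)%nat / 2 ^ k) (seq 1 n) +
        rsum (fun k => (2 * INR k + 3) / 2 ^ k) (seq 0 n))).
    - rewrite <- seq_shift, rsum_map, <- rsum_scal, <- rsum_plus, <- rsum_scal. apply rsum_le. intros k _.
      assert (hp : 0 < 2 ^ k) by (apply pow_lt; lra). destruct (hM k) as [_ h].
      unfold V in h. rewrite S_INR in h. unfold r.
      assert (hi : 3 / (2 ^ k * ln 2) <= 6 / 2 ^ k).
      { apply Rmult_le_reg_r with (2 ^ k * ln 2); [apply Rmult_lt_0_compat; lra|].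
        replace (3 / (2 ^ k * ln 2) * (2 ^ k * ln 2)) with 3 by (field; split; lra).
        replace (6 / 2 ^ k * (2 ^ k * ln 2)) with (6 * ln 2) by (field; lra). lra. }
      apply Rle_trans with (INR (M k) * (6 / 2 ^ k)).
      + apply Rmult_le_compat_l; [apply pos_INR|exact hi].
      + change (2 ^ S k) with (2 * 2 ^ k).
        replace (6 * (2 * (W (2 ^ S k)%nat / (2 * 2 ^ k)) + (2 * INR k + 3) / 2 ^ k))
          with ((W (2 ^ S k)%nat + 2 * INR k + 3) * (6 / 2 ^ k)) by (field; lra).
        apply Rmult_le_compat_r; [|lra]. left; apply Rdiv_lt_0_compat; lra.
    - pose proof (condensation_twice W B hpos hmono hB n). pose proof (linear_geometric_sum n). lra. }
  (* All scales together have finite width by [condensation_twice]. Dropping the first [k0] fits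
     them into [H / 8] and gives up the decay only for [j < 2^k0]. *)
  destruct (small_tail r _ (H / 8) hr0 hrB ltac:(lra)) as [k0 hk0].
  exists (2 ^ k0)%nat. intros J. exists (box_widths M (seq k0 (S J))).
  split; [intros rho; apply box_widths_pos|]. split; [rewrite box_widths_sum; apply hk0|].
  intros j t [hj1 hj2] ht.
  assert (hj : (1 <= j)%nat) by (pose proof (le_pow2 k0); lia).
  set (k := Nat.log2 j). destruct (Nat.log2_spec j) as [s1 s2]; [lia|]. fold k in s1, s2.
  assert (hk1 : (k0 <= k)%nat).
  { destruct (Nat.le_gt_cases k0 k) as [h|h]; [exact h|].
    pose proof (Nat.pow_le_mono_r 2 (S k) k0 ltac:(lia) ltac:(lia)). lia. }
  assert (hk2 : (k < k0 + S J)%nat) by (pose proof (le_pow2 k); lia).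
  eapply Rle_trans; [apply (box_widths_multiplier M _ k t)|].
  - apply in_seq. lia.
  - eapply Rle_trans; [|exact ht]. apply Rmult_le_compat_r; [lra|]. rewrite <- INR_pow2. now apply le_INR.
  - destruct (hM k) as [h _]. unfold V in h.
    assert (hWj : W j <= W (2 ^ S k)%nat) by (apply hmono; lia).
    apply Rle_trans with (exp (- W j + - (2 * INR (S k)))); [apply exp_ge_of_le; lra|].
    rewrite exp_plus. apply Rmult_le_compat_l; [left; apply exp_pos|].
    rewrite exp_Ropp. unfold Rdiv. rewrite Rmult_1_l.
    assert (hj0 : 0 < INR j) by (apply lt_0_INR; lia).
    apply Rinv_le_contravar; [apply pow_lt; lra|].
    replace (2 * INR (S k)) with (INR (S k) * 1 + INR (S k) * 1) by ring. rewrite exp_plus, exp_nat_pow.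
    assert (h2 : INR j <= exp 1 ^ S k).
    { apply Rle_trans with (2 ^ S k); [rewrite <- INR_pow2; apply le_INR; lia|].
      apply pow_incr. pose proof exp_ge_2. lra. }
    nra.
Qed.

(** * Bounded mass after smoothing and the lower bound *)

Lemma dyadic_window delta T0 : 0 < delta -> exists j1, forall j, (j1 <= j)%nat ->
  admissible_window delta T0 (2 ^ j) (2 ^ j).
Proof.
  intros hd. destruct (INR_unbounded (Rabs T0 + exp (exp 1))) as [j1 hj1]. exists j1. intros j hj.
  assert (h1 : (1 <= 2 ^ j)%nat) by (pose proof (le_pow2 j); lia).
  assert (h2 : INR j1 <= INR (2 ^ j)).
  { apply le_INR. pose proof (le_pow2 j). lia. }
  pose proof (Rabs_pos T0). pose proof (Rle_abs T0). pose proof (exp_pos (exp 1)). pose proof (exp_pos 1).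
  split; [exact h1|]. split; [exact h1|]. split; [lra|]. split; [|lia].
  set (x := INR (2 ^ j)) in *.
  assert (hl : 1 <= ln (ln x)).
  { rewrite <- (ln_exp 1). apply ln_le; [assumption|]. rewrite <- (ln_exp (exp 1)).
    apply ln_le; lra. }
  assert (hr : 1 <= Rpower (ln (ln x)) (1 + delta)).
  { apply Rle_trans with (ln (ln x)); [exact hl|].
    rewrite <- (Rpower_1 (ln (ln x))) at 1 by lra. apply Rle_Rpower; lra. }
  apply Rmult_le_reg_r with (Rpower (ln (ln x)) (1 + delta)); [lra|].
  unfold Rdiv. rewrite Rmult_assoc, Rinv_l by lra. nra.
Qed.

Lemma block_mass A delta T0 Phi C j (w : nat -> R) (E : R) :
  (forall n, (1 <= n)%nat -> 0 < A n) ->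
  admissible_window delta T0 (2 ^ j) (2 ^ j) ->
  window_mean A (2 ^ j) (2 ^ j) <= C * Phi (2 ^ j)%nat ->
  (forall n, (2 ^ j <= n < 2 ^ S j)%nat -> w n <= E) -> 0 <= E ->
  rsum (fun n => A n / INR n * w n) (seq (2 ^ j) (2 ^ j)) <= C * Phi (2 ^ j)%nat * E.
Proof.
  intros hA hadm hwin hw hE.
  assert (hx : 0 < INR (2 ^ j)) by (apply lt_0_INR; pose proof (le_pow2 j); lia).
  apply Rle_trans with (/ INR (2 ^ j) * E * rsum A (seq (2 ^ j) (2 ^ j))).
  - rewrite <- rsum_scal. apply rsum_le. intros n hn. apply in_seq in hn.
    specialize (hw n ltac:(simpl; lia)). pose proof (hA n ltac:(pose proof (le_pow2 j); lia)).
    assert (hn0 : INR (2 ^ j) <= INR n) by (apply le_INR; lia).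
    replace (/ INR (2 ^ j) * E * A n) with (A n * (/ INR (2 ^ j) * E)) by ring.
    unfold Rdiv. rewrite Rmult_assoc. apply Rmult_le_compat_l; [lra|].
    apply Rle_trans with (/ INR n * E).
    + apply Rmult_le_compat_l; [left; apply Rinv_0_lt_compat; lra|exact hw].
    + apply Rmult_le_compat_r; [exact hE|]. apply Rinv_le_contravar; lra.
  (* The window mean includes the right endpoint [2^(j+1)], which belongs to the next block; its
     positive term is dropped. *)
  - unfold window_mean in hwin. rewrite sum_n_m_rsum, seq_S, rsum_app, rsum_cons in hwin.
    change (rsum _ nil) with 0 in hwin.
    pose proof (hA (2 ^ j + 2 ^ j)%nat ltac:(pose proof (le_pow2 j); lia)) as hA2.
    assert (h0 : 0 < / INR (2 ^ j)) by now apply Rinv_0_lt_compat.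
    assert (h : / INR (2 ^ j) * rsum A (seq (2 ^ j) (2 ^ j)) <= C * Phi (2 ^ j)%nat) by nra.
    replace (/ INR (2 ^ j) * E * rsum A (seq (2 ^ j) (2 ^ j))) with (/ INR (2 ^ j) * rsum A (seq (2 ^ j) (2 ^ j)) * E) by ring.
    now apply Rmult_le_compat_r.
Qed.

(** In block [j] the factor [e^(- log_growth Phi j)] cancels [Phi (2^j)] up to [Phi 1] and leaves a
    multiple of [1 / j^2]. The boxes depend on [N], but [S0] does not. *)
Lemma smoothed_mass A delta T0 Phi C H B :
  0 < H -> (forall n, (1 <= n)%nat -> 0 < A n) -> 0 < delta ->
  (forall n, (1 <= n)%nat -> 0 < Phi n) ->
  (forall m n, (1 <= m)%nat -> (m <= n)%nat -> Phi m <= Phi n) -> 0 < C ->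
  (forall T M, admissible_window delta T0 T M -> window_mean A T M <= C * Phi T) ->
  (forall J, rsum (fun j => log_growth Phi j / INR j ^ 2) (seq 1 J) <= B) ->
  exists S0, 0 <= S0 /\ forall N, exists rs, (forall rho, In rho rs -> 0 < rho) /\ rsum id rs <= H / 8 /\
    rsum (fun n => A n / INR n * Rabs (multiplier rs (ln (INR n)))) (seq 2 (N - 1)) <= S0.
Proof.
  intros hH hA hd hPhi hmono hC hwin hB.
  destruct (log_growth_mono Phi hPhi hmono) as [hW0 hWm].
  destruct (smoothing_widths (log_growth Phi) H B hH hW0 hWm hB) as [j0 hrs].
  destruct (dyadic_window delta T0 hd) as [j1 hadm].
  assert (hP1 : 0 < Phi 1%nat) by (apply hPhi; lia).
  set (j2 := (j0 + j1)%nat).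
  set (Q := rsum (fun j => rsum (fun n => A n / INR n) (seq (2 ^ j) (2 ^ j))) (seq 1 j2)).
  assert (hAn : forall n, (1 <= n)%nat -> 0 <= A n / INR n).
  { intros n hn. apply Rmult_le_pos; [left; now apply hA|left; apply Rinv_0_lt_compat, lt_0_INR; lia]. }
  assert (hQ : 0 <= Q).
  { apply rsum_nonneg. intros j hj. apply rsum_nonneg. intros n hn. apply in_seq in hn. apply hAn.
    pose proof (le_pow2 j); lia. }
  assert (hCP : 0 < C * Phi 1%nat) by (apply Rmult_lt_0_compat; lra).
  exists (Q + C * Phi 1%nat * 2). split; [lra|].
  intros N. set (J := (j2 + N)%nat). destruct (hrs J) as [rs [h1 [h2 h3]]].
  exists rs. split; [exact h1|]. split; [exact h2|].
  set (f := fun n => A n / INR n * Rabs (multiplier rs (ln (INR n)))).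
  assert (hf : forall n, (1 <= n)%nat -> 0 <= f n).
  { intros n hn. apply Rmult_le_pos; [now apply hAn|apply Rabs_pos]. }
  apply Rle_trans with (rsum f (seq 2 (2 ^ S J - 2))).
  { apply rsum_seq_mono; [|intros; apply hf; lia]. pose proof (le_pow2 J). simpl. lia. }
  (* The first [j2] blocks, where decay or admissibility may fail, are finitely many independently
     of [N]; there the multiplier is bounded by 1. *)
  rewrite rsum_blocks. unfold J at 1. rewrite seq_app, rsum_app. apply Rplus_le_compat.
  - unfold Q. apply rsum_le. intros j hj. apply rsum_le. intros n hn. apply in_seq in hn.
    assert (hn1 : (1 <= n)%nat) by (pose proof (le_pow2 j); lia).
    rewrite <- (Rmult_1_r (A n / INR n)). apply Rmult_le_compat_l; [now apply hAn|].
    apply multiplier_le_1; [exact h1|]. rewrite <- ln_1. apply ln_le; [lra|]. now apply (le_INR 1).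
  - apply Rle_trans with (C * Phi 1%nat * rsum (fun j => 1 / INR j ^ 2) (seq (1 + j2) N)).
    + rewrite <- rsum_scal. apply rsum_le. intros j hj. apply in_seq in hj.
      assert (hjs : 0 < 1 / INR j ^ 2).
      { apply Rdiv_lt_0_compat; [lra|]. apply pow_lt, lt_0_INR; lia. }
      assert (hex : 0 < exp (- log_growth Phi j)) by apply exp_pos.
      eapply Rle_trans.
      * apply (block_mass A delta T0 Phi C j _ (exp (- log_growth Phi j) * (1 / INR j ^ 2)) hA).
        -- apply hadm; unfold j2 in hj; lia.
        -- apply hwin, hadm; unfold j2 in hj; lia.
        -- intros n hn. apply h3; [unfold J, j2 in *; lia|]. apply (ln_block j n); [lia|exact hn].
        -- apply Rmult_le_pos; lra.
      * assert (hP2 : 0 < Phi (2 ^ j)%nat) by (apply hPhi; pose proof (le_pow2 j); lia).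
        rewrite exp_neg_log_growth by assumption. right. field. split; [apply not_0_INR; lia|lra].
    + apply Rmult_le_compat_l; [lra|]. apply Rle_trans with (rsum (fun j => 1 / INR j ^ 2) (seq 1 (j2 + N))); [|apply inv_sq_sum].
      rewrite seq_app, rsum_app.
      assert (0 <= rsum (fun j => 1 / INR j ^ 2) (seq 1 j2)); [|lra].
      apply rsum_nonneg. intros j hj. apply in_seq in hj. left. apply Rdiv_lt_0_compat; [lra|]. apply pow_lt, lt_0_INR; lia.
Qed.

Lemma esq_RInt_sub l a b H : 0 <= a -> a <= b -> b <= H ->
  RInt (fun s => esq l s 0) a b <= RInt (fun s => esq l s 0) 0 H.
Proof.
  intros h0 h1 h2.
  assert (hex : forall x y, ex_RInt (fun s => esq l s 0) x y) by (intros; apply continuous_ex_RInt, esq_continuous).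
  rewrite <- (RInt_Chasles (fun s => esq l s 0) 0 a H), <- (RInt_Chasles (fun s => esq l s 0) a b H) by apply hex.
  change plus with Rplus.
  assert (0 <= RInt (fun s => esq l s 0) 0 a) by (apply RInt_ge_0; auto; intros; apply esq_nonneg).
  assert (0 <= RInt (fun s => esq l s 0) b H) by (apply RInt_ge_0; auto; intros; apply esq_nonneg).
  lra.
Qed.

(** The interval shrinks from [[0, H]] to [[H/8, 7H/8]] by the first average and to [[H/4, 3H/4]] by
    the others; centred at 0, it is the one of [uniqueness_bound] with [r = H / 4]. Averages keep
    the constant term 1. *)
Lemma converges_imp_lower_bound H A delta T0 Phi B :
  0 < H -> (forall n, (1 <= n)%nat -> 0 < A n) -> 0 < delta ->
  (forall n, (1 <= n)%nat -> 0 < Phi n) ->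
  (forall m n, (1 <= m)%nat -> (m <= n)%nat -> Phi m <= Phi n) ->
  asymp_on (admissible_window delta T0) (window_mean A) (fun T _ => Phi T) ->
  (forall J, rsum (fun j => log_growth Phi j / INR j ^ 2) (seq 1 J) <= B) ->
  exists m0, 0 < m0 /\ forall N v, mean_square_values A H N v -> m0 <= v.
Proof.
  intros hH hA hd hPhi hmono [c [K [hc [hK hwin]]]] hB.
  destruct (smoothed_mass A delta T0 Phi K H B hH hA hd hPhi hmono hK (fun T M h => proj2 (hwin T M h)) hB)
    as [S0 [hS0 hsm]].
  destruct (uniqueness_bound S0 (H / 4) hS0 ltac:(lra)) as [eps0 [heps0 huniq]].
  exists (eps0 * (H / 4)). split; [apply Rmult_lt_0_compat; lra|].
  intros N v [a [ha ->]]. rewrite mean_square_esq.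
  destruct (hsm N) as [rs [hrs1 [hrs2 hmass]]].
  set (f := dirichlet_list a N). set (v := RInt (fun t => esq f t 0) 0 H : R).
  (* [fold_right] applies the last entry first: the extra box of half-width [H / 8] turns the mean
     square into a pointwise bound, which the remaining averages preserve. *)
  set (rs' := rs ++ (H / 8 :: nil)).
  set (l' := map (fun n => (Cmult (cos (ln (INR n) * (H / 2)), sin (ln (INR n) * (H / 2)))
     (Cmult (RtoC (multiplier rs' (ln (INR n)))) (Re (a n) / INR n, Im (a n) / INR n)), ln (INR n))) (seq 2 (N - 1))).
  assert (hlist : shift (H / 2) (avgs rs' f) = (RtoC 1, 0) :: l').
  { rewrite avgs_map. unfold shift. rewrite map_map. unfold f, dirichlet_list. cbn [map fst snd]. f_equal.
    - rewrite multiplier_zero, Rmult_0_l, cos_0, sin_0. f_equal. change ((1, 0) : C) with (RtoC 1).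
      now rewrite !Cmult_1_l.
    - rewrite map_map. reflexivity. }
  assert (hfirst : forall t, H / 8 <= t <= 7 * H / 8 -> esq (avg (H / 8) f) t 0 <= 4 / H * v).
  { intros t ht. eapply Rle_trans; [apply avg_mean_square; lra|].
    replace (/ (2 * (H / 8))) with (4 / H) by (field; lra).
    apply Rmult_le_compat_l; [left; apply Rdiv_lt_0_compat; lra|]. apply esq_RInt_sub; lra. }
  assert (havgs : avgs rs' f = avgs rs (avg (H / 8) f)).
  { unfold avgs, rs'. now rewrite fold_right_app. }
  assert (hfin : eps0 <= 4 / H * v).
  { apply (huniq l').
    - intros p hp. apply in_map_iff in hp. destruct hp as [n [<- hn]]. apply in_seq in hn. cbn [snd].
      apply ln_le; [lra|]. apply (le_INR 2). lia.
    - eapply Rle_trans; [|exact hmass]. unfold mass, l'. rewrite rsum_map. apply rsum_le.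
      intros n hn. apply in_seq in hn. cbn [fst]. rewrite !Cmod_mult, dirichlet_term_mass, Cmod_R by lia.
      assert (e : Cmod (cos (ln (INR n) * (H / 2)), sin (ln (INR n) * (H / 2))) = 1).
      { unfold Cmod; cbn [fst snd]. rewrite <- sqrt_1. f_equal.
        pose proof (sin2_cos2 (ln (INR n) * (H / 2))) as h. unfold Rsqr in h. simpl; lra. }
      rewrite e, Rmult_1_l.
      assert (hln : 0 <= ln (INR n)).
      { rewrite <- ln_1. apply ln_le; [lra|]. apply (le_INR 1). lia. }
      assert (hm : Rabs (multiplier rs' (ln (INR n))) <= Rabs (multiplier rs (ln (INR n)))).
      { unfold rs'. rewrite multiplier_app, Rabs_mult.
        rewrite <- (Rmult_1_r (Rabs (multiplier rs (ln (INR n))))) at 2.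
        apply Rmult_le_compat_l; [apply Rabs_pos|]. apply multiplier_le_1; [|exact hln].
        intros rho [<-|[]]. lra. }
      assert (hn0 : 0 < INR n) by (apply lt_0_INR; lia).
      rewrite Rmult_comm. apply Rmult_le_compat; auto using Rabs_pos.
      + apply Rmult_le_pos; [apply Cmod_ge_0|left; now apply Rinv_0_lt_compat].
      + apply Rmult_le_compat_r; [left; now apply Rinv_0_lt_compat|]. apply ha; lia.
    - intros t ht. apply Rabs_le_between in ht. rewrite <- hlist, esq_shift, havgs.
      apply (avgs_bound rs _ (H / 4) (3 * H / 4)); [exact hrs1| |lra].
      intros s hs. apply hfirst. lra. }
  apply Rmult_le_compat_r with (r := H / 4) in hfin; [|lra].
  replace (4 / H * v * (H / 4)) with v in hfin by (field; lra). exact hfin.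
Qed.

Theorem theorem5 :
  forall (H : R) (A : nat -> R) (delta T0 : R) (Phi : nat -> R),
    0 < H ->
    (forall n : nat, (1 <= n)%nat -> 0 < A n) ->
    0 < delta ->
    (forall n : nat, (1 <= n)%nat -> 0 < Phi n) ->
    (forall m n : nat, (1 <= m)%nat -> (m <= n)%nat -> Phi m <= Phi n) ->
    asymp_on (admissible_window delta T0) (window_mean A) (fun T _ => Phi T) ->
    exists (mu : nat -> R) (l : R),
      (forall N : nat, is_minimum (mean_square_values A H N) (mu N)) /\
      is_lim_seq mu l /\
      (0 < l <->
       ex_series (fun k : nat =>
         ln (Phi (k + 2)%nat) / (INR (k + 2) * ln (INR (k + 2)) ^ 2))).
Proof.
  intros H A delta T0 Phi hH hA hd hPhi hmono has.
  destruct (minima_limit H A hH hA) as [mu [l [hmin [hlim hle]]]].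
  exists mu, l. split; [exact hmin|]. split; [exact hlim|].
  rewrite (log_series_condensed Phi hPhi hmono). split.
  - intros hl. now apply (positive_limit_imp_converges H A delta T0 Phi mu l).
  - intros [B hB].
    destruct (converges_imp_lower_bound H A delta T0 Phi B hH hA hd hPhi hmono has hB) as [m0 [hm0 hlow]].
    apply Rlt_le_trans with m0; [exact hm0|].
    apply (is_lim_seq_le (fun _ => m0) mu m0 l); [|apply is_lim_seq_const|exact hlim].
    intros N. apply (hlow N). apply hmin.
Qed.
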